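(* Let $(A,G,\alpha)$ be a pre-ordered Banach algebra dynamical system, with $A$ having a closed cone, a (not necessarily positive) bounded approximate right identity and a positive bounded approximate left identity. Let $\alpha$ be uniformly bounded and $\omega$ a weight on $G$. Let $X$ be a pre-ordered Banach space with closed cone. Then the following maps are mutual inverses between the positive non-degenerate continuous covariant representations $(\pi,U)$ of $(A,G,\alpha)$ on $X$ satisfying $\|U_r\|\le C_U\omega(r)$ for some $C_U\ge0$ and all $r\in G$, and the positive non-degenerate bounded representations $T:L^1(G,A,\omega;\alpha)\to B(X)$ of the pre-ordered generalized Beurling algebra $L^1(G,A,\omega;\alpha)$ on $X$: $$(\pi,U)\mapsto\left(f\mapsto\int_G\pi(f(r))U_r\,dr\right)=:T^{(\pi,U)}\qquad(f\in C_c(G,A)),$$ determining a positive non-degenerate bounded representation $T^{(\pi,U)}$ of $L^1(G,A,\omega;\alpha)$, and $$T\mapsto\left(\begin{array}{l}a\mapsto\text{SOT-}\lim_{(V,i)}T(z_V\otimes au_i),\\ s\mapsto\text{SOT-}\lim_{(V,i)}T(z_V(s^{-1}\cdot)\otimes u_i)\end{array}\right)=:(\pi^T,U^T),$$ where $\mathcal{Z}$ is a neighbourhood base of $e\in G$ of which all elements are contained in a fixed compact subset of $G$, $z_V\in C_c(G)$ is chosen such that $z_V\ge0$ is supported in $V\in\mathcal{Z}$ and $\int_Gz_V(r)\,dr=1$, and $(u_i)$ is any positive bounded approximate left identity of $A$. Furthermore, if $A$ has an $M$-bounded (not necessarily positive) approximate left identity, then the following bounds for $T^{(\pi,U)}$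 and $(\pi^T,U^T)$ hold: (1) $\|T^{(\pi,U)}\|\le C_U\|\pi\|$, (2) $\|\pi^T\|\le\left(\inf_{V\in\mathcal{Z}}\sup_{r\in V}\omega(r)\right)\|T\|$, (3) $\|U_s^T\|\le M\left(\inf_{V\in\mathcal{Z}}\sup_{r\in V}\omega(r)\right)\|T\|\,\omega(s)$ for all $s\in G$.
   Context: All vector spaces are real; algebras are associative and not assumed unital; locally compact groups are Hausdorff; $e$ is the identity of $G$. A cone in a vector space $V$ is a subset $C$ with $C+C\subseteq C$ and $\lambda C\subseteq C$ for all $\lambda\ge0$. A pre-ordered vector space is a vector space $V$ with a chosen cone $V_+$. A pre-ordered algebra is an algebra and pre-ordered vector space with $V_+\cdot V_+\subseteq V_+$; a pre-ordered Banach algebra is a pre-ordered algebra that is also a Banach algebra. For a pre-ordered normed space $X$, $B(X)_+=\{T\in B(X):TX_+\subseteq X_+\}$, and $\mathrm{Inv}_+(X)$ is the group of invertible $T\in B(X)$ with $T^{\pm1}X_+\subseteq X_+$. An approximate left identity is positive if its elements lie in the cone, and $M$-bounded if its elements have norm at most $M$. $\mathrm{Aut}_+(A)$ is the group of bounded automorphisms $\beta$ of $A$ with $\beta^{\pm1}(A_+)\subseteq A_+$. A pre-ordered Banach algebra dynamical system $(A,G,\alpha)$ consists of a pre-ordered Banach algebra $A$ with closed cone, a locally compact group $G$ and a strongly continuous homomorphism $\alpha:G\to\mathrm{Aut}_+(A)$; $\alpha$ is uniformly bounded if $\sup_{s\in G}\|\alpha_s\|<\infty$. A representation of an algebra $B$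 on $X$ is an algebra homomorphism $\pi:B\to B(X)$; it is non-degenerate if $\mathrm{span}\{\pi(b)x\}$ is dense in $X$ and positive if it maps $B_+$ into $B(X)_+$. A positive covariant representation of $(A,G,\alpha)$ on $X$ is a pair $(\pi,U)$ with $\pi:A\to B(X)$ a positive representation and $U:G\to\mathrm{Inv}_+(X)$ a homomorphism such that $\pi(\alpha_s(a))=U_s\pi(a)U_s^{-1}$; it is continuous if $\pi$ is bounded and $U$ strongly continuous, and non-degenerate if $\pi$ is. Operator-valued integrals are taken in the strong sense: $\left(\int_G\pi(f(r))U_r\,dr\right)x=\int_G\pi(f(r))U_rx\,dr$. A weight on $G$ is a non-zero submultiplicative Borel measurable function $\omega:G\to[0,\infty)$. $L^1(G,A,\omega)$ is the completion of $C_c(G,A)$ in the norm $\|h\|_{1,\omega}=\int_G\|h(s)\|\omega(s)\,ds$ (left Haar measure), with cone the closure of $C_c(G,A_+)$. If $\alpha$ is uniformly bounded, the twisted convolution $(f*g)(s)=\int_Gf(r)\alpha_r(g(r^{-1}s))\,dr$ on $C_c(G,A)$ extends to a continuous multiplication on $L^1(G,A,\omega)$; the resulting pre-ordered algebra, with norm $\|\cdot\|_{1,\omega}$, is the pre-ordered generalized Beurling algebra $L^1(G,A,\omega;\alpha)$. For $z\in C_c(G)=C_c(G,\mathbb{R})$ and $a\in A$, $(z\otimes a)(s)=z(s)a$; $z(s^{-1}\cdot)$ is the function $r\mapsto z(s^{-1}r)$. Pairs $(V,i)$ are directed by $(V,i)\le(W,j)$ iff $i\le j$ and $W\subseteq V$.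 SOT-lim is the limit in the strong operator topology. *)

(* Defs.v *)
From HB Require Import structures.
From mathcomp Require Import all_boot all_order all_algebra.
From mathcomp Require Import all_classical all_reals all_analysis.

Set Implicit Arguments.
Unset Strict Implicit.
Unset Printing Implicit Defensive.

Import Order.TTheory GRing.Theory Num.Theory.
Import numFieldNormedType.Exports.

Local Open Scope classical_set_scope.
Local Open Scope ring_scope.

(* The [point] of the underlying pointed type carries no information (a group
   is never empty); it is there because [g_sigma_algebraType] asks for it. *)
HB.mixin Record PreTopologicalGroup_isTopologicalGroup G
    & PointedTopological G & Group G := {
  mulg_continuous : continuous (fun p : G * G => (p.1 * p.2)%g) ;
  invg_continuous : continuous (fun s : G => (s^-1)%g) ;
}.

#[short(type="topologicalGroupType")]
HB.structure Definition TopologicalGroup :=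
  {G of PointedTopological G & Group G
      & PreTopologicalGroup_isTopologicalGroup G}.

Definition locally_compact_group (G : topologicalGroupType) :=
  hausdorff_space G /\ locally_compact [set: G].

Notation borel T := (g_sigma_algebraType (@open T)).

Record left_haar_measure (R : realType) (G : topologicalGroupType)
    (mu : {measure set (borel G) -> \bar R}) : Prop := {
  haar_neq0 : mu setT != 0%E ;
  haar_compact : forall K : set G, compact K -> (mu K < +oo)%E ;
  haar_outer_regular : forall E : set G, measurable (E : set (borel G)) ->
    mu E = ereal_inf [set mu O | O in [set O : set G | open O /\ E `<=` O]] ;
  haar_inner_regular : forall O : set G, open O ->
    mu O = ereal_sup [set mu K | K in [set K : set G | compact K /\ K `<=` O]] ;
  haar_left_invariant : forall (s : G) (E : set G),
    measurable (E : set (borel G)) -> mu [set (s * r)%g | r in E] = mu E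
}.

Definition weight (R : realType) (G : topologicalGroupType) (w : G -> R) :=
  [/\ forall s, 0 <= w s,
      exists s, w s != 0,
      forall s t, w (s * t)%g <= w s * w t &
      measurable_fun [set: borel G] (w : borel G -> R)].

(* Supremum of [N (f v)] over the closed unit ball. With [N] the norm of the
   target this is the operator norm; with [N := opnorm] it is the norm of a
   bounded linear map with values in B(X). Junk when the set is unbounded. *)
Definition unit_ball_sup (R : realType) (V : normedModType R) (W : Type)
    (N : W -> R) (f : V -> W) : R :=
  sup [set N (f v) | v in [set v : V | `|v| <= 1]].

Definition opnorm (R : realType) (V W : normedModType R) (f : V -> W) : R :=
  unit_ball_sup (fun y : W => `|y|) f.

Definition repnorm (R : realType) (B X : normedModType R) (pi : B -> X -> X) :=
  unit_ball_sup (@opnorm R X X) pi.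

Definition bounded_operator (R : realType) (V W : normedModType R)
    (f : V -> W) :=
  linear f /\ exists C : R, forall v, `|f v| <= C * `|v|.

Definition linear_span (R : realType) (V : normedModType R) (S : set V) :=
  [set v | exists (n : nat) (c : 'I_n -> R) (x : 'I_n -> V),
     (forall i, S (x i)) /\ v = \sum_(i < n) c i *: x i].

Definition is_cone (R : realType) (V : normedModType R) (C : set V) :=
  (forall x y, C x -> C y -> C (x + y)) /\
  (forall (l : R) x, 0 <= l -> C x -> C (l *: x)).

Definition algebra_mul (R : realType) (B : normedModType R)
    (mul : B -> B -> B) :=
  [/\ forall b, linear (mul b), forall b, linear (mul^~ b) & associative mul].

Definition preordered_banach_algebra (R : realType)
    (A : completeNormedModType R) (mul : A -> A -> A) (C : set A) :=
  [/\ algebra_mul mul,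
      forall a b, `|mul a b| <= `|a| * `|b|,
      is_cone C &
      forall a b, C a -> C b -> C (mul a b)].

Definition positive_automorphism (R : realType) (A : normedModType R)
    (mul : A -> A -> A) (C : set A) (beta : A -> A) :=
  [/\ bounded_operator beta,
      forall a b, beta (mul a b) = mul (beta a) (beta b) &
      exists gamma : A -> A,
        [/\ cancel beta gamma, cancel gamma beta,
            beta @` C `<=` C & gamma @` C `<=` C]].

Definition positive_operator (R : realType) (X : normedModType R) (C : set X)
    (T : X -> X) :=
  bounded_operator T /\ T @` C `<=` C.

Definition positive_invertible (R : realType) (X : normedModType R)
    (C : set X) (T : X -> X) :=
  positive_operator C T /\
  exists S : X -> X, [/\ positive_operator C S, cancel T S & cancel S T].

Definition dynamical_system (R : realType) (A : completeNormedModType R)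
    (mul : A -> A -> A) (C : set A) (G : topologicalGroupType)
    (alpha : G -> A -> A) :=
  [/\ preordered_banach_algebra mul C /\ closed C,
      locally_compact_group G,
      forall s, positive_automorphism mul C (alpha s),
      forall s t a, alpha (s * t)%g a = alpha s (alpha t a) &
      forall a, continuous (alpha^~ a)].

Definition uniformly_bounded (R : realType) (A : normedModType R) (G : Type)
    (alpha : G -> A -> A) :=
  has_ubound [set opnorm (alpha s) | s in [set: G]].

Definition directed (I : Type) (le : I -> I -> Prop) :=
  [/\ inhabited I, forall i, le i i,
      forall i j k, le i j -> le j k -> le i k &
      forall i j, exists2 k, le i k & le j k].

(* The filter generated by the tails of the preorder [le] on [D]: convergence
   of a map along it is convergence of the net indexed by [D]. *)
Definition tails (I : Type) (D : set I) (le : I -> I -> Prop) : set_system I :=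
  [set P | exists2 i0, D i0 & forall i, D i -> le i0 i -> P i].

Definition bounded_by (R : realType) (A : normedModType R) (I : Type)
    (u : I -> A) (M : R) := forall i, `|u i| <= M.

Definition approximate_left_identity (R : realType) (A : normedModType R)
    (mul : A -> A -> A) (I : Type) (le : I -> I -> Prop) (u : I -> A) :=
  directed le /\ forall a, mul (u i) a @[i --> tails setT le] --> a.

Definition approximate_right_identity (R : realType) (A : normedModType R)
    (mul : A -> A -> A) (I : Type) (le : I -> I -> Prop) (u : I -> A) :=
  directed le /\ forall a, mul a (u i) @[i --> tails setT le] --> a.

Definition has_bounded_approximate_right_identity (R : realType)
    (A : normedModType R) (mul : A -> A -> A) :=
  exists (I : Type) (le : I -> I -> Prop) (u : I -> A) (M : R),
    approximate_right_identity mul le u /\ bounded_by u M.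

Definition has_bounded_approximate_left_identity (R : realType)
    (A : normedModType R) (mul : A -> A -> A) (M : R) :=
  exists (I : Type) (le : I -> I -> Prop) (u : I -> A),
    approximate_left_identity mul le u /\ bounded_by u M.

Definition positive_bounded_approximate_left_identity (R : realType)
    (A : normedModType R) (mul : A -> A -> A) (C : set A)
    (I : Type) (le : I -> I -> Prop) (u : I -> A) :=
  [/\ approximate_left_identity mul le u,
      forall i, C (u i) &
      exists M : R, bounded_by u M].

Definition pair_le (T I : Type) (le : I -> I -> Prop) (p q : set T * I) :=
  le p.2 q.2 /\ q.1 `<=` p.1.

Definition pair_tails (T I : Type) (Z : set (set T)) (le : I -> I -> Prop) :=
  tails [set p : set T * I | Z p.1] (pair_le le).

Section bochner.
Context d (T : measurableType d) (R : realType) (X : normedModType R).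
Variable mu : {measure set T -> \bar R}.

Definition bochner_simple (s : T -> X) :=
  [/\ finite_set (range s),
      forall x, measurable (s @^-1` [set x]) &
      forall x, x != 0 -> (mu (s @^-1` [set x]) < +oo)%E].

(* The term at 0 vanishes, whatever the measure of the fibre. *)
Definition bochner_sintegral (s : T -> X) : X :=
  \sum_(x \in [set: X]) fine (mu (s @^-1` [set x])) *: x.

Definition bochner_integral_is (h : T -> X) (y : X) :=
  exists s_ : nat -> T -> X,
    [/\ forall n, bochner_simple (s_ n),
        forall n, measurable_fun setT (fun t => `|h t - s_ n t|),
        (\int[mu]_t `|h t - s_ n t|%:E)%E @[n --> \oo] --> 0%E &
        bochner_sintegral (s_ n) @[n --> \oo] --> y].

(* The value is 0 if [h] is not Bochner integrable; continuous compactly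
   supported functions are. *)
Definition bochner (h : T -> X) : X := xget 0 [set y | bochner_integral_is h y].

End bochner.

Definition supp (G : topologicalType) (V : nmodType) (f : G -> V) :=
  closure [set s | f s != 0].

Definition Cc (R : realType) (G : topologicalType) (V : normedModType R) :
    set (G -> V) :=
  [set f | continuous f /\ compact (supp f)].

Definition Cc_cone (R : realType) (G : topologicalType) (V : normedModType R)
    (C : set V) : set (G -> V) :=
  [set f | Cc f /\ forall s, C (f s)].

Definition tensor (R : realType) (G : Type) (V : normedModType R)
    (z : G -> R) (a : V) : G -> V := fun s => z s *: a.

Definition ltranslate (R : Type) (G : groupType) (s : G) (z : G -> R) :
  G -> R := fun r => z (s^-1 * r)%g.

Section beurling.
Context (R : realType) (G : topologicalGroupType).
Variable mu : {measure set (borel G) -> \bar R}.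
Variables (A : completeNormedModType R) (mulA : A -> A -> A) (coneA : set A).
Variables (alpha : G -> A -> A) (w : G -> R).

Definition norm1w (h : G -> A) : R := \int[mu]_s (`|h s| * w s).

Definition twisted_conv (f g : G -> A) : G -> A :=
  fun s => bochner mu (fun r : borel G =>
    mulA (f r) (alpha r (g (r^-1 * s)%g))).

(* [L] together with [iota : C_c(G, A) -> L] is a completion of C_c(G, A) for
   the norm [norm1w], and [mulL] is the continuous extension of the twisted
   convolution. Only the values of [iota] on [Cc] are relevant. *)
Record beurling_algebra (L : completeNormedModType R)
    (iota : (G -> A) -> L) (mulL : L -> L -> L) : Prop := {
  beurling_linear : forall (c : R) (f g : G -> A), Cc f -> Cc g ->
    iota (fun s => c *: f s + g s) = c *: iota f + iota g ;
  beurling_norm : forall f : G -> A, Cc f -> `|iota f| = norm1w f ;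
  beurling_dense : dense (iota @` (@Cc R G A)) ;
  beurling_mul : algebra_mul mulL ;
  beurling_mul_continuous : continuous (fun p : L * L => mulL p.1 p.2) ;
  beurling_conv : forall f g : G -> A, Cc f -> Cc g ->
    mulL (iota f) (iota g) = iota (twisted_conv f g)
}.

Definition beurling_cone (L : completeNormedModType R)
    (iota : (G -> A) -> L) : set L :=
  closure (iota @` (Cc_cone coneA)).

End beurling.

Definition representation (R : realType) (B X : normedModType R)
    (mul : B -> B -> B) (pi : B -> X -> X) :=
  [/\ forall b, bounded_operator (pi b),
      forall c b1 b2 x, pi (c *: b1 + b2) x = c *: pi b1 x + pi b2 x &
      forall b1 b2 x, pi (mul b1 b2) x = pi b1 (pi b2 x)].

Definition nondegenerate (R : realType) (B X : normedModType R)
    (pi : B -> X -> X) :=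
  dense (linear_span [set pi p.1 p.2 | p in [set: B * X]]).

Definition bounded_representation (R : realType) (B X : normedModType R)
    (pi : B -> X -> X) :=
  exists C : R, forall b, opnorm (pi b) <= C * `|b|.

Definition positive_representation (R : realType) (B X : normedModType R)
    (coneB : set B) (coneX : set X) (pi : B -> X -> X) :=
  forall b, coneB b -> positive_operator coneX (pi b).

Definition pos_nd_bounded_rep (R : realType) (B X : normedModType R)
    (mul : B -> B -> B) (coneB : set B) (coneX : set X) (T : B -> X -> X) :=
  [/\ representation mul T, positive_representation coneB coneX T,
      nondegenerate T & bounded_representation T].

Definition positive_covariant_rep (R : realType) (A X : normedModType R)
    (mulA : A -> A -> A) (coneA : set A) (coneX : set X)
    (G : groupType) (alpha : G -> A -> A)
    (pi : A -> X -> X) (U : G -> X -> X) :=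
  [/\ representation mulA pi,
      positive_representation coneA coneX pi,
      forall s, positive_invertible coneX (U s),
      forall s t x, U (s * t)%g x = U s (U t x) &
      forall s a x, pi (alpha s a) x = U s (pi a (U (s^-1)%g x))].

Definition growth_bound (R : realType) (X : normedModType R) (G : Type)
    (w : G -> R) (U : G -> X -> X) (CU : R) :=
  0 <= CU /\ forall r, opnorm (U r) <= CU * w r.

Definition pos_nd_cont_covariant_rep (R : realType) (A X : normedModType R)
    (mulA : A -> A -> A) (coneA : set A) (coneX : set X)
    (G : topologicalGroupType) (alpha : G -> A -> A) (w : G -> R)
    (pi : A -> X -> X) (U : G -> X -> X) :=
  [/\ positive_covariant_rep mulA coneA coneX alpha pi U,
      nondegenerate pi,
      bounded_representation pi,
      forall x, continuous (U^~ x) &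
      exists CU : R, growth_bound w U CU].

(* For f in C_c(G, A) the function r |-> pi (f r) (U r x) is integrable, with
   integral T (iota f) x: that is, T = T^(pi, U). *)
Definition integrated_form (R : realType) (G : topologicalGroupType)
    (mu : {measure set (borel G) -> \bar R}) (A X L : normedModType R)
    (iota : (G -> A) -> L) (pi : A -> X -> X) (U : G -> X -> X)
    (T : L -> X -> X) :=
  forall f : G -> A, Cc f ->
    forall x, bochner_integral_is mu (fun r : borel G => pi (f r) (U r x))
                                  (T (iota f) x).

(* The limits defining (pi^T, U^T) exist, and (pi, U) = (pi^T, U^T). *)
Definition disintegrated_form (R : realType) (G : topologicalGroupType)
    (A X L : normedModType R) (mulA : A -> A -> A) (iota : (G -> A) -> L)
    (Z : set (set G)) (z : set G -> G -> R)
    (I : Type) (le : I -> I -> Prop) (u : I -> A)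
    (T : L -> X -> X) (pi : A -> X -> X) (U : G -> X -> X) :=
  (forall a x,
     T (iota (tensor (z p.1) (mulA a (u p.2)))) x @[p --> pair_tails Z le]
       --> pi a x) /\
  (forall s x,
     T (iota (tensor (ltranslate s (z p.1)) (u p.2))) x @[p --> pair_tails Z le]
       --> U s x).

Definition small_nbhs_base (G : topologicalGroupType) (Z : set (set G)) :=
  [/\ forall V, Z V -> nbhs (1%g : G) V,
      forall W, nbhs (1%g : G) W -> exists2 V, Z V & V `<=` W &
      exists2 K : set G, compact K & forall V, Z V -> V `<=` K].

Definition bump_family (R : realType) (G : topologicalGroupType)
    (mu : {measure set (borel G) -> \bar R})
    (Z : set (set G)) (z : set G -> G -> R) :=
  forall V, Z V ->
    [/\ Cc (z V : G -> R), forall r, 0 <= z V r, supp (z V) `<=` V &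
        (\int[mu]_r (z V r)%:E)%E = 1%E].

Definition inf_sup_weight (R : realType) (G : Type) (Z : set (set G))
    (w : G -> R) : R :=
  inf [set sup (w @` V) | V in Z].

(* Main.v *)
Require Import Defs.
From mathcomp Require Import all_boot all_order all_algebra.
From mathcomp Require Import all_classical all_reals all_analysis.
From mathcomp Require Import measurable_realfun ring lra.

Set Implicit Arguments.
Unset Strict Implicit.
Unset Printing Implicit Defensive.

Import Order.TTheory GRing.Theory Num.Theory.
Import numFieldNormedType.Exports.

Local Open Scope classical_set_scope.
Local Open Scope ring_scope.

(** Integrating a covariant representation (pi, U) against functions gives
    [T f = \int pi (f r) U_r dr], and (pi, U) can be read off from T because T
    intertwines left multiplication in the algebra [L] with operators on [X].
    Everything happens on the vectors [T f x] with f continuous and compactly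
    supported, whose span is dense.

    Integrals. The integral of a continuous compactly supported function is the
    limit of its Riemann sums over partitions that are fine with respect to a
    neighbourhood of 1 ([riemann_sum_cvg]). Linearity, positivity and the
    commutation with bounded operators are thus inherited from finite sums, and
    so is [interchange]: an integral commutes with every linear map on the
    functions supported in a fixed compact set that is bounded for the uniform
    norm. It serves twice: as Fubini, for the multiplicativity of the integrated
    form ([integratedM]), and to see the twisted convolution f * g as the
    integral in [L] of the functions [f(r) alpha_r(g(r^-1 .))]
    ([generated_integrated_form]).

    Weights. A weight is only Borel measurable, but a Steinhaus argument bounds
    it on compact sets ([weight_compact]). On functions supported in a fixed
    compact set the norm of [L] is therefore dominated by the uniform norm
    ([iota_le]), and limits in [L] reduce to uniform limits ([iota_cvg]).

    From (pi, U) to T. The integrated form is bounded by [CU ||pi|| ||f||], so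
    it extends to [L] ([representation_exists]). If [pi b_i] converges strongly
    to Q, then [T (z_V(s^-1 .) (x) b_i)] converges strongly to [Q U_s], because
    [z_V(s^-1 .)] concentrates at s ([integrated_density_cvg]). This recovers pi
    and U, and shows that T is non-degenerate.

    From T to (pi, U). If b_i is bounded in A and [b_i c] tends to [beta c] for
    every c, then [(z_V(s^-1 .) (x) b_i) * f] tends in [L] to the function
    [t |-> beta (alpha_s (f (s^-1 t)))] ([density_conv_cvg]). The operators
    [T (z_V(s^-1 .) (x) b_i)] are bounded, hence converge strongly
    ([operator_net_limit]), and on the vectors [T f x] the limits act as A and G
    act on functions. The algebraic identities, the continuity and the
    non-degeneracy of (pi, U) follow from those of the actions on functions.

    Bounds. Since T is the integrated form of (pi, U), the limits may be
    computed along other nets: [pi a] with the constant net a, where only the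
    densities contribute to the constant, and [U_s] with any M-bounded
    approximate left identity. *)

(** * Integrals of functions with finitely many values *)

(** Dividing by [C + 1] spares the case [C = 0] in epsilon estimates. *)
Lemma mulr_divD1_le (R : realType) (C e : R) : 0 <= C -> 0 <= e ->
  C * (e / (C + 1)) <= e.
Proof.
by move=> C0 e0; rewrite mulrCA ler_piMr // ler_pdivrMr ?ltr_wpDl // mul1r
  lerDl.
Qed.

Section finitely_valued.
Context d (T : measurableType d) (R : realType).
Variable mu : {measure set T -> \bar R}.

Definition measurable_fibres (J : finType) (q : T -> J) :=
  forall j, measurable (q @^-1` [set j]).

Lemma measurable_fibres_preimage (J : finType) (q : T -> J) (D : set J) :
  measurable_fibres q -> measurable (q @^-1` D).
Proof.
move=> mq; rewrite -[D]image_id -bigcup_imset1 preimage_bigcup.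
by apply: fin_bigcup_measurable => // j _; exact: mq.
Qed.

Lemma measurable_fibres_comp (J : finType) (q : T -> J) d'
  (Y : measurableType d')
    (phi : J -> Y) :
  measurable_fibres q -> measurable_fun setT (phi \o q).
Proof.
move=> mq _ B mB; rewrite setTI comp_preimage.
exact: measurable_fibres_preimage.
Qed.

Lemma measurable_fibres_pair (J K : finType) (p : T -> J) (q : T -> K) :
  measurable_fibres p -> measurable_fibres q ->
  measurable_fibres (fun t => (p t, q t)).
Proof.
move=> mp mq [j k].
rewrite (_ : _ @^-1` _ = p @^-1` [set j] `&` q @^-1` [set k]).
  exact: measurableI.
by apply/seteqP; split => t /= [-> ->].
Qed.

Lemma ge0_integral_fibres (J : finType) (q : T -> J) (phi : J -> R) :
  measurable_fibres q -> (forall j, 0 <= phi j) ->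
  (\int[mu]_t (phi (q t))%:E = \sum_j (phi j)%:E * mu (q @^-1` [set j]))%E.
Proof.
move=> mq phi0.
have := @ge0_integral_bigsetU _ T R mu J (fun j => q @^-1` [set j])
  (fun t => (phi (q t))%:E) (index_enum J) mq (index_enum_uniq J).
rewrite (_ : \big[setU/set0]_(i <- index_enum J) _ = setT); last first.
  apply/seteqP; split => // t _; rewrite -bigcup_seq.
  by exists (q t); rewrite //= mem_index_enum.
move=> ->.
- apply: eq_bigr => j _; rewrite -integral_cst //.
  by apply: eq_integral => t; rewrite inE /= => ->.
- by move=> j k _ _ [t [/= <- <-]].
- apply/measurable_EFinP.
  exact: (measurable_fibres_comp (phi : J -> measurableTypeR R) mq).
- by move=> t _; rewrite lee_fin.
Qed.

Lemma measure_preimage_fibres (J : finType) (q : T -> J) (P : pred J) :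
  measurable_fibres q ->
  mu (q @^-1` [set` P]) = (\sum_(j | P j) mu (q @^-1` [set j]))%E.
Proof.
move=> mq; have := @ge0_integral_fibres J q (fun j => (P j)%:R) mq.
rewrite (_ : (\int[mu]_t _)%E = mu (q @^-1` [set` P])); last first.
  have mP : measurable (q @^-1` [set` P]) by exact: measurable_fibres_preimage.
  have := @integral_indic _ _ _ mu setT measurableT _ mP; rewrite setIT => <-.
  by apply: eq_integral => t _; rewrite indicE /= mem_setE.
move=> -> //; rewrite [RHS]big_mkcond; apply: eq_bigr => j _.
by case: (P j); rewrite ?mul1e ?mul0e.
Qed.

End finitely_valued.

Lemma cvge0_le (R : realType) (I : Type) (F : set_system I) {FF : Filter F}
    (f : I -> \bar R) (e : R) :
  f @ F --> 0%E -> 0 < e -> \forall i \near F, (f i <= e%:E)%E.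
Proof.
move=> f0 e0; have /f0 : nbhs (0%E : \bar R) [set x | (x < e%:E)%E].
  apply: open_nbhs_nbhs; split; first exact: open_ereal_lt_ereal.
  by rewrite /= lte_fin.
by rewrite nbhs_filterE /=; apply: filterS => i /ltW.
Qed.

Lemma cvg_norm_unique (R : realType) (V : normedModType R) (I : Type)
    (F : set_system I) {FF : ProperFilter F} (f : I -> V) (a b : V) :
  f @ F --> a -> f @ F --> b -> a = b.
Proof. by apply: cvg_unique; exact: norm_hausdorff. Qed.

Lemma cvg_of_approx (R : realType) (V : completeNormedModType R) (I : Type)
    (F : set_system I) {FF : ProperFilter F} (f : I -> V) :
  (forall e, 0 < e -> exists y, \forall i \near F, `|f i - y| <= e) ->
  cvg (f @ F).
Proof.
move=> Hf; apply/cauchy_cvgP/cauchy_exP => e e0.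
have [y yf] := Hf (e / 2) (divr_gt0 e0 (ltr0Sn _ 1)); exists y.
apply: filterS yf => i fy; rewrite -ball_normE /= distrC (le_lt_trans fy) //.
by rewrite ltr_pdivrMr // ltr_pMr // ltr1n.
Qed.

Section simple_functions.
Context d (T : measurableType d) (R : realType) (X : normedModType R).
Variable mu : {measure set T -> \bar R}.

Definition finite_off_zero (J : finType) (q : T -> J) (c : J -> X) :=
  forall j, c j != 0 -> (mu (q @^-1` [set j]) < +oo)%E.

(** [q] need not separate the values of the function: this is what allows two
    simple functions to be written over one common partition. *)
Lemma sintegral_fibres (J : finType) (q : T -> J) (c : J -> X) :
  measurable_fibres q -> finite_off_zero q c ->
  bochner_sintegral mu (c \o q) = \sum_j fine (mu (q @^-1` [set j])) *: c j.
Proof.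
move=> mq fq; rewrite /bochner_sintegral.
pose A := undup (codom c).
have uA : uniq A by exact: undup_uniq.
have cA j : c j \in A by rewrite mem_undup codom_f.
rewrite (fsbigE A) //; last first.
  move=> x _ xc; rewrite (_ : _ @^-1` _ = set0) ?measure0 ?scale0r //.
  rewrite -subset0 => t /= ctx; move/negP: xc; apply => /=.
  by rewrite -(ctx : c (q t) = x).
transitivity (\sum_(x <- A) \sum_(j | c j == x)
                fine (mu (q @^-1` [set j])) *: c j); last first.
  rewrite (exchange_big_dep xpredT) //=; apply: eq_bigr => j _.
  rewrite big_mkcond (bigD1_seq (c j)) //=.
  by rewrite eqxx big1 ?addr0 // => x /negPf; rewrite eq_sym => ->.
rewrite (eq_bigl xpredT); last by move=> x; exact: in_setT.
apply: eq_bigr => x _.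
have [->|x0] := eqVneq x 0.
  by rewrite scaler0 big1 // => j /eqP ->; rewrite scaler0.
rewrite (_ : _ @^-1` [set x] = q @^-1` [set` [pred j | c j == x]]); last first.
  by apply/seteqP; split => t /= /eqP.
rewrite measure_preimage_fibres // (eq_bigr (fun j =>
    (fine (mu (q @^-1` [set j])))%:E)); last first.
  move=> j /eqP cj; rewrite fineK // ge0_fin_numE //.
  by apply: fq; rewrite cj.
by rewrite sumEFin /= scaler_suml; apply: eq_bigr => j /eqP ->.
Qed.

Lemma bochner_simple_fibres (s : T -> X) : bochner_simple mu s ->
  exists (J : finType) (q : T -> J) (c : J -> X),
    [/\ measurable_fibres q, finite_off_zero q c & s = c \o q].
Proof.
case=> /finite_seqP [r rE] ms fs.
have sr t : s t \in r by have : range s (s t) by []; rewrite rE.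
exists (seq_sub r), (fun t => SeqSub (sr t)), (@ssval _ r); split => //.
- move=> j; rewrite (_ : _ @^-1` _ = s @^-1` [set ssval j]) //.
  by apply/seteqP; split => t /= => [<-//|e]; exact: val_inj.
- move=> j j0; rewrite (_ : _ @^-1` _ = s @^-1` [set ssval j]) ?fs //.
  by apply/seteqP; split => t /= => [<-//|e]; exact: val_inj.
Qed.

Lemma measurable_dist_simple (s s' : T -> X) :
  bochner_simple mu s -> bochner_simple mu s' ->
  measurable_fun setT (fun t => `|s t - s' t|).
Proof.
move=> /bochner_simple_fibres [J [q [c [mq _ ->]]]].
move=> /bochner_simple_fibres [K [p [e [mp _ ->]]]].
exact: (measurable_fibres_comp
  (fun jk => `|c jk.1 - e jk.2| : measurableTypeR R)
    (measurable_fibres_pair mq mp)).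
Qed.

Lemma bochner_simple0 : bochner_simple mu (fun=> 0 : X).
Proof.
split.
- apply: (@sub_finite_set _ _ [set 0]) => [_ [t _ <-] //|]; exact: finite_set1.
- move=> x; have [->|x0] := eqVneq x 0.
    by rewrite (_ : _ @^-1` _ = setT) //; apply/seteqP; split.
  rewrite (_ : _ @^-1` _ = set0) // -subset0 => t /= e.
  by rewrite -e eqxx in x0.
- move=> x x0; rewrite (_ : _ @^-1` _ = set0) ?measure0 // -subset0 => t /= e.
  by rewrite -e eqxx in x0.
Qed.

Lemma bochner_simple_comp (J : finType) (q : T -> J) (c : J -> X) :
  measurable_fibres q -> finite_off_zero q c -> bochner_simple mu (c \o q).
Proof.
move=> mq fq; split.
- apply: (@sub_finite_set _ _ [set` codom c]); last exact: finite_seq.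
  by move=> _ [t _ <-]; exact: codom_f.
- by move=> x; rewrite comp_preimage; exact: measurable_fibres_preimage.
- move=> x x0; rewrite comp_preimage.
  rewrite (_ : c @^-1` [set x] = [set` [pred j | c j == x]]); last first.
    by apply/seteqP; split => t /= /eqP.
  rewrite measure_preimage_fibres // (eq_bigr (fun j =>
    (fine (mu (q @^-1` [set j])))%:E) _).
    by rewrite sumEFin ltry.
  by move=> j /eqP cj; rewrite fineK // ge0_fin_numE //; apply: fq; rewrite cj.
Qed.

Lemma sintegral0 : bochner_sintegral mu (fun=> 0 : X) = 0.
Proof.
rewrite /bochner_sintegral fsbig1 // => x _.
have [->|x0] := eqVneq x 0; first by rewrite scaler0.
rewrite (_ : _ @^-1` _ = set0) ?measure0 ?scale0r // -subset0 => t /= e.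
by rewrite -e eqxx in x0.
Qed.

(** On the common refinement of the two level partitions this is the triangle
    inequality for finite sums. *)
Lemma sintegral_dist (s s' : T -> X) :
  bochner_simple mu s -> bochner_simple mu s' ->
  (`|bochner_sintegral mu s - bochner_sintegral mu s'|%:E <=
   \int[mu]_t `|s t - s' t|%:E)%E.
Proof.
move=> /bochner_simple_fibres [J [q [c [mq fq ->]]]].
move=> /bochner_simple_fibres [K [p [e [mp fp ->]]]].
have mqp := measurable_fibres_pair mq mp; set qp := fun t => _ in mqp.
have fc : finite_off_zero qp (c \o fst).
  move=> [j k] /= /fq; apply: le_lt_trans; apply: le_measure; rewrite ?inE //.
  by move=> t [/= -> _].
have fe : finite_off_zero qp (e \o snd).
  move=> [j k] /= /fp; apply: le_lt_trans; apply: le_measure; rewrite ?inE //.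
  by move=> t [/= _ ->].
rewrite (_ : c \o q = (c \o fst) \o qp) // (_ : e \o p = (e \o snd) \o qp) //.
rewrite !sintegral_fibres // -sumrB.
rewrite (@ge0_integral_fibres _ _ _ mu _ qp
  (fun jk => `|c jk.1 - e jk.2|) mqp) //.
apply: (@le_trans _ _ (\sum_jk (fine (mu (qp @^-1` [set jk])) *
    `|c jk.1 - e jk.2|)%:E)%E).
  rewrite sumEFin lee_fin; apply: le_trans (ler_norm_sum _ _ _) _.
  apply: ler_sum => jk _ /=; rewrite -scalerBr normrZ ger0_norm //.
apply: lee_sum => jk _; rewrite muleC.
have [->|ne0] := eqVneq (c jk.1 - e jk.2) 0.
  by rewrite normr0 mulr0 mule0.
rewrite EFinM fineK // ge0_fin_numE //.
have [c0|c0] := eqVneq (c jk.1) 0; last exact: fc.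
by apply: fe => /=; move: ne0; rewrite c0 sub0r oppr_eq0.
Qed.

Lemma sintegral_dist_through (h s s' : T -> X) :
  bochner_simple mu s -> bochner_simple mu s' ->
  measurable_fun setT (fun t => `|h t - s t|) ->
  measurable_fun setT (fun t => `|h t - s' t|) ->
  (`|bochner_sintegral mu s - bochner_sintegral mu s'|%:E <=
   \int[mu]_t `|h t - s t|%:E + \int[mu]_t `|h t - s' t|%:E)%E.
Proof.
move=> ss ss' ms ms'; apply: le_trans (sintegral_dist ss ss') _.
rewrite -ge0_integralD //; try exact/measurable_EFinP.
apply: ge0_le_integral => //.
- exact/measurable_EFinP/measurable_dist_simple.
- by apply/measurable_EFinP; exact: measurable_funD.
- move=> t _; rewrite -EFinD lee_fin distrC -[s' t - s t](subrKA (h t)).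
  by rewrite (le_trans (ler_normD _ _)) // addrC (distrC (s' t)).
Qed.

Lemma bochner_integral_dist (h s : T -> X) y :
  bochner_integral_is mu h y -> bochner_simple mu s ->
  measurable_fun setT (fun t => `|h t - s t|) ->
  (`|y - bochner_sintegral mu s|%:E <= \int[mu]_t `|h t - s t|%:E)%E.
Proof.
move=> [s_ [ss_ ms_ hs_ ys_]] ss ms.
apply/lee_addgt0Pr => e e0.
have e20 : 0 < e / 2 by rewrite divr_gt0.
have [n [hn yn]] : exists n, (\int[mu]_t `|h t - s_ n t|%:E <= (e / 2)%:E)%E /\
    `|y - bochner_sintegral mu (s_ n)| <= e / 2.
  near \oo => n; exists n; split.
    by near: n; exact: cvge0_le.
  by near: n; move/cvgrPdist_le : ys_; exact.
rewrite (_ : y - _ = (y - bochner_sintegral mu (s_ n)) +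
  (bochner_sintegral mu (s_ n) - bochner_sintegral mu s));
    last by rewrite subrKA.
apply: (@le_trans _ _ ((e / 2)%:E + (\int[mu]_t `|h t - s_ n t|%:E +
    \int[mu]_t `|h t - s t|%:E))%E).
  rewrite (le_trans (y := (`|y - bochner_sintegral mu (s_ n)| +
    `|bochner_sintegral mu (s_ n) - bochner_sintegral mu s|)%:E)%E) //.
    by rewrite lee_fin ler_normD.
  by rewrite EFinD leeD // sintegral_dist_through.
rewrite addeA addeC leeD2l // [leRHS](_ : _ = (e / 2)%:E + (e / 2)%:E)%E.
  by rewrite leeD2l.
by rewrite -EFinD -splitr.
Unshelve. all: by end_near. Qed.

Lemma bochner_integral_unique (h : T -> X) y y' :
  bochner_integral_is mu h y -> bochner_integral_is mu h y' -> y = y'.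
Proof.
move=> hy [s_ [ss_ ms_ hs_ ys_]].
apply: (@cvg_norm_unique _ _ _ \oo _ _ _ _ _ ys_).
apply/cvgrPdist_le => e e0; near=> n.
rewrite -lee_fin (le_trans (bochner_integral_dist hy (ss_ n) (ms_ n))) //.
by near: n; exact: cvge0_le.
Unshelve. all: by end_near. Qed.

Lemma bochnerE (h : T -> X) y : bochner_integral_is mu h y -> bochner mu h = y.
Proof.
move=> hy; apply: (bochner_integral_unique _ hy).
exact: (xgetPex 0 (ex_intro _ y hy)).
Qed.

Lemma bochner_integral_norm (h : T -> X) y :
  measurable_fun setT (fun t => `|h t|) -> bochner_integral_is mu h y ->
  (`|y|%:E <= \int[mu]_t `|h t|%:E)%E.
Proof.
move=> mh hy; have hE : (fun t => `|h t - 0|) = (fun t => `|h t|).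
  by apply/funext => t; rewrite subr0.
have := bochner_integral_dist hy bochner_simple0; rewrite hE sintegral0 subr0.
move=> /(_ mh) /le_trans; apply.
by under eq_integral do rewrite subr0.
Qed.

End simple_functions.

(** By [sintegral_dist_through] the integrals of simple functions that
    approximate [h] in mean form a Cauchy sequence. *)
Lemma bochner_integral_exists d (T : measurableType d) (R : realType)
    (X : completeNormedModType R) (mu : {measure set T -> \bar R})
      (h : T -> X) :
  (forall e, 0 < e -> exists s, [/\ bochner_simple mu s,
     measurable_fun setT (fun t => `|h t - s t|) &
     (\int[mu]_t `|h t - s t|%:E <= e%:E)%E]) ->
  exists y, bochner_integral_is mu h y.
Proof.
move=> Hh; have /choice [s_ Hs] : forall n : nat, exists s : T -> X,
    [/\ bochner_simple mu s, measurable_fun setT (fun t => `|h t - s t|) &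
     (\int[mu]_t `|h t - s t|%:E <= (n.+1%:R^-1)%:E)%E].
  by move=> n; apply: Hh; rewrite invr_gt0.
have int_small e : 0 < e ->
    \forall n \near \oo, (\int[mu]_t `|h t - s_ n t|%:E <= e%:E)%E.
  move=> e0; have := near_infty_natSinv_lt (PosNum e0).
  apply: filterS => n /ltW ne; have [_ _ hn] := Hs n.
  by rewrite (le_trans hn) // lee_fin.
have : cvg (bochner_sintegral mu (s_ n) @[n --> \oo]).
  apply: cvg_of_approx => e e0.
  have e20 : 0 < e / 2 by rewrite divr_gt0.
  have [N _ /(_ N (leqnn N)) /= HN] := int_small _ e20.
  exists (bochner_sintegral mu (s_ N)).
  apply: filterS (int_small _ e20) => n Hn.
  have [sN mN _] := Hs N; have [sn mn _] := Hs n.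
  rewrite -lee_fin (le_trans (sintegral_dist_through sn sN mn mN)) //.
  by rewrite [e]splitr EFinD leeD.
move=> cvg_s; exists (lim (bochner_sintegral mu (s_ n) @[n --> \oo])), s_;
  split => //.
- by move=> n; have [] := Hs n.
- by move=> n; have [] := Hs n.
- apply/fine_cvgP; split.
    near=> n; rewrite ge0_fin_numE ?integral_ge0 //.
    rewrite (@le_lt_trans _ _ 1%:E) ?ltry //; near: n; exact: int_small.
  apply/cvgrPdist_le => e e0; near=> n; rewrite sub0r normrN ger0_norm /=.
    rewrite -lee_fin fineK.
      by near: n; exact: int_small.
    rewrite ge0_fin_numE ?integral_ge0 //.
    rewrite (@le_lt_trans _ _ 1%:E) ?ltry //; near: n; exact: int_small.
  by rewrite fine_ge0 // integral_ge0.
Unshelve. all: by end_near. Qed.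

(** * Compactness and Riemann sums on a topological group *)

Lemma cvg_continuous_comp (I : Type) (F : set_system I) (U V : topologicalType)
    (f : I -> U) (g : U -> V) (a : U) :
  continuous g -> f i @[i --> F] --> a -> g (f i) @[i --> F] --> g a.
Proof. by move=> cg fa; exact: (cvg_comp _ _ fa (cg a)). Qed.

Section topological_group.
Context (R : realType) (G : topologicalGroupType).

Lemma cvg_mulg (I : Type) (F : set_system I) {FF : Filter F}
  (f g : I -> G) a b :
  f @ F --> a -> g @ F --> b -> (f i * g i)%g @[i --> F] --> (a * b)%g.
Proof.
move=> fa gb; apply: (cvg_comp2 fa gb).
exact: (@mulg_continuous G (a, b)).
Qed.

Lemma cvg_invg (I : Type) (F : set_system I) {FF : Filter F} (f : I -> G) a :
  f @ F --> a -> (f i)^-1%g @[i --> F] --> a^-1%g.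
Proof.
by move=> fa; apply: (continuous_cvg _ _ fa); exact: invg_continuous.
Qed.

Lemma mulgl_continuous (s : G) : continuous (fun r : G => (s * r)%g).
Proof. by move=> r; apply: cvg_mulg; [exact: cvg_cst | exact: cvg_id]. Qed.

Lemma open_mulgl (s : G) (O : set G) : open O -> open [set r : G | O (s * r)%g].
Proof. by move=> oO; apply: open_comp => // r _; exact: mulgl_continuous. Qed.

Lemma compact_mulg (K1 K2 : set G) : compact K1 -> compact K2 ->
  compact [set (p.1 * p.2)%g | p in K1 `*` K2].
Proof.
move=> c1 c2; apply: continuous_compact; last exact: compact_setX.
by apply: continuous_subspaceT => p; exact: mulg_continuous.
Qed.

Lemma compact_image (T U : topologicalType) (f : T -> U) (K : set T) :
  continuous f -> compact K -> compact (f @` K).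
Proof.
by move=> cf; apply: continuous_compact; exact: continuous_subspaceT.
Qed.

Lemma open_borel (O : set G) : open O -> measurable (O : set (borel G)).
Proof. exact: sub_sigma_algebra. Qed.

Lemma closed_borel (C : set G) : closed C -> measurable (C : set (borel G)).
Proof. by move=> /closed_openC/open_borel/measurableC; rewrite setCK. Qed.

Lemma compact_borel (K : set G) : hausdorff_space G -> compact K ->
  measurable (K : set (borel G)).
Proof. by move=> hG cK; apply: closed_borel; exact: compact_closed. Qed.

Lemma continuous_borel (f : G -> R) : continuous f ->
  measurable_fun [set: borel G] (f : borel G -> R).
Proof.
move=> /continuousP cf; apply: (measurability _ (RGenOpens.measurableE R)).
move=> _ [_ [a [b ->] <-]]; rewrite setTI; apply: open_borel.
exact/cf/interval_open.
Qed.

Lemma continuous_norm_borel (V : normedModType R) (f : G -> V) : continuous f ->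
  measurable_fun [set: borel G] ((fun r => `|f r|) : borel G -> R).
Proof.
move=> cf; apply: continuous_borel => r.
by apply: cvg_norm; exact: cf.
Qed.

(** Near covering of [K] turns continuity at each of its points into one
    neighbourhood of 1 that serves all of them. *)
Lemma compact_uniform_mulg (S : topologicalType) (V : normedModType R)
    (F : G * S -> V) (K : set (G * S)) (e : R) :
  continuous F -> compact K -> 0 < e ->
  \forall v \near (1%g : G), forall p, K p ->
    `|F ((p.1 * v)%g, p.2) - F p| <= e.
Proof.
move=> cF /compact_near_coveringP cK e0.
have := cK G (nbhs (1%g : G)) (fun v p => `|F ((p.1 * v)%g, p.2) - F p| <= e) _
  _.
apply => -[r s] Krs /=.
have h0 : ((q.1.1 * q.2)%g, q.1.2) @[q --> ((r, s), (1%g : G))] --> (r, s).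
  apply: cvg_pair.
    suff : (q.1.1 * q.2)%g @[q --> ((r, s), (1%g : G))] --> (r * 1)%g.
      by rewrite mulg1.
    apply: cvg_mulg; last exact: cvg_snd.
    by apply: (cvg_comp _ _ cvg_fst); exact: cvg_fst.
  by apply: (cvg_comp _ _ cvg_fst); exact: cvg_snd.
have h1 : F ((q.1.1 * q.2)%g, q.1.2) - F q.1 @[q --> ((r, s), (1%g : G))] -->
  (0 : V).
  rewrite -(subrr (F (r, s))); apply: cvgB.
    exact: (cvg_comp _ _ h0 (cF _)).
  by apply: (cvg_comp _ _ cvg_fst); exact: cF.
by move/cvgr0Pnorm_le : h1 => /(_ _ e0).
Qed.

End topological_group.

Section riemann_sums.
Context (R : realType) (G : topologicalGroupType).
Variable mu : {measure set (borel G) -> \bar R}.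
Hypothesis hausG : hausdorff_space G.
Hypothesis mu_compact : forall K : set G, compact K -> (mu K < +oo)%E.

(** Cells are numbered by ordinals because a type quantifying over all finite
    types is too large to carry a filter; [None] stands for the points outside
    the partitioned set. *)
Record tagged_partition := TaggedPartition {
  cell_number : nat ;
  cell_tag : 'I_cell_number -> G ;
  cell_of : borel G -> option 'I_cell_number }.

(** Fineness is measured by a neighbourhood of 1 rather than by the oscillation
    of one function, so that it applies to all integrands at once. *)
Definition fine_partition (K V : set G) (P : tagged_partition) :=
  [/\ measurable_fibres (@cell_of P), forall j, K (@cell_tag P j),
      forall r, @cell_of P r = None <-> ~ K r &
      forall r j, @cell_of P r = Some j -> V ((@cell_tag P j)^-1 * r)%g].

Definition fine_partitions (K : set G) : set_system tagged_partition :=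
  [set Q | exists2 V, nbhs (1%g : G) V & fine_partition K V `<=` Q].

(** A point goes to the first set of the list that contains it. *)
Lemma finite_open_partition (K : set G) (s : seq G) (U : G -> set G) :
  measurable (K : set (borel G)) -> (forall t, open (U t)) ->
  (forall r, K r -> exists2 t, t \in s & U t r) ->
  exists q : borel G -> option 'I_(size s),
    [/\ measurable_fibres q, forall r, q r = None <-> ~ K r &
        forall r j, q r = Some j -> U (nth 1%g s j) r].
Proof.
move=> mK oU Ks.
pose a r := [pred t | `[< U t r >]].
pose q (r : borel G) : option 'I_(size s) :=
  if `[< K r >] then insub (find (a r) s) else None.
have K_has r : K r -> has (a r) s.
  by move=> /Ks [t ts Ut]; apply/hasP; exists t => //; apply/asboolP.
have qNone r : q r = None <-> ~ K r.
  rewrite /q; case: asboolP => // Kr; split => //.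
  by case: insubP => //; rewrite -has_find K_has.
have qSome r j : q r = Some j <-> K r /\ find (a r) s = j.
  rewrite /q; case: asboolP => Kr; last by split => // -[].
  case: insubP => [i _ <-|]; last by rewrite -has_find K_has.
  by split => [[->] //|[_ /val_inj ->]].
exists q; split => //; last first.
  move=> r j /qSome [Kr fj]; have := nth_find (1%g : G) (K_has _ Kr).
  by rewrite fj => /asboolP.
move=> [j|]; last first.
  rewrite (_ : _ @^-1` _ = ~` K); first exact: measurableC.
  by apply/seteqP; split => r /qNone.
pose W (i : 'I_(size s)) : set G := U (nth 1%g s i).
rewrite (_ : _ @^-1` _ = (K `&` W j) `\`
  \bigcup_(i in [set i : 'I_(size s) | (i < j)%N]) W i).
  apply: measurableD.
    by apply: measurableI => //; exact: (open_borel (oU _)).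
  by apply: fin_bigcup_measurable => // i _; exact: (open_borel (oU _)).
apply/seteqP; split => r /=.
  move=> /qSome [Kr fj]; split; first split => //.
    by have := nth_find (1%g : G) (K_has _ Kr); rewrite fj => /asboolP.
  move=> [i /= ij Wi].
  have := @before_find _ (1%g : G) (a r) s i; rewrite fj => /(_ ij) /asboolP.
  exact.
move=> [[Kr Wj] nW]; apply/qSome; split => //; apply/eqP; rewrite eqn_leq.
apply/andP; split; rewrite leqNgt; apply/negP => lt.
  by have := before_find (1%g : G) lt => /asboolP; apply.
have fs := ltn_trans lt (ltn_ord j).
apply: nW; exists (Ordinal fs) => //=.
by have := nth_find (1%g : G) (K_has _ Kr) => /asboolP.
Qed.

(** Finitely many left translates of [V] by points of [K] cover [K]. *)
Lemma fine_partition_exists (K V : set G) : compact K -> nbhs (1%g : G) V ->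
  exists P, fine_partition K V P.
Proof.
move=> cK V1; pose U (t : G) := [set r | V^° (t^-1 * r)%g].
have oU t : open (U t) by apply: open_mulgl; exact: open_interior.
have : cover_compact K by rewrite -compact_cover.
move=> /(_ G K U (fun t _ => oU t)) [r Kr|D DK Kcov].
  by exists r => //; rewrite /U /= mulVg.
have [|q [mq qN qS]] :=
    @finite_open_partition K (finmap.enum_fset D) U (compact_borel hausG cK) oU.
  by move=> r /Kcov [t tD Ut]; exists t.
exists (@TaggedPartition _ (fun j => nth 1%g (finmap.enum_fset D) j) q);
  split => //=.
- by move=> j; apply/set_mem/DK/mem_nth.
- by move=> r j /qS; exact: interior_subset.
Qed.

Lemma fine_partitionS (K V W : set G) : V `<=` W ->
  fine_partition K V `<=` fine_partition K W.
Proof. by move=> VW P [mP tP nP vP]; split => // r j /vP /VW. Qed.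

Lemma fine_partitions_filter (K : set G) : compact K ->
  ProperFilter (fine_partitions K).
Proof.
move=> cK; split.
  by move=> [V V1 VQ]; have [P /VQ] := fine_partition_exists cK V1.
split.
- by exists setT; [exact: filterT | ].
- move=> Q1 Q2 [V1 n1 s1] [V2 n2 s2]; exists (V1 `&` V2); first exact: filterI.
  move=> P fP; split; [apply: s1|apply: s2].
    by apply: fine_partitionS fP => ? [].
  by apply: fine_partitionS fP => ? [].
- by move=> Q1 Q2 Q12 [V1 n1 s1]; exists V1 => // P /s1 /Q12.
Qed.

Definition riemann_sum (X : normedModType R) (h : G -> X)
    (P : tagged_partition) : X :=
  \sum_j fine (mu (@cell_of P @^-1` [set Some j])) *: h (cell_tag j).

Definition vanishes_off (X : zmodType) (K : set G) (h : G -> X) :=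
  forall r, ~ K r -> h r = 0.

Section sum_estimates.
Context (X : normedModType R) (h : G -> X) (K V : set G).
Context (P : tagged_partition) (e : R).
Hypotheses (cK : compact K) (fP : fine_partition K V P).

Let step : borel G -> X := (oapp (fun j => h (@cell_tag P j)) 0) \o
  (@cell_of P).

Lemma cell_finite j : (mu (@cell_of P @^-1` [set Some j]) < +oo)%E.
Proof.
have [mP tP nP vP] := fP.
apply: le_lt_trans (mu_compact cK); apply: le_measure; rewrite ?inE //.
  exact: compact_borel.
by move=> r /= rj; apply: contrapT => /nP; rewrite rj.
Qed.

Let step_finite :
  finite_off_zero mu (@cell_of P) (oapp (fun j => h (@cell_tag P j)) 0).
Proof. by move=> [j|] /=; [rewrite cell_finite | rewrite eqxx]. Qed.

Lemma step_simple : bochner_simple mu step.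
Proof. by case: fP => mP _ _ _; exact: bochner_simple_comp. Qed.

Lemma sintegral_step : bochner_sintegral mu step = riemann_sum h P.
Proof.
case: fP => mP _ _ _; rewrite /step sintegral_fibres // (bigD1 None) //=.
rewrite scaler0 add0r (reindex_omap Some id) //=; last by case.
by apply: eq_bigl => j; rewrite eqxx.
Qed.

Hypotheses (ch : continuous h) (hK : vanishes_off K h) (e0 : 0 <= e).
Hypothesis he : forall r j, @cell_of P r = Some j ->
  `|h r - h (@cell_tag P j)| <= e.

Lemma measurable_dist_step :
  measurable_fun setT (fun r : borel G => `|h r - step r|).
Proof.
move=> _ B mB; rewrite setTI.
rewrite (_ : _ @^-1` B = \bigcup_(o in [set: option 'I_(cell_number P)])
   (@cell_of P @^-1` [set o] `&`
    (fun r : borel G => `|h r - oapp (fun j => h (@cell_tag P j)) 0 o|) @^-1`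
      B)).
  apply: fin_bigcup_measurable => // o _; apply: measurableI.
    by case: fP.
  rewrite -[X in measurable X]setTI; apply: continuous_norm_borel => // r.
  by apply: cvgB; [exact: ch | exact: cvg_cst].
apply/seteqP; split => r /=.
  by move=> Br; exists (@cell_of P r).
by move=> [c _ [<-]].
Qed.

Lemma step_dist (r : borel G) : `|h r - step r| <= e * \1_K r.
Proof.
case: fP => _ _ nP _; rewrite /step /= indicE.
case E : (@cell_of P r) => [j|] /=.
  rewrite mem_set ?mulr1 ?he //.
  by apply: contrapT => /nP; rewrite E.
by have /nP nK := E; rewrite memNset // mulr0 subr0 hK ?normr0.
Qed.

Lemma integral_dist_step :
  (\int[mu]_r `|h r - step r|%:E <= (e * fine (mu K))%:E)%E.
Proof.
have mK : measurable (K : set (borel G)) by exact: compact_borel.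
have muK : mu K \is a fin_num by rewrite ge0_fin_numE ?mu_compact.
apply: (@le_trans _ _ (\int[mu]_r (e * \1_K r)%:E)%E).
  apply: ge0_le_integral => //.
  - by apply/measurable_EFinP; apply: measurable_dist_step.
  - by apply/measurable_EFinP; apply: measurable_funM.
  - by move=> r _; rewrite lee_fin step_dist.
rewrite (@integralZl_indic _ _ _ mu setT measurableT (fun=> K)) //.
  by rewrite integral_indic // setIT EFinM fineK.
by move=> e_lt0; move: e0; rewrite leNgt e_lt0.
Qed.

Lemma riemann_sum_dist y : bochner_integral_is mu h y ->
  `|y - riemann_sum h P| <= e * fine (mu K).
Proof.
move=> hy; rewrite -sintegral_step -lee_fin.
apply: le_trans integral_dist_step.
exact: (bochner_integral_dist hy step_simple measurable_dist_step).
Qed.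

End sum_estimates.

Lemma compact_uniform_mulg1 (X : normedModType R) (h : G -> X) (K : set G)
  (e : R) :
  continuous h -> compact K -> 0 < e ->
  \forall v \near (1%g : G), forall r, K r -> `|h (r * v)%g - h r| <= e.
Proof.
move=> ch cK e0.
have cF : continuous (fun p : G * G => h p.1).
  by move=> p; apply: (cvg_comp _ _ cvg_fst); exact: ch.
have := compact_uniform_mulg cF (compact_setX cK (@compact_set1 _ (1%g : G)))
  e0.
by apply: filterS => v Hv r Kr; exact: (Hv (r, 1%g)).
Qed.

Section integrals.
Context (X : completeNormedModType R) (h : G -> X) (K : set G).
Hypotheses (cK : compact K) (ch : continuous h) (hK : vanishes_off K h).

Lemma near_fine_partition (e : R) : 0 < e ->
  \forall P \near fine_partitions K, exists2 V, fine_partition K V P &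
    forall r j, @cell_of P r = Some j -> `|h r - h (@cell_tag P j)| <= e.
Proof.
move=> e0; have nV := compact_uniform_mulg1 ch cK e0.
exists [set v | forall r, K r -> `|h (r * v)%g - h r| <= e] => //.
move=> P fP; exists [set v | forall r, K r -> `|h (r * v)%g - h r| <= e] => //.
case: (fP) => mP tP nP vP r j rj.
by have := vP r j rj _ (tP j); rewrite mulVKg.
Qed.

Lemma bochner_integrable : bochner_integral_is mu h (bochner mu h).
Proof.
have [y hy] : exists y, bochner_integral_is mu h y;
  last by rewrite (bochnerE hy).
apply: bochner_integral_exists => e e0.
have FK := fine_partitions_filter cK.
have muK0 : 0 <= fine (mu K) by rewrite fine_ge0.
have d0 : 0 < e / (fine (mu K) + 1) by rewrite divr_gt0 // ltr_wpDl.
have [P [V fP hP]] := filter_ex (near_fine_partition d0).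
exists (oapp (fun j => h (@cell_tag P j)) 0 \o (@cell_of P)); split.
- exact: (step_simple h cK fP).
- exact: (measurable_dist_step fP ch).
- apply: le_trans (integral_dist_step cK fP ch hK (ltW d0) hP) _.
  by rewrite lee_fin mulrC mulr_divD1_le // ltW.
Qed.

(** Properties of finite sums pass to integrals through this limit. *)
Lemma riemann_sum_cvg :
  riemann_sum h P @[P --> fine_partitions K] --> bochner mu h.
Proof.
have FK := fine_partitions_filter cK.
have muK0 : 0 <= fine (mu K) by rewrite fine_ge0.
apply/cvgrPdist_le => e e0.
have d0 : 0 < e / (fine (mu K) + 1) by rewrite divr_gt0 // ltr_wpDl.
apply: filterS (near_fine_partition d0) => P [V fP hP].
apply: le_trans (riemann_sum_dist cK fP ch hK (ltW d0) hP bochner_integrable) _.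
by rewrite mulrC mulr_divD1_le // ltW.
Qed.

Lemma bochner_norm : (`|bochner mu h|%:E <= \int[mu]_r `|h r|%:E)%E.
Proof.
apply: bochner_integral_norm; last exact: bochner_integrable.
exact: continuous_norm_borel.
Qed.

Lemma bochner_le (e : R) : 0 <= e -> (forall r, `|h r| <= e) ->
  `|bochner mu h| <= e * fine (mu K).
Proof.
move=> e0 he; rewrite -lee_fin (le_trans bochner_norm) //.
have mK : measurable (K : set (borel G)) by exact: compact_borel.
have muK : mu K \is a fin_num by rewrite ge0_fin_numE ?mu_compact.
apply: (@le_trans _ _ (\int[mu]_r (e * \1_K r)%:E)%E).
  apply: ge0_le_integral => //.
  - by apply/measurable_EFinP; apply: continuous_norm_borel.
  - by apply/measurable_EFinP; apply: measurable_funM.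
  - move=> r _; rewrite lee_fin indicE; have [rK|/negP rK] := boolP (r \in K).
      by rewrite mulr1.
    by rewrite mulr0 hK ?normr0 // => /mem_set.
rewrite (@integralZl_indic _ _ _ mu setT measurableT (fun=> K)) //.
  by rewrite integral_indic // setIT EFinM fineK.
by move=> e_lt0; move: e0; rewrite leNgt e_lt0.
Qed.

(** The Riemann sums lie in the cone. *)
Lemma bochner_in_cone (C : set X) : closed C -> is_cone C -> C 0 ->
  (forall r, C (h r)) -> C (bochner mu h).
Proof.
move=> clC [CD CZ] C0 Ch; have FK := fine_partitions_filter cK.
apply: (closed_cvg C clC _ _ riemann_sum_cvg).
apply: nearW => P; rewrite /riemann_sum; elim/big_ind: _ => // j _.
by apply: CZ => //; rewrite fine_ge0.
Qed.

End integrals.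

End riemann_sums.

(** * The integral of continuous compactly supported functions *)

Section linear_operators.
Context (R : realType) (V W : normedModType R) (f : V -> W).
Hypothesis lf : linear f.

Lemma linear_zero : f 0 = 0.
Proof. by have := lf (-1) 0 0; rewrite scaler0 addr0 scaleN1r addNr. Qed.

Lemma linear_scale c v : f (c *: v) = c *: f v.
Proof. by rewrite -[c *: v]addr0 lf linear_zero addr0. Qed.

Lemma linear_add v w : f (v + w) = f v + f w.
Proof. by rewrite -[v]scale1r lf !scale1r. Qed.

Lemma linear_opp v : f (- v) = - f v.
Proof. by rewrite -scaleN1r linear_scale scaleN1r. Qed.

Lemma linear_sub v w : f (v - w) = f v - f w.
Proof. by rewrite linear_add linear_opp. Qed.

Lemma linear_sumZ (n : nat) (c : 'I_n -> R) (v : 'I_n -> V) :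
  f (\sum_i c i *: v i) = \sum_i c i *: f (v i).
Proof.
elim: n c v => [|n IHn] c v; first by rewrite !big_ord0 linear_zero.
by rewrite !big_ord_recr /= linear_add IHn linear_scale.
Qed.

Lemma linear_bounded_continuous (C : R) :
  (forall v, `|f v| <= C * `|v|) -> continuous f.
Proof.
move=> fC v; apply/cvgrPdist_le => e e0.
have C0 : 0 < `|C| + 1 by rewrite ltr_wpDl.
near=> u; rewrite -linear_sub (le_trans (fC _)) //.
rewrite (le_trans (y := (`|C| + 1) * `|v - u|)) //.
  by rewrite ler_wpM2r // (le_trans (ler_norm C)) // lerDl.
rewrite -ler_pdivlMl // mulrC; near: u; apply: cvgr_dist_le => //.
by rewrite divr_gt0.
Unshelve. all: by end_near. Qed.

End linear_operators.

Lemma bounded_operator_continuous (R : realType) (V W : normedModType R)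
    (f : V -> W) : bounded_operator f -> continuous f.
Proof. by move=> [lf [C fC]]; exact: linear_bounded_continuous fC. Qed.

Section integral_calculus.
Context (R : realType) (G : topologicalGroupType).
Variable mu : {measure set (borel G) -> \bar R}.
Hypothesis hausG : hausdorff_space G.
Hypothesis Hmu : left_haar_measure mu.
Let mu_compact := haar_compact Hmu.

Section linearity.
Context (X Y : completeNormedModType R) (K : set G).
Hypothesis cK : compact K.

Lemma bochner_comp (h : G -> X) (phi : X -> Y) :
  continuous h -> vanishes_off K h -> bounded_operator phi ->
  bochner mu (fun r : borel G => phi (h r)) = phi (bochner mu h).
Proof.
move=> ch hK bphi; have [lphi _] := bphi.
have cphi := bounded_operator_continuous bphi.
have FK := fine_partitions_filter hausG cK.
have cphih : continuous (phi \o h) by move=> r; apply: continuous_comp;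
  [exact: ch | exact: cphi].
have phihK : vanishes_off K (phi \o h).
  by move=> r Kr; rewrite /= hK // linear_zero.
apply: cvg_norm_unique (riemann_sum_cvg hausG mu_compact cK cphih phihK) _.
rewrite (_ : riemann_sum mu (phi \o h) = phi \o riemann_sum mu h).
  exact: (cvg_comp _ _ (riemann_sum_cvg hausG mu_compact cK ch hK) (cphi _)).
by apply/funext => P; rewrite /= /riemann_sum linear_sumZ.
Qed.

Lemma bochnerZD (h g : G -> X) (c : R) :
  continuous h -> vanishes_off K h -> continuous g -> vanishes_off K g ->
  bochner mu (fun r : borel G => c *: h r + g r) = c *: bochner mu h + bochner
    mu g.
Proof.
move=> ch hK cg gK.
have FK := fine_partitions_filter hausG cK.
have chg : continuous (fun r => c *: h r + g r).
  by move=> r; apply: cvgD; [apply: cvgZ|];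
    [exact: cvg_cst|exact: ch|exact: cg].
have hgK : vanishes_off K (fun r => c *: h r + g r).
  by move=> r Kr; rewrite hK // gK // scaler0 addr0.
apply: cvg_norm_unique (riemann_sum_cvg hausG mu_compact cK chg hgK) _.
rewrite (_ : riemann_sum mu _ = fun P =>
  c *: riemann_sum mu h P + riemann_sum mu g P).
  apply: cvgD; last exact: riemann_sum_cvg cg gK.
  by apply: cvgZ; [exact: cvg_cst | exact: riemann_sum_cvg ch hK].
apply/funext => P; rewrite /riemann_sum scaler_sumr -big_split /=.
by apply: eq_bigr => j _; rewrite scalerDr !scalerA [c * _]mulrC.
Qed.

Lemma bochner_dist_le (h g : G -> X) (e : R) : 0 <= e ->
  continuous h -> vanishes_off K h -> continuous g -> vanishes_off K g ->
  (forall r, K r -> `|h r - g r| <= e) ->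
  `|bochner mu h - bochner mu g| <= e * fine (mu K).
Proof.
move=> e0 ch hK cg gK hg.
have -> : bochner mu h - bochner mu g = bochner mu (fun r : borel G =>
  -1 *: g r + h r).
  by rewrite bochnerZD // scaleN1r addrC.
apply: bochner_le => //.
- move=> r; apply: cvgD; last exact: ch.
  by apply: cvgZ; [exact: cvg_cst | exact: cg].
- by move=> r Kr; rewrite hK // gK // scaler0 addr0.
- move=> r; have [Kr|Kr] := pselect (K r).
    by rewrite scaleN1r addrC hg.
  by rewrite hK // gK // scaler0 addr0 normr0.
Qed.

Lemma bochner0 (h : G -> X) : (forall r, h r = 0) -> bochner mu h = 0.
Proof.
move=> h0; have -> : h = cst 0 by apply/funext.
apply/eqP; rewrite -normr_le0 -(mul0r (fine (mu K))).
by apply: bochner_le => //; [exact: cst_continuous | move=> r; rewrite normr0].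
Qed.

End linearity.

Section parameters.
Context (E : completeNormedModType R) (F : G * G -> E) (K1 K2 : set G).
Hypotheses (cK1 : compact K1) (cK2 : compact K2) (cF : continuous F).
Hypothesis F0 : forall r s, ~ (K1 r /\ K2 s) -> F (r, s) = 0.

Definition param_integral (s : G) : E :=
  bochner mu (fun r : borel G => F (r, s)).

Lemma section_continuous s : continuous (fun r => F (r, s)).
Proof.
move=> r; have h : (r', s) @[r' --> r] --> (r, s).
  by apply: cvg_pair; [exact: cvg_id | exact: cvg_cst].
exact: (cvg_continuous_comp cF h).
Qed.

Lemma cosection_continuous r : continuous (fun s => F (r, s)).
Proof.
move=> s; have h : (r, s') @[s' --> s] --> (r, s).
  by apply: cvg_pair; [exact: cvg_cst | exact: cvg_id].
exact: (cvg_continuous_comp cF h).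
Qed.

Lemma section_vanishes s : vanishes_off K1 (fun r => F (r, s)).
Proof. by move=> r Kr; apply: F0 => -[]. Qed.

Lemma cosection_vanishes r : vanishes_off K2 (fun s => F (r, s)).
Proof. by move=> s Ks; apply: F0 => -[]. Qed.

Lemma param_vanishes : vanishes_off K2 param_integral.
Proof.
by move=> s Ks; apply: (bochner0 cK1) => r; exact: cosection_vanishes.
Qed.

(** Near covering of [K1]: close to [s0] the integrands are uniformly close. *)
Lemma param_continuous : continuous param_integral.
Proof.
move=> s0; apply/cvgrPdist_le => e e0.
have muK0 : 0 <= fine (mu K1) by rewrite fine_ge0.
have d0 : 0 < e / (fine (mu K1) + 1) by rewrite divr_gt0 // ltr_wpDl.
have /compact_near_coveringP cov := cK1.
have := cov G (nbhs s0) (fun s r =>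
  `|F (r, s0) - F (r, s)| <= e / (fine (mu K1) + 1)) _ _.
move=> /(_ _) near_s0; have {near_s0} : \forall s \near s0, forall r, K1 r ->
    `|F (r, s0) - F (r, s)| <= e / (fine (mu K1) + 1).
  apply: near_s0 => r _.
  have h1 : F (q.1, s0) - F (q.1, q.2) @[q --> (r, s0)] --> (0 : E).
    rewrite -(subrr (F (r, s0))); apply: cvgB.
      by apply: (cvg_continuous_comp (@section_continuous s0)); exact: cvg_fst.
    have h : (q.1, q.2) @[q --> (r, s0)] --> (r, s0).
      by apply: cvg_pair; [exact: cvg_fst | exact: cvg_snd].
    exact: (cvg_continuous_comp cF h).
  by move/cvgr0Pnorm_le : h1 => /(_ _ d0).
apply: filterS => s Hs.
apply: le_trans (bochner_dist_le cK1 (ltW d0) (@section_continuous s0)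
  (@section_vanishes s0) (@section_continuous s) (@section_vanishes s) Hs) _.
by rewrite mulrC mulr_divD1_le // ltW.
Qed.

(** Uniform continuity with the parameter [s] in [K2] makes one partition good
    for all [s] at once. *)
Lemma riemann_sum_uniform e : 0 < e -> \forall P \near fine_partitions K1,
  forall s, `|param_integral s - riemann_sum mu (fun r => F (r, s)) P| <= e.
Proof.
move=> e0.
have muK0 : 0 <= fine (mu K1) by rewrite fine_ge0.
have d0 : 0 < e / (fine (mu K1) + 1) by rewrite divr_gt0 // ltr_wpDl.
pose V : set G := [set v | forall p, (K1 `*` K2) p ->
  `|F ((p.1 * v)%g, p.2) - F p| <= e / (fine (mu K1) + 1)].
have nV : nbhs (1%g : G) V := compact_uniform_mulg cF (compact_setX cK1 cK2) d0.
exists V => // P fP s.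
have [mP tP nP vP] := fP.
have [Ks|Ks] := pselect (K2 s); last first.
  rewrite param_vanishes // /riemann_sum big1 ?subrr ?normr0 ?(ltW e0) //.
  by move=> j _; rewrite (cosection_vanishes _ Ks) scaler0.
apply: (le_trans (riemann_sum_dist hausG mu_compact cK1 fP
  (@section_continuous s)
  (@section_vanishes s) (ltW d0) _ _)).
- move=> r j rj; have := vP r j rj (cell_tag j, s); rewrite /= mulVKg.
  by apply; split.
- exact: (bochner_integrable hausG mu_compact cK1 (@section_continuous s)
    (@section_vanishes s)).
- by rewrite mulrC mulr_divD1_le // ltW.
Qed.

End parameters.

Definition cc_on (E : normedModType R) (K : set G) (f : G -> E) :=
  continuous f /\ vanishes_off K f.

(** Interchange of an integral with a linear map that is bounded for the
    uniform norm on functions supported in a fixed compact set. With the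
    integral itself as the map this is Fubini for such functions; with a
    representation of the Beurling algebra it expresses the image of a twisted
    convolution as an integral. *)
Section interchange.
Context (E Y : completeNormedModType R) (K1 K2 : set G) (Lam : (G -> E) -> Y).
Hypotheses (cK1 : compact K1) (cK2 : compact K2).

Lemma cc_on_ZD c (f g : G -> E) : cc_on K2 f -> cc_on K2 g ->
  cc_on K2 (fun s => c *: f s + g s).
Proof.
move=> [cf fK] [cg gK]; split.
  by move=> s; apply: cvgD;
    [apply: cvgZ; [exact: cvg_cst | exact: cf] | exact: cg].
by move=> s Ks; rewrite fK // gK // scaler0 addr0.
Qed.

Lemma cc_on0 : cc_on K2 (fun _ : G => 0 : E).
Proof. by split => // s; exact: cvg_cst. Qed.

Hypothesis LamZD : forall c (f g : G -> E), cc_on K2 f -> cc_on K2 g ->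
  Lam (fun s => c *: f s + g s) = c *: Lam f + Lam g.
Variable C : R.
Hypothesis Lam_le : forall (f : G -> E) e, cc_on K2 f -> 0 <= e ->
  (forall s, `|f s| <= e) ->
  `|Lam f| <= C * e.

Lemma Lam0 : Lam (fun=> 0) = 0.
Proof.
have := LamZD (-1) cc_on0 cc_on0.
under [in X in X -> _]eq_fun do rewrite scaler0 addr0.
by rewrite scaleN1r addNr.
Qed.

Lemma Lam_sum (n : nat) (c : 'I_n -> R) (f : 'I_n -> G -> E) :
  (forall i, cc_on K2 (f i)) ->
  cc_on K2 (fun s => \sum_i c i *: f i s) /\
  Lam (fun s => \sum_i c i *: f i s) = \sum_i c i *: Lam (f i).
Proof.
elim: n c f => [|n IHn] c f cf.
  rewrite big_ord0; under eq_fun do rewrite big_ord0.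
  by split; [exact: cc_on0 | exact: Lam0].
have -> : (fun s => \sum_(i < n.+1) c i *: f i s) =
  (fun s => c ord0 *: f ord0 s +
    \sum_(i < n) c (lift ord0 i) *: f (lift ord0 i) s).
  by apply/funext => s; rewrite big_ord_recl.
have [cs sE] := IHn (fun i => c (lift ord0 i)) (fun i => f (lift ord0 i))
  (fun i => cf _).
by split; [exact: cc_on_ZD | rewrite LamZD // sE big_ord_recl].
Qed.

Lemma Lam_dist (f g : G -> E) e : cc_on K2 f -> cc_on K2 g -> 0 <= e ->
  (forall s, `|f s - g s| <= e) -> `|Lam f - Lam g| <= C * e.
Proof.
move=> cf cg e0 fg.
have -> : Lam f - Lam g = Lam (fun s => -1 *: g s + f s).
  by rewrite LamZD // scaleN1r addrC.
apply: Lam_le => //; first exact: cc_on_ZD.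
by move=> s; rewrite scaleN1r addrC.
Qed.

Variable F : G * G -> E.
Hypothesis cF : continuous F.
Hypothesis F0 : forall r s, ~ (K1 r /\ K2 s) -> F (r, s) = 0.

Lemma cc_on_cosection r : cc_on K2 (fun s => F (r, s)).
Proof.
by split; [exact: cosection_continuous | exact: (cosection_vanishes F0)].
Qed.

Lemma cc_on_param : cc_on K2 (param_integral F).
Proof.
split; first exact: (param_continuous cK1 cF F0).
exact: (param_vanishes cK1 F0).
Qed.

Lemma Lam_section_vanishes : vanishes_off K1 (fun r => Lam (fun s => F (r, s))).
Proof.
move=> r Kr; rewrite -[RHS]Lam0; congr Lam; apply/funext => s.
by rewrite F0 // => -[].
Qed.

Lemma Lam_section_continuous : continuous (fun r => Lam (fun s => F (r, s))).
Proof.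
move=> r0; apply/cvgrPdist_le => e e0.
have C0 : 0 < `|C| + 1 by rewrite ltr_wpDl.
have d0 : 0 < e / (`|C| + 1) by rewrite divr_gt0.
have /compact_near_coveringP cov := cK2.
have := cov G (nbhs r0) (fun r s => `|F (r0, s) - F (r, s)| <= e / (`|C| + 1))
  _ _.
move=> /(_ _) near_r0; have {near_r0} : \forall r \near r0, forall s, K2 s ->
    `|F (r0, s) - F (r, s)| <= e / (`|C| + 1).
  apply: near_r0 => s _.
  have h1 : F (r0, q.1) - F (q.2, q.1) @[q --> (s, r0)] --> (0 : E).
    rewrite -(subrr (F (r0, s))); apply: cvgB.
      have h : (q.1 : G) @[q --> (s, r0)] --> s by exact: cvg_fst.
      exact: (cvg_continuous_comp (cosection_continuous cF (r := r0)) h).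
    have h : (q.2, q.1) @[q --> (s, r0)] --> (r0, s).
      by apply: cvg_pair; [exact: cvg_snd | exact: cvg_fst].
    exact: (cvg_continuous_comp cF h).
  by move/cvgr0Pnorm_le : h1 => /(_ _ d0).
apply: filterS => r Hr.
apply: (@le_trans _ _ (C * (e / (`|C| + 1)))).
  apply: Lam_dist (ltW d0) _; try exact: cc_on_cosection.
  move=> s; have [Ks|Ks] := pselect (K2 s); first exact: Hr.
  by rewrite !F0 ?subrr ?normr0 ?(ltW d0) // => -[].
rewrite mulrCA ger_pMr // ler_pdivrMr // mul1r.
by rewrite (le_trans (ler_norm C)) // lerDl.
Qed.

Lemma interchange :
  Lam (param_integral F) = bochner mu (fun r : borel G =>
    Lam (fun s => F (r, s))).
Proof.
have FK := fine_partitions_filter hausG cK1.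
have C0 : 0 < `|C| + 1 by rewrite ltr_wpDl.
have cvg1 := riemann_sum_cvg hausG mu_compact cK1 Lam_section_continuous
  Lam_section_vanishes.
apply: cvg_norm_unique cvg1; apply/cvgrPdist_le => e e0.
have d0 : 0 < e / (`|C| + 1) by rewrite divr_gt0.
apply: filterS (riemann_sum_uniform cK1 cK2 cF F0 d0) => P HP.
have [cs sE] := Lam_sum (fun j => fine (mu (@cell_of _ P @^-1` [set Some j])))
  (fun j => cc_on_cosection (@cell_tag _ P j)).
rewrite -[riemann_sum _ _ _]sE.
apply: (@le_trans _ _ (C * (e / (`|C| + 1)))).
  exact: Lam_dist cc_on_param cs (ltW d0) HP.
rewrite mulrCA ger_pMr // ler_pdivrMr // mul1r.
by rewrite (le_trans (ler_norm C)) // lerDl.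
Qed.

End interchange.

End integral_calculus.

(** * Left invariance and approximate point masses *)

Section haar_calculus.
Context (R : realType) (G : topologicalGroupType).
Variable mu : {measure set (borel G) -> \bar R}.
Hypothesis hausG : hausdorff_space G.
Hypothesis Hmu : left_haar_measure mu.
Let mu_compact := haar_compact Hmu.

Lemma measure_mulgl (s : G) (E : set (borel G)) : measurable E ->
  mu ((fun r : borel G => (s * r)%g : borel G) @^-1` E) = mu E.
Proof.
move=> mE; rewrite -(haar_left_invariant Hmu s^-1%g mE); congr (mu _).
apply/seteqP; split => r /=; first by move=> Er; exists (s * r)%g;
  rewrite ?mulKg.
by move=> [t Et <-]; rewrite mulVKg.
Qed.

Lemma measurable_mulgl (s : G) :
  measurable_fun [set: borel G] (fun r : borel G => (s * r)%g : borel G).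
Proof.
apply: (@measurability _ _ _ (borel G) setT _ (@open G)) => // _ [W oW <-].
by rewrite setTI; apply: open_borel; exact: open_mulgl.
Qed.

Lemma integral_mulgl (s : G) (f : borel G -> \bar R) :
  measurable_fun setT f -> (forall r, (0 <= f r)%E) ->
  (\int[mu]_r f (s * r)%g = \int[mu]_r f r)%E.
Proof.
move=> mf f0.
have := ge0_integral_pushforward (measurable_mulgl s) mu measurableT mf
  (fun r _ => f0 r).
rewrite preimage_setT /= => <-; apply: eq_measure_integral.
  exact: measurable_mulgl.
by move=> mm E mE _; exact: measure_mulgl.
Qed.

Lemma bochner_mulgl (X : completeNormedModType R) (h : G -> X) (K : set G)
  (s : G) :
  compact K -> continuous h -> vanishes_off K h ->
  bochner mu (fun r : borel G => h (s * r)%g) = bochner mu h.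
Proof.
move=> cK ch hK; apply: bochnerE.
have [s_ [ss_ ms_ is_ ys_]] := bochner_integrable hausG mu_compact cK ch hK.
exists (fun n (r : borel G) => s_ n (s * r)%g); split.
- move=> n; have [fr mf ff] := ss_ n; split.
  + by apply: sub_finite_set fr => _ [t _ <-]; exists (s * t)%g.
  + move=> x; have := measurable_mulgl s measurableT (mf x); rewrite setTI;
      exact.
  + by move=> x x0; have := ff x x0; rewrite -(measure_mulgl s (mf x)).
- move=> n; exact: measurableT_comp (ms_ n) (measurable_mulgl s).
- rewrite (_ : (fun n => _) = (fun n => (\int[mu]_t `|h t - s_ n t|%:E)%E)) //.
  apply/funext => n.
  rewrite -(integral_mulgl s (f := fun t => `|h t - s_ n t|%:E)) //.
  exact/measurable_EFinP.
- rewrite (_ : (fun n => _) = (fun n => bochner_sintegral mu (s_ n))) //.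
  apply/funext => n; apply: eq_fsbigr => x _; congr (fine _ *: _).
  by have [_ mf _] := ss_ n; rewrite -(measure_mulgl s (mf x)).
Qed.

(** The Riemann sums are the Lebesgue integrals of step functions, and these are
    uniformly close to [z] on [K]. *)
Lemma bochner_nonneg (z : G -> R^o) (K : set G) : compact K -> continuous z ->
  vanishes_off K z -> (forall r, 0 <= z r) ->
  ((bochner mu z)%:E = \int[mu]_r (z r)%:E)%E.
Proof.
move=> cK cz zK z0.
have FK := fine_partitions_filter hausG cK.
have mz : measurable_fun [set: borel G] (z : borel G -> R).
  exact: continuous_borel.
have muK0 : 0 <= fine (mu K) by rewrite fine_ge0.
have mK : measurable (K : set (borel G)) by exact: compact_borel.
have muK : mu K \is a fin_num by rewrite ge0_fin_numE ?mu_compact.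
have cvgz := riemann_sum_cvg hausG mu_compact cK cz zK.
have int_indic e : 0 <= e ->
  (\int[mu]_r (e * \1_K r)%:E = (e * fine (mu K))%:E)%E.
  move=> e0; rewrite (@integralZl_indic _ _ _ mu setT measurableT (fun=> K)) //.
    by rewrite integral_indic // setIT EFinM fineK.
  by move=> e_lt0; move: e0; rewrite leNgt e_lt0.
have key e : 0 < e -> \forall P \near fine_partitions K,
   (\int[mu]_r (z r)%:E <= (riemann_sum mu z P + e * fine (mu K))%:E)%E /\
   ((riemann_sum mu z P)%:E <= \int[mu]_r (z r)%:E + (e * fine (mu K))%:E)%E.
  move=> e0; have ge0 := ltW e0;
    apply: filterS (near_fine_partition cK cz e0) => P [V fP hP].
  have [mP tP nP vP] := fP.
  pose c := oapp (fun j => z (@cell_tag _ P j)) 0.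
  have c0 j : 0 <= c j by case: j => /=.
  have stepE : (\int[mu]_r (c (@cell_of _ P r))%:E = (riemann_sum mu z P)%:E)%E.
    rewrite ge0_integral_fibres // (bigD1 None) //= mul0e add0e.
    rewrite (reindex_omap Some id) //=; last by case.
    rewrite /riemann_sum -sumEFin; apply: eq_big => [j|j _];
      first by rewrite eqxx.
    rewrite /= EFinM muleC fineK // ge0_fin_numE //.
    exact: (cell_finite hausG mu_compact cK fP).
  have mc : measurable_fun setT (fun r : borel G => c (@cell_of _ P r)).
    exact: (measurable_fibres_comp (c : _ -> measurableTypeR R) mP).
  have step_near r := step_dist fP zK hP r.
  split.
    rewrite EFinD -stepE -int_indic // -ge0_integralD //.
    - apply: ge0_le_integral => //.
      + by move=> r _; rewrite lee_fin.
      + exact/measurable_EFinP.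
      + by apply: emeasurable_funD; apply/measurable_EFinP => //;
          exact: measurable_funM.
      + move=> r _; rewrite -EFinD lee_fin -lerBlDl.
        by rewrite (le_trans (ler_norm _)) // step_near.
    - by move=> r _; rewrite lee_fin.
    - exact/measurable_EFinP.
    - by move=> r _; rewrite lee_fin mulr_ge0.
    - by apply/measurable_EFinP; exact: measurable_funM.
  rewrite -stepE -int_indic // -ge0_integralD //.
  - apply: ge0_le_integral => //.
    + by move=> r _; rewrite lee_fin.
    + exact/measurable_EFinP.
    + by apply: emeasurable_funD; apply/measurable_EFinP => //;
        exact: measurable_funM.
    + move=> r _; rewrite -EFinD lee_fin -lerBlDl.
      by rewrite (le_trans (ler_norm _)) // distrC step_near.
  - by move=> r _; rewrite lee_fin.
  - exact/measurable_EFinP.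
  - by move=> r _; rewrite lee_fin mulr_ge0.
  - by apply/measurable_EFinP; exact: measurable_funM.
have Iz : (\int[mu]_r (z r)%:E)%E \is a fin_num.
  rewrite ge0_fin_numE; last by apply: integral_ge0 => r _; rewrite lee_fin.
  have [P [le1 _]] := filter_ex (key 1 ltr01).
  by apply: le_lt_trans le1 _; rewrite ltry.
rewrite -(fineK Iz); congr (_%:E).
apply: cvg_norm_unique cvgz _; apply/cvgrPdist_le => e e0.
have d0 : 0 < e / (fine (mu K) + 1) by rewrite divr_gt0 // ltr_wpDl.
apply: filterS (key _ d0) => P; rewrite -(fineK Iz) -EFinD !lee_fin /= =>
  -[le1 le2].
have de : e / (fine (mu K) + 1) * fine (mu K) <= e.
  by rewrite mulrC mulr_divD1_le // ltW.
rewrite ler_distl; apply/andP; split.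
  by rewrite lerBlDr (le_trans le2) // lerD2l.
by rewrite (le_trans le1) // lerD2l.
Qed.

(** A density of integral 1 averages a function: the average is close to [y]
    when the function is, wherever the density does not vanish. *)
Section densities.
Context (X : completeNormedModType R) (z : G -> R) (K : set G).
Hypotheses (cK : compact K) (cz : continuous z) (zK : vanishes_off K z).
Hypotheses (z0 : forall r, 0 <= z r).
Hypothesis intz : (\int[mu]_r (z r)%:E = 1)%E.

Lemma density_cst (y : X) : bochner mu (fun r : borel G => z r *: y) = y.
Proof.
have bop : bounded_operator (fun c : R^o => c *: y).
  split; first by move=> a b c /=; rewrite scalerDl scalerA.
  by exists `|y| => c; rewrite normrZ mulrC.
have := bochner_comp hausG Hmu cK (h := z : G -> R^o) cz zK bop.
have := @bochner_nonneg z K cK cz zK z0; rewrite intz => -[->].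
by rewrite scale1r.
Qed.

Lemma density_scale_continuous (H : G -> X) : continuous H ->
  continuous (fun r => z r *: H r).
Proof. by move=> cH r; apply: cvgZ; [exact: cz | exact: cH]. Qed.

Lemma density_scale_vanishes (H : G -> X) :
  vanishes_off K (fun r => z r *: H r).
Proof. by move=> r Kr; rewrite zK // scale0r. Qed.

Lemma density_average (H : G -> X) (y : X) (e : R) : continuous H -> 0 <= e ->
  (forall r, z r != 0 -> `|H r - y| <= e) ->
  `|bochner mu (fun r : borel G => z r *: H r) - y| <= e.
Proof.
move=> cH e0 He; rewrite -[y in _ - y]density_cst.
have cy : continuous (fun _ : G => y) by move=> r; exact: cvg_cst.
have -> : bochner mu (fun r : borel G => z r *: H r) -
    bochner mu (fun r : borel G => z r *: y) =
    bochner mu (fun r : borel G => -1 *: (z r *: y) + z r *: H r).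
  rewrite (bochnerZD hausG Hmu cK); first by rewrite scaleN1r addrC.
  - exact: density_scale_continuous cy.
  - exact: density_scale_vanishes (fun=> y).
  - exact: density_scale_continuous.
  - exact: density_scale_vanishes.
have -> : (fun r : borel G => -1 *: (z r *: y) + z r *: H r) =
    (fun r => z r *: (H r - y)).
  by apply/funext => r; rewrite scaleN1r scalerBr addrC.
have cHy : continuous (fun r => H r - y).
  by move=> r; apply: cvgB; [exact: cH | exact: cvg_cst].
rewrite -lee_fin (le_trans (bochner_norm hausG mu_compact cK
  (density_scale_continuous cHy) (density_scale_vanishes (fun r => H r - y))))
    //.
have mz : measurable_fun [set: borel G] (z : borel G -> R).
  exact: continuous_borel.
apply: (@le_trans _ _ (\int[mu]_r (e%:E * (z r)%:E))%E); last first.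
  rewrite ge0_integralZl //; first by rewrite intz mule1.
  - exact/measurable_EFinP.
  - by move=> r _; rewrite lee_fin.
apply: ge0_le_integral => //.
- by apply/measurable_EFinP; apply: continuous_norm_borel;
    exact: density_scale_continuous.
- by apply: emeasurable_funM => //; exact/measurable_EFinP.
- move=> r _; rewrite -EFinM lee_fin normrZ ger0_norm //.
  have [->|zr] := eqVneq (z r) 0; first by rewrite mul0r mulr0.
  by rewrite mulrC ler_wpM2r // He.
Qed.

End densities.

End haar_calculus.

(** * Weights are bounded on compact sets *)

Section weights.
Context (R : realType) (G : topologicalGroupType).
Variable mu : {measure set (borel G) -> \bar R}.
Hypothesis hausG : hausdorff_space G.
Hypothesis Hmu : left_haar_measure mu.
Let mu_compact := haar_compact Hmu.

Lemma compact_positive_measure : exists2 K : set G, compact K & (0 < mu K)%E.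
Proof.
have : (0 < mu setT)%E by rewrite lt0e (haar_neq0 Hmu) /=.
rewrite (haar_inner_regular Hmu openT) => /ereal_sup_gt [_ [K [cK _] <-] K0].
by exists K.
Qed.

Lemma measurable_invg : measurable_fun [set: borel G] (fun r : borel G =>
  r^-1%g : borel G).
Proof.
apply: (@measurability _ _ _ (borel G) setT _ (@open G)) => // _ [W oW <-].
rewrite setTI; apply: open_borel; apply: open_comp => // r _.
exact: invg_continuous.
Qed.

(** Inner regularity for sets of finite measure: remove from [K] an open set
    that exceeds [K `\` E] by less than [mu E]. *)
Lemma compact_subset_positive (K : set G) (E : set (borel G)) : compact K ->
  measurable E ->
  E `<=` K -> (0 < mu E)%E ->
  exists C : set G, [/\ compact C, C `<=` E & (0 < mu C)%E].
Proof.
move=> cK mE EK E0.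
have mK : measurable (K : set (borel G)) by exact: compact_borel.
have muK : mu K \is a fin_num by rewrite ge0_fin_numE ?mu_compact.
have muE : mu E \is a fin_num.
  rewrite ge0_fin_numE // (le_lt_trans _ (mu_compact cK)) //.
  by apply: le_measure; rewrite ?inE.
have mKE : measurable (K `\` E : set (borel G)) by exact: measurableD.
have KE : (mu (K `\` E) < mu K)%E.
  rewrite measureD //; last by rewrite -ge0_fin_numE.
  by rewrite setIidr // lteBlDr // lteDl.
move: KE; rewrite (haar_outer_regular Hmu mKE) =>
  /ereal_inf_lt [_ [W [oW KEW] <-] WK].
have mW : measurable (W : set (borel G)) by exact: open_borel.
exists (K `\` W); split.
- apply: (subclosed_compact _ cK); last by move=> r [].
  by apply: closedI; [exact: compact_closed | exact: open_closedC].
- by move=> r [Kr nWr]; apply: contrapT => nEr; apply: nWr; apply: KEW.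
- rewrite lt0e measure_ge0 andbT; apply/negP => /eqP KW0.
  have : (mu K <= mu (K `\` W) + mu W)%E.
    have : (mu K <= mu ((K `\` W) `|` W))%E.
      apply: le_measure; rewrite ?inE //; first by apply: measurableU => //;
        exact: measurableD.
      by move=> r Kr; have [Wr|nWr] := pselect (W r); [right | left].
    move/le_trans; apply; apply: measureU2 => //; exact: measurableD.
  by rewrite KW0 add0e leNgt WK.
Qed.

(** Steinhaus: a translate [vC] of a compact set [C] of positive measure cannot
    miss [C] when both lie in an open set of measure less than [2 mu C]. *)
Lemma steinhaus (K : set G) (E : set (borel G)) : compact K -> measurable E ->
  E `<=` K -> (0 < mu E)%E ->
  \forall v \near (1%g : G), exists a b, [/\ E a, E b & v = (a * b^-1)%g].
Proof.
move=> cK mE EK E0; have [C [cC CE C0]] := compact_subset_positive cK mE EK E0.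
have mC : measurable (C : set (borel G)) by exact: compact_borel.
have muC : mu C \is a fin_num by rewrite ge0_fin_numE ?mu_compact.
have : (mu C < mu C + mu C)%E by rewrite -(fineK muC) -EFinD lte_fin ltrDl
  -lte_fin fineK.
rewrite {1}(haar_outer_regular Hmu mC) => /ereal_inf_lt [_ [W [oW CW] <-] WC].
have /compact_near_coveringP cov := cC.
have : \forall v \near (1%g : G), forall c, C c -> W (v * c)%g.
  apply: (cov G (nbhs (1%g : G)) (fun v c => W (v * c)%g)) => c Cc.
  have h : (q.2 * q.1)%g @[q --> (c, (1%g : G))] --> c.
    suff : (q.2 * q.1)%g @[q --> (c, (1%g : G))] --> (1 * c)%g by rewrite mul1g.
    by apply: cvg_mulg; [exact: cvg_snd | exact: cvg_fst].
  by apply: h; apply: open_nbhs_nbhs; split => //; exact: CW.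
apply: filterS => v vCW.
have mvC : measurable ([set (v * r)%g | r in C] : set (borel G)).
  have := measurable_mulgl v^-1%g measurableT mC; rewrite setTI.
  rewrite (_ : _ @^-1` C = [set (v * r)%g | r in C]) //.
  apply/seteqP; split => r /=; first by move=> Cr; exists (v^-1 * r)%g;
    rewrite ?mulVKg.
  by move=> [t Ct <-]; rewrite mulKg.
have [[r [Cr [b Cb vb]]]|disj] :=
  pselect (exists r, C r /\ [set (v * r)%g | r in C] r).
  exists r, b; split; [exact: CE | exact: CE | by rewrite -vb mulgK].
have : (mu (C `|` [set (v * r)%g | r in C]) <= mu W)%E.
  apply: le_measure; rewrite ?inE; first exact: measurableU.
    exact: open_borel.
  by move=> r [/CW //|[t Ct <-]]; exact: vCW.
rewrite measureU //; last first.
  by rewrite -subset0 => r [Cr vCr]; apply: disj; exists r.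
move=> CvC; have vC := haar_left_invariant Hmu v mC.
have : (mu C + mu C <= mu W)%E by apply: le_trans CvC;
  rewrite -[X in (_ + X <= _)%E]vC.
by rewrite leNgt WC.
Qed.

Section bound.
Variable w : G -> R.
Hypothesis Hw : weight w.

Lemma weight_ge0 s : 0 <= w s. Proof. by case: Hw. Qed.

Lemma weightM s t : w (s * t)%g <= w s * w t. Proof. by case: Hw. Qed.

Lemma weight_measurable : measurable_fun [set: borel G] (w : borel G -> R).
Proof. by case: Hw. Qed.

(** Some set on which [w s] and [w s^-1] are at most [n] has positive measure;
    Steinhaus makes its difference set a neighbourhood of 1, where
    submultiplicativity bounds [w] by [n^2]. *)
Lemma weight_near1 : exists n : R, \forall v \near (1%g : G), w v <= n.
Proof.
have [K cK K0] := compact_positive_measure.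
have mK : measurable (K : set (borel G)) by exact: compact_borel.
pose E (n : nat) : set (borel G) :=
  [set s | K s /\ w s <= n%:R /\ w s^-1%g <= n%:R].
have mE n : measurable (E n).
  have m1 := weight_measurable.
  have m2 : measurable_fun [set: borel G] (fun s : borel G => w s^-1%g).
    exact: measurableT_comp weight_measurable measurable_invg.
  rewrite (_ : E n = K `&` ((w @^-1` [set x | x <= n%:R]) `&`
      ((fun s : borel G => w s^-1%g) @^-1` [set x | x <= n%:R]))) //.
  apply: measurableI => //; apply: measurableI;
    rewrite -[X in measurable X]setTI.
    by apply: m1 => //; rewrite -set_itvNyc.
  by apply: m2 => //; rewrite -set_itvNyc.
have [n En0] : exists n, (0 < mu (E n))%E.
  apply: contrapT => /forallNP En; move: K0;
    rewrite lt_neqAle => /andP[/eqP + _]; apply.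
  apply/esym/measure_negligible => //.
  apply: (@negligibleS _ _ _ _ (\bigcup_n E n)).
    move=> s Ks; have [n Hn] : exists n : nat, Num.max (w s) (w s^-1%g) <= n%:R.
      exists (Num.truncn (Num.max (w s) (w s^-1%g))).+1; exact/ltW/truncnS_gt.
    by exists n => //; move: Hn; rewrite ge_max => /andP[].
  apply: negligible_bigcup => n; apply/negligibleP => //.
  by apply/eqP; rewrite eq_le measure_ge0 andbT leNgt; apply/negP/En.
exists (n%:R * n%:R); apply: filterS (steinhaus cK (mE n) _ En0) => [v|s []//].
move=> [a [b [[_ [wa _]] [_ [_ wb]] ->]]].
by rewrite (le_trans (weightM _ _)) // ler_pM ?weight_ge0.
Qed.

Lemma weight_near (t : G) : exists c : R, \forall s \near t, w s <= c.
Proof.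
have [n wn] := weight_near1; exists (w t * n).
have h : (t^-1 * s)%g @[s --> t] --> (1%g : G).
  by rewrite -(mulVg t); exact: mulgl_continuous.
have := h _ wn; rewrite nbhs_filterE /=; apply: filterS => s ws.
by rewrite -[s](mulVKg t) (le_trans (weightM _ _)) // ler_wpM2l ?weight_ge0.
Qed.

Lemma weight_compact (K : set G) : compact K ->
  exists2 C : R, 0 <= C & forall s, K s -> w s <= C.
Proof.
move=> /compact_near_coveringP cov.
have : \forall m \near \oo, forall s, K s -> w s <= m%:R.
  apply: (cov nat \oo (fun m s => w s <= m%:R)) => t _.
  have [c nt] := weight_near t.
  exists ([set s | w s <= c], [set m | c <= m%:R]) => /=.
    by split => //; exact: nbhs_infty_ger.
  by move=> [s m] /= [/le_trans]; apply.
by move=> [m _ /(_ m (leqnn m)) Hm]; exists m%:R.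
Qed.

Lemma weight_gt0 s : 0 < w s.
Proof.
have [w0 [t wt] _ _] := Hw; rewrite lt_neqAle w0 andbT; apply/eqP => ws.
have := weightM (t * s^-1)%g s; rewrite mulgVK -ws mulr0 => wt0.
by move: wt; rewrite eq_le w0 wt0.
Qed.

End bound.

End weights.

(** * Bounded operators, representations and strong limits *)

Section operator_norm.
Context (R : realType) (V W : normedModType R).

Lemma opnorm_le (f : V -> W) (C : R) : 0 <= C ->
  (forall v, `|f v| <= C * `|v|) -> opnorm f <= C.
Proof.
move=> C0 fC; apply: ge_sup; first by exists `|f 0|, 0 => //=; rewrite normr0.
by move=> _ [v /= v1 <-]; rewrite (le_trans (fC v)) // ler_piMr.
Qed.

Lemma le_opnorm (f : V -> W) v : bounded_operator f ->
  `|f v| <= opnorm f * `|v|.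
Proof.
move=> [lf [C fC]].
have [->|v0] := eqVneq v 0; first by rewrite linear_zero // !normr0 mulr0.
have nv : 0 < `|v| by rewrite normr_gt0.
have fv : `|f (`|v|^-1 *: v)| <= opnorm f.
  apply: ub_le_sup; last first.
    by exists (`|v|^-1 *: v) => //=;
      rewrite normrZ normfV normr_id mulVf // gt_eqF.
  exists `|C| => _ [u /= u1 <-]; rewrite (le_trans (fC u)) //.
  by rewrite (le_trans (ler_wpM2r _ (ler_norm C))) // ler_piMr.
rewrite -ler_pdivrMr // mulrC (le_trans _ fv) // linear_scale // normrZ.
by rewrite normfV normr_id.
Qed.

Lemma opnorm_ge0 (f : V -> W) : bounded_operator f -> 0 <= opnorm f.
Proof.
move=> bf; have [lf [C fC]] := bf; apply: ub_le_sup; last first.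
  by exists 0 => /=; rewrite ?normr0 // linear_zero // normr0.
exists `|C| => _ [u /= u1 <-]; rewrite (le_trans (fC u)) //.
by rewrite (le_trans (ler_wpM2r _ (ler_norm C))) // ler_piMr.
Qed.

End operator_norm.

(** In [N_i (v_i) = N_i (v_i - v) + N_i v] the common bound controls the first
    summand. *)
Lemma cvg_equibounded (R : realType) (V W : normedModType R) (I : Type)
    (F : set_system I) {FF : Filter F} (N : I -> V -> W) (C : R) (v_ : I -> V)
    (v : V) (y : W) :
  (forall i, linear (N i)) -> (forall i u, `|N i u| <= C * `|u|) ->
  N i v @[i --> F] --> y -> v_ @ F --> v -> N i (v_ i) @[i --> F] --> y.
Proof.
move=> lN NC Ny vv.
have -> : (fun i => N i (v_ i)) = (fun i => N i (v_ i - v) + N i v).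
  by apply/funext => i; rewrite -(linear_add (lN i)) subrK.
rewrite -[y]add0r; apply: cvgD => //.
have v0 : v_ i - v @[i --> F] --> (0 : V).
  by rewrite -(subrr v); apply: cvgB => //; exact: cvg_cst.
apply/cvgr0Pnorm_le => e e0.
have d0 : 0 < e / (`|C| + 1) by rewrite divr_gt0 // ltr_wpDl.
move/cvgr0Pnorm_le : v0 => /(_ _ d0); apply: filterS => i vi.
rewrite (le_trans (NC _ _)) // (le_trans (ler_wpM2r _ (ler_norm C))) //.
rewrite (le_trans (ler_wpM2l _ vi)) //.
by rewrite mulr_divD1_le // ltW.
Qed.

Section bounded_operator_calculus.
Context (R : realType) (U V W : normedModType R).

Lemma bounded_operator_comp (f : U -> V) (g : V -> W) :
  bounded_operator f -> bounded_operator g ->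
    bounded_operator (fun x => g (f x)).
Proof.
move=> [lf [C fC]] [lg [D gD]]; split; first by move=> c x y; rewrite /= lf lg.
exists (`|D| * C) => x; rewrite (le_trans (gD _)) //.
by rewrite (le_trans (ler_wpM2r _ (ler_norm D))) // -mulrA ler_wpM2l.
Qed.

Lemma bounded_operatorZD c (f g : U -> V) :
  bounded_operator f -> bounded_operator g ->
  bounded_operator (fun x => c *: f x + g x).
Proof.
move=> [lf [C fC]] [lg [D gD]]; split.
  move=> a x y; rewrite /= lf lg !scalerDr !scalerA [a * c]mulrC.
  by rewrite addrACA.
exists (`|c| * C + D) => x; rewrite (le_trans (ler_normD _ _)) // normrZ mulrDl.
by rewrite lerD // -mulrA ler_wpM2l.
Qed.

Lemma bounded_operator_id : bounded_operator (@id U).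
Proof. by split => //; exists 1 => v; rewrite mul1r. Qed.

End bounded_operator_calculus.

Section representations.
Context (R : realType) (B X : normedModType R) (mul : B -> B -> B).
Variable pi : B -> X -> X.
Hypothesis rpi : representation mul pi.

Lemma rep_bounded b : bounded_operator (pi b). Proof. by case: rpi. Qed.

Lemma rep_linear b : linear (pi b). Proof. by case: (rep_bounded b). Qed.

Lemma rep_linearl x : linear (fun b => pi b x).
Proof. by case: rpi => _ lpi _ c b1 b2; rewrite /= lpi. Qed.

Lemma repM b1 b2 x : pi (mul b1 b2) x = pi b1 (pi b2 x).
Proof.
by case: rpi.
Qed.

Lemma bounded_representationP : bounded_representation pi <->
  exists2 C : R, 0 <= C & forall b x, `|pi b x| <= C * `|b| * `|x|.
Proof.
split=> [[C piC]|[C C0 piC]].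
  exists `|C| => // b x; rewrite (le_trans (le_opnorm x (rep_bounded b))) //.
  by rewrite ler_wpM2r // (le_trans (piC b)) // ler_wpM2r // ler_norm.
by exists C => b; apply: opnorm_le; rewrite ?mulr_ge0.
Qed.

Lemma repnorm_le (C : R) : 0 <= C ->
  (forall b x, `|pi b x| <= C * `|b| * `|x|) -> repnorm pi <= C.
Proof.
move=> C0 piC; apply: ge_sup; first by exists (opnorm (pi 0)), 0 => //=;
  rewrite normr0.
move=> _ [b /= b1 <-]; apply: opnorm_le => // x.
by rewrite (le_trans (piC b x)) // ler_wpM2r // ler_piMr.
Qed.

Hypothesis bpi : bounded_representation pi.

Lemma repnorm_has_ubound :
  has_ubound [set opnorm (pi b) | b in [set b : B | `|b| <= 1]].
Proof.
have [C piC] := bpi; exists `|C| => _ [b /= b1 <-];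
  rewrite (le_trans (piC b)) //.
by rewrite (le_trans (ler_wpM2r _ (ler_norm C))) // ler_piMr.
Qed.

Lemma repnorm_ge0 : 0 <= repnorm pi.
Proof.
apply: (le_trans (opnorm_ge0 (rep_bounded 0))).
by apply: ub_le_sup; [exact: repnorm_has_ubound | exists 0 => //=;
  rewrite normr0].
Qed.

Lemma le_repnorm b x : `|pi b x| <= repnorm pi * `|b| * `|x|.
Proof.
have [->|b0] := eqVneq b 0.
  by rewrite (linear_zero (rep_linearl x)) !normr0 mulr0 mul0r.
have nb : 0 < `|b| by rewrite normr_gt0.
have -> : b = `|b| *: (`|b|^-1 *: b) by rewrite scalerA divff ?scale1r ?gt_eqF.
rewrite (linear_scale (rep_linearl x)) !normrZ !normr_id normfV normr_id.
rewrite mulVf ?gt_eqF // mulr1 mulrAC mulrC ler_wpM2r //.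
rewrite (le_trans (le_opnorm _ (rep_bounded _))) // ler_wpM2r //.
apply: ub_le_sup; first exact: repnorm_has_ubound.
exists (`|b|^-1 *: b) => //=.
by rewrite normrZ normfV normr_id mulVf // gt_eqF.
Qed.

Lemma rep_continuous b : continuous (pi b).
Proof. exact: bounded_operator_continuous (rep_bounded b). Qed.

Lemma rep_continuousl x : continuous (fun b => pi b x).
Proof.
have [C C0 piC] := bounded_representationP.1 bpi.
apply: (linear_bounded_continuous (rep_linearl x) (C := C * `|x|)) => b.
by rewrite mulrAC.
Qed.

Lemma cvg_rep (I : Type) (F : set_system I) {FF : Filter F} (b_ : I -> B)
    (x_ : I -> X) b x :
  b_ @ F --> b -> x_ @ F --> x -> pi (b_ i) (x_ i) @[i --> F] --> pi b x.
Proof.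
move=> bb xx; have [C C0 piC] := bounded_representationP.1 bpi.
have -> : (fun i => pi (b_ i) (x_ i)) =
    (fun i => pi (b_ i - b) (x_ i - x) + pi (b_ i - b) x + pi b (x_ i)).
  apply/funext => i; rewrite -(linear_add (rep_linear _)) subrK.
  rewrite (linear_sub (rep_linearl (x_ i))) subrK //.
have -> : pi b x = 0 + 0 + pi b x by rewrite !add0r.
have b0 : b_ i - b @[i --> F] --> (0 : B) by rewrite -(subrr b);
  apply: cvgB => //; exact: cvg_cst.
have x0 : x_ i - x @[i --> F] --> (0 : X) by rewrite -(subrr x);
  apply: cvgB => //; exact: cvg_cst.
apply: cvgD; first apply: cvgD;
  last exact: (cvg_continuous_comp (@rep_continuous b) xx).
- apply/cvgr0Pnorm_le => e e0.
  have d0 : 0 < e / (C + 1) by rewrite divr_gt0 // ltr_wpDl.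
  near=> i; rewrite (le_trans (piC _ _)) //.
  have h1 : `|b_ i - b| <= 1 by near: i; move/cvgr0Pnorm_le : b0; exact.
  have h2 : `|x_ i - x| <= e / (C + 1) by near: i; move/cvgr0Pnorm_le : x0;
    exact.
  apply: (@le_trans _ _ (C * 1 * (e / (C + 1)))).
    by rewrite ler_pM ?mulr_ge0 // ler_wpM2l.
  by rewrite mulr1 mulrCA ger_pMr // ler_pdivrMr ?ltr_wpDl // mul1r lerDl.
- rewrite -(linear_zero (rep_linearl x)).
  exact: (cvg_continuous_comp (@rep_continuousl x) b0).
Unshelve. all: by end_near. Qed.

End representations.

Section density.
Context (R : realType).

Lemma dense_closed_ind (T : topologicalType) (S P : set T) :
  dense S -> closed P -> S `<=` P -> forall t, P t.
Proof.
move=> dS cP SP t; apply: contrapT => nPt.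
have [|u [nPu Su]] := dS (~` P) _ (closed_openC cP); first by exists t.
exact: nPu (SP _ Su).
Qed.

Lemma closed_eq_fun (T : topologicalType) (V : normedModType R) (f g : T -> V) :
  continuous f -> continuous g -> closed [set t | f t = g t].
Proof.
move=> cf cg; have -> : [set t | f t = g t] =
  (fun t => f t - g t) @^-1` [set 0].
  by apply/seteqP; split => t /=; [move=> ->; rewrite subrr | move/subr0_eq].
apply: (continuous_closedP _).1; last first.
  apply: accessible_closed_set1; apply: hausdorff_accessible.
  exact: norm_hausdorff.
by move=> t; apply: cvgB; [exact: cf | exact: cg].
Qed.

(** A closed linear property need only be checked on the vectors [pi b x]. *)
Lemma nondegenerate_ind (B X : normedModType R) (pi : B -> X -> X) (P : set X) :
  Defs.nondegenerate pi -> closed P -> P 0 ->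
  (forall c x y, P x -> P y -> P (c *: x + y)) -> (forall b x, P (pi b x)) ->
  forall x, P x.
Proof.
move=> nd cP P0 PZD Ppi; apply: (dense_closed_ind nd cP) =>
  _ [n [c [x [Sx ->]]]].
elim: n c x Sx => [|n IHn] c x Sx; first by rewrite big_ord0.
rewrite big_ord_recl; apply: PZD; last exact: IHn.
by have [[b y] _ <-] := Sx ord0; exact: Ppi.
Qed.

(** Extension by continuity of a bounded linear map given on the image of a
    dense parametrization [iota]; [iota] need not be injective, so the bound
    also makes the extension well defined. *)
Section extension.
Context (Y : Type) (L : normedModType R) (X : completeNormedModType R).
Variables (D : set Y) (iota : Y -> L) (phi : Y -> X) (C : R).
Hypothesis C0 : 0 <= C.
Hypothesis iotaD : dense (iota @` D).
Hypothesis comb : forall c f g, D f -> D g -> exists h,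
  [/\ D h, iota h = c *: iota f + iota g & phi h = c *: phi f + phi g].
Hypothesis phi_le : forall f, D f -> `|phi f| <= C * `|iota f|.

Let phi_dist f g : D f -> D g -> `|phi f - phi g| <= C * `|iota f - iota g|.
Proof.
move=> Df Dg; have [h [Dh hE pE]] := comb (-1) Dg Df.
by have := phi_le Dh; rewrite hE pE !scaleN1r ![- _ + _]addrC.
Qed.

Let near_dense l e : 0 < e -> exists2 f, D f & `|iota f - l| <= e.
Proof.
move=> e0; have [|v [fe [f Df fE]]] := iotaD _ (@ball_open _ _ l e).
  by exists l; exact: ballxx.
by exists f => //; move: fe; rewrite -fE -ball_normE /= distrC => /ltW.
Qed.

Let ext_filter l : set_system Y :=
  [set Q | exists2 e, 0 < e & forall f, D f -> `|iota f - l| <= e -> Q f].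

Let ext_filter_proper l : ProperFilter (ext_filter l).
Proof.
split; first by move=> [e e0 Qe]; have [f Df /(Qe _ Df)] := near_dense l e0.
split; first by exists 1.
- move=> P Q [e e0 Pe] [d d0 Qd]; exists (Num.min e d);
    first by rewrite lt_min e0.
  by move=> f Df; rewrite le_min => /andP[fe fd]; split;
    [exact: Pe | exact: Qd].
- by move=> P Q PQ [e e0 Pe]; exists e => // f Df fe; apply: PQ; exact: Pe.
Qed.

Let ext_cvg l : cvg (phi f @[f --> ext_filter l]).
Proof.
have PF := ext_filter_proper l; apply: cvg_of_approx => e e0.
have d0 : 0 < e / 2 / (C + 1) by rewrite !divr_gt0 // ltr_wpDl.
have [g Dg gl] := near_dense l d0; exists (phi g), (e / 2 / (C + 1)) =>
  // f Df fl.
apply: (le_trans (phi_dist Df Dg)).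
have fg : `|iota f - iota g| <= e / (C + 1).
  rewrite -(subrKA l) (le_trans (ler_normD _ _)) // (distrC l).
  by rewrite [e]splitr mulrDl lerD.
rewrite (le_trans (ler_wpM2l C0 fg)) // mulrCA ger_pMr // ler_pdivrMr ?ltr_wpDl
  //.
by rewrite mul1r lerDl.
Qed.

Lemma extend_bounded : exists T : L -> X,
  [/\ linear T, forall l, `|T l| <= C * `|l| & forall f, D f ->
    T (iota f) = phi f].
Proof.
pose T l := lim (phi f @[f --> ext_filter l]).
have TP l e : 0 < e -> exists f,
    [/\ D f, `|iota f - l| <= e & `|T l - phi f| <= e].
  move=> e0; have PF := ext_filter_proper l.
  have nT : \forall f \near ext_filter l, `|T l - phi f| <= e.
    by have /cvgrPdist_le/(_ e e0) := @ext_cvg l.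
  have nD : \forall f \near ext_filter l, D f /\ `|iota f - l| <= e by exists e.
  by have [f [Tf [Df fl]]] := filter_ex (filterI nT nD); exists f.
have T_le l : `|T l| <= C * `|l|.
  apply/ler_addgt0Pr => e e0.
  have d0 : 0 < e / (C + 1) by rewrite divr_gt0 // ltr_wpDl.
  have [f [Df fl Tf]] := TP l _ d0.
  rewrite -(subrK (phi f) (T l)) (le_trans (ler_normD _ _)) //.
  have : `|phi f| <= C * (`|l| + e / (C + 1)).
    rewrite (le_trans (phi_le Df)) // ler_wpM2l // -(subrK l (iota f)) addrC.
    by rewrite (le_trans (ler_normD _ _)) // lerD2l.
  move=> pf; rewrite (le_trans (lerD Tf pf)) // mulrDr addrCA lerD2l.
  rewrite -{1}[e / _]mul1r -mulrDl addrC mulrCA mulfV ?mulr1 //.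
  by rewrite gt_eqF // ltr_wpDl.
have T_dist l f : D f -> `|T l - phi f| <= C * `|l - iota f|.
  move=> Df; apply/ler_addgt0Pr => e e0.
  have d0 : 0 < e / (C + 1) by rewrite divr_gt0 // ltr_wpDl.
  have [g [Dg gl Tg]] := TP l _ d0.
  rewrite -(subrK (phi g) (T l)) -addrA (le_trans (ler_normD _ _)) //.
  have pf : `|phi g - phi f| <= C * (`|l - iota f| + e / (C + 1)).
    rewrite (le_trans (phi_dist Dg Df)) // ler_wpM2l // -(subrKA l) addrC.
    by rewrite (le_trans (ler_normD _ _)) // lerD2l.
  rewrite (le_trans (lerD Tg pf)) // mulrDr addrCA lerD2l.
  rewrite -{1}[e / _]mul1r -mulrDl addrC mulrCA mulfV ?mulr1 //.
  by rewrite gt_eqF // ltr_wpDl.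
have TE f : D f -> T (iota f) = phi f.
  move=> Df; apply/subr0_eq/eqP; rewrite -normr_le0.
  by rewrite (le_trans (T_dist _ _ Df)) // subrr normr0 mulr0.
exists T; split => // c l m; apply/subr0_eq/eqP; rewrite -normr_le0.
apply/ler_addgt0Pr => e e0; rewrite add0r.
pose k := C * (`|c| + 1) + `|c| + 1.
have k0 : 0 < k by rewrite ltr_wpDl // addr_ge0 // mulr_ge0 // addr_ge0.
have d0 : 0 < e / k by rewrite divr_gt0.
have [f [Df fl Tf]] := TP l _ d0; have [g [Dg gm Tg]] := TP m _ d0.
have [h [Dh hE pE]] := comb c Df Dg.
have Th : `|T (c *: l + m) - phi h| <= C * ((`|c| + 1) * (e / k)).
  rewrite (le_trans (T_dist _ _ Dh)) // ler_wpM2l // hE opprD addrACA -scalerBr.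
  rewrite (le_trans (ler_normD _ _)) // mulrDl mul1r lerD //.
    by rewrite normrZ distrC ler_wpM2l.
  by rewrite distrC.
have -> : T (c *: l + m) - (c *: T l + T m) =
  (T (c *: l + m) - phi h) - (c *: (T l - phi f) + (T m - phi g)).
  by rewrite pE scalerBr addrACA -opprD opprB addrA subrK.
rewrite (le_trans (ler_normB _ _)) //.
have cfg : `|c *: (T l - phi f) + (T m - phi g)| <= (`|c| + 1) * (e / k).
  rewrite (le_trans (ler_normD _ _)) // mulrDl mul1r lerD //.
  by rewrite normrZ ler_wpM2l.
rewrite (le_trans (lerD Th cfg)) // mulrA -mulrDl /k -addrA.
by rewrite mulrCA mulfV ?mulr1 // gt_eqF // addrA.
Qed.

End extension.

Section strong_limits.
Context (X : completeNormedModType R) (I : Type) (F : set_system I).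
Context {FF : ProperFilter F}.
Variables (N : I -> X -> X) (C : R).
Hypothesis C0 : 0 <= C.
Hypothesis linN : \forall i \near F, linear (N i).
Hypothesis N_le : \forall i \near F, forall x, `|N i x| <= C * `|x|.

Let N_dist : \forall i \near F, forall x y, `|N i x - N i y| <= C * `|x - y|.
Proof.
by apply: filterS2 linN N_le => i li bi x y; rewrite -(linear_sub li).
Qed.

Lemma strong_cvg_closed : closed [set x | cvg (N i x @[i --> F])].
Proof.
move=> x clx; apply: cvg_of_approx => e e0.
have d0 : 0 < e / 2 / (C + 1) by rewrite !divr_gt0 // ltr_wpDl.
have [y [/= cy yx]] := clx _ (nbhsx_ballx x _ d0).
exists (lim (N i y @[i --> F])).
have e20 : 0 < e / 2 by rewrite divr_gt0.
move/cvgrPdist_le : cy => /(_ _ e20); apply: filterS2 N_dist => i di ny.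
rewrite -(subrKA (N i y)) (le_trans (ler_normD _ _)) // [e]splitr.
rewrite lerD //; last by rewrite distrC.
rewrite (le_trans (di _ _)) //.
move: yx; rewrite -ball_normE /= => /ltW yx;
  rewrite (le_trans (ler_wpM2l C0 yx)) //.
by rewrite mulr_divD1_le // ltW.
Qed.

Lemma strong_cvg_to_closed (P : X -> X) : linear P ->
  (forall x, `|P x| <= C * `|x|) ->
  closed [set x | N i x @[i --> F] --> P x].
Proof.
move=> lP P_le x clx; apply/cvgrPdist_le => e e0.
have e30 : 0 < e / 3 by rewrite divr_gt0.
have d0 : 0 < e / 3 / (C + 1) by rewrite !divr_gt0 // ltr_wpDl.
have [y [/= cy yx]] := clx _ (nbhsx_ballx x _ d0).
move/cvgrPdist_le : cy => /(_ _ e30); apply: filterS2 N_dist => i di ny.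
have Cyx : C * `|x - y| <= e / 3.
  move: yx; rewrite -ball_normE /= => /ltW yx;
    rewrite (le_trans (ler_wpM2l C0 yx)) //.
  by rewrite mulr_divD1_le // ltW.
have -> : P x - N i x = (P x - P y) + (P y - N i y) + (N i y - N i x).
  by rewrite !addrA !subrK.
have -> : e = e / 3 + e / 3 + e / 3 by field.
rewrite (le_trans (ler_normD _ _)) // lerD //.
  rewrite (le_trans (ler_normD _ _)) // lerD //.
  by rewrite -(linear_sub lP) (le_trans (P_le _)).
by rewrite (le_trans (di _ _)) // distrC.
Qed.

Lemma strong_limit :
  (forall x, cvg (N i x @[i --> F])) -> exists Q : X -> X,
   [/\ linear Q, forall x, `|Q x| <= C * `|x| & forall x, N i x @[i --> F] -->
     Q x].
Proof.
move=> cN; exists (fun x => lim (N i x @[i --> F])); split => //.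
- move=> c x y; apply: cvg_norm_unique (cN (c *: x + y)) _.
  have h : c *: N i x + N i y @[i --> F] -->
      c *: lim (N i x @[i --> F]) + lim (N i y @[i --> F]).
    by apply: cvgD => //; apply: cvgZ => //; exact: cvg_cst.
  move: h; apply: cvg_trans; apply: near_eq_cvg.
  by apply: filterS linN => i li; rewrite /= li.
- move=> x.
  have nx : `|N i x| @[i --> F] --> `|lim (N i x @[i --> F])|.
    by apply: cvg_norm; exact: cN.
  by apply: (cvgr_to_le nx); apply: filterS N_le => i.
Qed.

End strong_limits.

End density.

(** * Nets of densities and the Beurling algebra *)

Section nets.

Lemma tails_proper (I : Type) (D : set I) (le : I -> I -> Prop) :
  D !=set0 -> (forall i, le i i) ->
    (forall i j k, le i j -> le j k -> le i k) ->
  (forall i j, D i -> D j -> exists k, [/\ D k, le i k & le j k]) ->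
  ProperFilter (tails D le).
Proof.
move=> [i0 Di0] rfl trs dir; split.
  by move=> [i Di]; apply; [exact: Di | exact: rfl].
split.
- by exists i0.
- move=> P Q [i Di Pi] [j Dj Qj]; have [k [Dk ik jk]] := dir i j Di Dj.
  by exists k => // l Dl kl; split; [apply: Pi|apply: Qj] => //; exact: trs kl.
- by move=> P Q PQ [i Di Pi]; exists i => // j Dj ij; apply: PQ; exact: Pi.
Qed.

Lemma directed_tails_proper (I : Type) (le : I -> I -> Prop) :
  directed le -> ProperFilter (tails setT le).
Proof.
move=> [[i] rfl trs dir]; apply: tails_proper => //; first by exists i.
by move=> j k _ _; have [l jl kl] := dir j k; exists l.
Qed.

Context (G : topologicalGroupType) (Z : set (set G)).
Hypothesis HZ : small_nbhs_base Z.
Context (I : Type) (le : I -> I -> Prop).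
Hypothesis Hle : directed le.

Lemma pair_tails_proper : ProperFilter (pair_tails Z le).
Proof.
have [Znbhs Zbase _] := HZ; have [[i0] rfl trs dir] := Hle.
apply: tails_proper.
- have [V ZV _] := Zbase setT filterT; by exists (V, i0).
- by move=> [V i]; split.
- move=> [V i] [W j] [Y k] [/= ij WV] [/= jk YW]; split; first exact: trs jk.
  exact: subset_trans WV.
- move=> [V i] [W j] /= ZV ZW; have [k ik jk] := dir i j.
  have [Y ZY YVW] := Zbase _ (filterI (Znbhs _ ZV) (Znbhs _ ZW)).
  by exists (Y, k); split => //; split => //= r /YVW [].
Qed.

Lemma near_pair_tails_sub (V : set G) : Z V ->
  \forall p \near pair_tails Z le, Z p.1 /\ p.1 `<=` V.
Proof.
move=> ZV; have [[i0] _ _ _] := Hle.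
by exists (V, i0) => //= -[W i] /= ZW [].
Qed.

Lemma near_pair_tails_base : \forall p \near pair_tails Z le, Z p.1.
Proof.
have [_ Zbase _] := HZ; have [V ZV _] := Zbase setT filterT.
by have [[i0] _ _ _] := Hle; exists (V, i0).
Qed.

(** Joint limits in a group variable tending to 1 and an index become limits
    along the net of pairs, uniformly on the neighbourhood of the pair. *)
Lemma near_pair_tails (P : G -> I -> Prop) :
  (\forall v \near (1%g : G) & i \near tails setT le, P v i) ->
  \forall p \near pair_tails Z le, Z p.1 /\ forall v, p.1 v -> P v p.2.
Proof.
have [Znbhs Zbase _] := HZ.
move=> [[N B] /= [N1 [i0 _ Bi]] NB]; have [V ZV VN] := Zbase _ N1.
exists (V, i0) => //= -[W i] /= ZW [/= i0i WV]; split => // v Wv.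
by apply: (NB (v, i)); split => /=; [apply/VN/WV | exact: Bi].
Qed.

End nets.

Section compact_support.
Context (R : realType) (G : topologicalGroupType) (V : normedModType R).
Hypothesis hausG : hausdorff_space G.

Lemma cc_on_Cc (K : set G) (f : G -> V) : compact K ->
  continuous f -> vanishes_off K f -> Cc f.
Proof.
move=> cK cf fK; split => //; apply: (subclosed_compact _ cK);
  first exact: closed_closure.
move=> s sf; apply: (compact_closed hausG cK);
  apply: closure_subset sf => t /= ft.
by apply: contrapT => /fK ft0; rewrite ft0 eqxx in ft.
Qed.

Lemma vanishes_off_supp (f : G -> V) : vanishes_off (supp f) f.
Proof.
move=> s fs; apply: contrapT => /eqP fs0; apply: fs; exact: subset_closure.
Qed.

End compact_support.

Section beurling_data.
Context (R : realType) (A : completeNormedModType R) (mulA : A -> A -> A).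
Context (coneA : set A) (G : topologicalGroupType) (alpha : G -> A -> A).
Hypothesis Halpha : dynamical_system mulA coneA alpha.
Hypothesis Hunif : uniformly_bounded alpha.

Lemma ds_hausdorff : hausdorff_space G. Proof. by case: Halpha => _ []. Qed.

Lemma mulA_linearr a : linear (mulA a).
Proof. by case: Halpha => -[[[]]]. Qed.

Lemma mulA_linearl a : linear (mulA^~ a).
Proof. by case: Halpha => -[[[]]]. Qed.

Lemma mulAA : associative mulA.
Proof. by case: Halpha => -[[[]]]. Qed.

Lemma mulA_norm a b : `|mulA a b| <= `|a| * `|b|.
Proof. by case: Halpha => -[[]]. Qed.

Lemma mulA_bounded a : bounded_operator (mulA a).
Proof.
by split; [exact: mulA_linearr | exists `|a| => b; exact: mulA_norm].
Qed.

Lemma alpha_linear s : linear (alpha s).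
Proof. by case: Halpha => _ _ /(_ s) [[]]. Qed.

Lemma alphaM s a b : alpha s (mulA a b) = mulA (alpha s a) (alpha s b).
Proof. by case: Halpha => _ _ /(_ s) []. Qed.

Lemma alpha_mulg s t a : alpha (s * t)%g a = alpha s (alpha t a).
Proof. by case: Halpha. Qed.

(** [alpha 1] is idempotent and injective. *)
Lemma alpha1 a : alpha 1%g a = a.
Proof.
have [gamma [K1 K2 _ _]] : exists gamma : A -> A, [/\ cancel (alpha 1%g) gamma,
    cancel gamma (alpha 1%g),
      alpha 1%g @` coneA `<=` coneA & gamma @` coneA `<=` coneA].
  by case: Halpha => _ _ /(_ 1%g) [].
by apply: (can_inj K1); rewrite -alpha_mulg mulg1.
Qed.

Lemma alpha_orbit_continuous a : continuous (alpha^~ a).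
Proof. by case: Halpha. Qed.

Lemma alpha_bound : exists2 C : R, 0 <= C & forall s a,
  `|alpha s a| <= C * `|a|.
Proof.
have [C HC] := Hunif; exists `|C| => // s a.
have bs : bounded_operator (alpha s) by case: Halpha => _ _ /(_ s) [].
rewrite (le_trans (le_opnorm a bs)) // ler_wpM2r //.
by rewrite (le_trans _ (ler_norm C)) // HC //; exists s.
Qed.

Lemma alpha_bounded s : bounded_operator (alpha s).
Proof. by case: Halpha => _ _ /(_ s) []. Qed.

Lemma cvg_alpha (I : Type) (F : set_system I) {FF : Filter F}
    (s_ : I -> G) (a_ : I -> A) s a :
  s_ @ F --> s -> a_ @ F --> a -> alpha (s_ i) (a_ i) @[i --> F] --> alpha s a.
Proof.
move=> ss aa; have [C _ alphaC] := alpha_bound.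
apply: (cvg_equibounded (fun i => @alpha_linear (s_ i))
  (fun i => alphaC (s_ i)) _ aa).
exact: (cvg_continuous_comp (@alpha_orbit_continuous a) ss).
Qed.

(** As the left regular representation, the product inherits joint continuity
    from [cvg_rep]. *)
Lemma mulA_representation : representation mulA mulA.
Proof.
split; first exact: mulA_bounded; last by move=> a b c; rewrite mulAA.
by move=> c a b x; exact: mulA_linearl.
Qed.

Lemma mulA_bounded_representation : bounded_representation mulA.
Proof.
apply/(bounded_representationP mulA_representation); exists 1 => // a b.
by rewrite mul1r mulA_norm.
Qed.

End beurling_data.

Section beurling_norm.
Context (R : realType) (A : completeNormedModType R) (mulA : A -> A -> A).
Context (coneA : set A) (G : topologicalGroupType) (alpha : G -> A -> A).
Variable mu : {measure set (borel G) -> \bar R}.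
Variable w : G -> R.
Context (L : completeNormedModType R) (iota : (G -> A) -> L) (mulL : L -> L ->
  L).
Hypothesis Halpha : dynamical_system mulA coneA alpha.
Hypothesis Hunif : uniformly_bounded alpha.
Hypothesis Hmu : left_haar_measure mu.
Hypothesis Hw : weight w.
Hypothesis HL : beurling_algebra mu mulA alpha w iota mulL.
Let hausG : hausdorff_space G := ds_hausdorff Halpha.
Let mu_compact := haar_compact Hmu.

Lemma cc_on_supp (V : normedModType R) (f : G -> V) : Cc f -> cc_on (supp f) f.
Proof. by move=> [cf _]; split => //; exact: vanishes_off_supp. Qed.

Lemma cc_bounded (V : normedModType R) (f : G -> V) (K : set G) :
  compact K -> cc_on K f -> exists2 M : R, 0 <= M & forall s, `|f s| <= M.
Proof.
move=> /compact_near_coveringP cov [cf fK].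
have : \forall m \near \oo, forall s, K s -> `|f s| <= m%:R.
  apply: (cov nat \oo (fun m s => `|f s| <= m%:R)) => t _.
  exists ([set s | `|f s| <= `|f t| + 1], [set m | `|f t| + 1 <= m%:R]) => /=.
    split; last exact: nbhs_infty_ger.
    have h : `|f s| @[s --> t] --> `|f t| by apply: cvg_norm; exact: cf.
    by apply: (cvgr_le _ h); rewrite ltrDl.
  by move=> [s m] /= [/le_trans]; apply.
move=> [m _ /(_ m (leqnn m)) Hm]; exists m%:R => // s.
have [Ks|Ks] := pselect (K s); first exact: Hm.
by rewrite fK // normr0.
Qed.

Lemma weighted_norm_measurable (f : G -> A) : continuous f ->
  measurable_fun [set: borel G] ((fun s => `|f s| * w s) : borel G -> R).
Proof.
move=> cf; apply: measurable_funM; first exact: continuous_norm_borel.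
exact: weight_measurable Hw.
Qed.

Lemma integral_weighted_le (f : G -> A) (K : set G) (e c : R) : compact K ->
  cc_on K f -> 0 <= e -> 0 <= c -> (forall s, `|f s| <= e) ->
  (forall s, K s -> w s <= c) ->
  (\int[mu]_s (`|f s| * w s)%:E <= (e * c * fine (mu K))%:E)%E.
Proof.
move=> cK [cf fK] e0 c0 fe wc.
have mK : measurable (K : set (borel G)) by exact: compact_borel.
have muK : mu K \is a fin_num by rewrite ge0_fin_numE ?mu_compact.
have w0 := weight_ge0 Hw.
apply: (@le_trans _ _ (\int[mu]_r (e * c * \1_K r)%:E)%E).
  apply: ge0_le_integral => //.
  - by move=> r _; rewrite lee_fin mulr_ge0.
  - by apply/measurable_EFinP; exact: weighted_norm_measurable.
  - by apply/measurable_EFinP; exact: measurable_funM.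
  - move=> r _; rewrite lee_fin indicE; have [Kr|Kr] := pselect (K r).
      by rewrite mem_set // mulr1 ler_pM // wc.
    by rewrite fK // normr0 mul0r mulr_ge0 // mulr_ge0.
rewrite (@integralZl_indic _ _ _ mu setT measurableT (fun=> K)) //.
  by rewrite integral_indic // setIT [leRHS]EFinM fineK.
by move=> e_lt0; move: (mulr_ge0 e0 c0); rewrite leNgt e_lt0.
Qed.

Lemma norm1w_integral (f : G -> A) : Cc f ->
  (\int[mu]_s (`|f s| * w s)%:E)%E = (norm1w mu w f)%:E.
Proof.
move=> Cf; have cK : compact (supp f) by case: Cf.
have [M M0 fM] := cc_bounded cK (cc_on_supp Cf).
have [c c0 wc] := weight_compact hausG Hmu Hw cK.
rewrite /norm1w /Rintegral fineK // ge0_fin_numE.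
  apply: le_lt_trans (integral_weighted_le cK (cc_on_supp Cf) M0 c0 fM wc) _.
  by rewrite ltry.
by apply: integral_ge0 => r _; rewrite lee_fin mulr_ge0 // (weight_ge0 Hw).
Qed.

Lemma iota_linear c f g : Cc f -> Cc g ->
  iota (fun s => c *: f s + g s) = c *: iota f + iota g.
Proof. exact: beurling_linear HL c f g. Qed.

(** The weight is bounded on [K] and [K] has finite measure. *)
Lemma iota_le (K : set G) : compact K ->
  exists2 C : R, 0 <= C & forall f e, cc_on K f -> 0 <= e ->
    (forall s, `|f s| <= e) -> `|iota f| <= C * e.
Proof.
move=> cK; have [c c0 wc] := weight_compact hausG Hmu Hw cK.
exists (c * fine (mu K)); first by rewrite mulr_ge0 // fine_ge0.
move=> f e [cf fK] e0 fe; have Cf := cc_on_Cc hausG cK cf fK.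
rewrite (beurling_norm HL Cf) -lee_fin -norm1w_integral //.
have -> : c * fine (mu K) * e = e * c * fine (mu K) by ring.
exact: integral_weighted_le cK (conj cf fK) e0 c0 fe wc.
Qed.

Definition twisted_integrand (f g : G -> A) (p : G * G) : A :=
  mulA (f p.1) (alpha p.1 (g (p.1^-1 * p.2)%g)).

Definition mul_set (K1 K2 : set G) : set G :=
  [set (p.1 * p.2)%g | p in K1 `*` K2].

Section twisted_integrands.
Variables (f g : G -> A) (K1 K2 : set G).
Hypotheses (cK1 : compact K1) (cK2 : compact K2).
Hypotheses (ccf : cc_on K1 f) (ccg : cc_on K2 g).

Lemma twisted_integrand_continuous : continuous (twisted_integrand f g).
Proof.
move=> p; have [cf _] := ccf; have [cg _] := ccg.
have h1 : (q.1 : G) @[q --> p] --> p.1 by exact: cvg_fst.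
have h2 : (q.2 : G) @[q --> p] --> p.2 by exact: cvg_snd.
apply: (cvg_rep (mulA_representation Halpha)
  (mulA_bounded_representation Halpha)).
  exact: (cvg_continuous_comp cf h1).
apply: (cvg_alpha Halpha Hunif h1).
apply: (cvg_continuous_comp cg).
by apply: cvg_mulg h2; exact: cvg_invg.
Qed.

Lemma twisted_integrand_vanishes r s : ~ (K1 r /\ mul_set K1 K2 s) ->
  twisted_integrand f g (r, s) = 0.
Proof.
move=> nrs; rewrite /twisted_integrand /=; have [_ fK] := ccf;
  have [_ gK] := ccg.
have [Kr|Kr] := pselect (K1 r); last first.
  by rewrite fK // (linear_zero (mulA_linearl Halpha _)).
rewrite gK ?(linear_zero (alpha_linear Halpha _)).
  by rewrite (linear_zero (mulA_linearr Halpha _)).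
move=> Ks; apply: nrs; split => //.
by exists (r, (r^-1 * s)%g) => //=; rewrite mulVKg.
Qed.

Lemma twisted_convE : twisted_conv mu mulA alpha f g =
  param_integral mu (twisted_integrand f g).
Proof. by []. Qed.

Lemma twisted_conv_cc : cc_on (mul_set K1 K2) (twisted_conv mu mulA alpha f g).
Proof.
rewrite twisted_convE; apply: (cc_on_param hausG Hmu cK1).
  exact: twisted_integrand_continuous.
exact: twisted_integrand_vanishes.
Qed.

End twisted_integrands.

Section densities_at_identity.
Variables (Z : set (set G)) (z : set G -> G -> R).
Hypothesis Hz : bump_family mu Z z.

Definition translated_density (V : set G) (s : G) : G -> R :=
  ltranslate s (z V).

(** [K] is the translate by [s] of the support of [z V], hence lies in [sV]. *)
Lemma translated_densityP (V : set G) (s : G) : Z V ->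
  exists K : set G, [/\ compact K,
    continuous (translated_density V s) /\
      vanishes_off K (translated_density V s),
   (forall r, 0 <= translated_density V s r),
   (\int[mu]_r (translated_density V s r)%:E = 1)%E &
   forall r, (translated_density V s r != 0 -> V (s^-1 * r)%g) /\
             (K r -> V (s^-1 * r)%g)].
Proof.
move=> ZV; have [[cz csupp] z0 zV intz] := Hz ZV.
have cs : continuous (translated_density V s).
  by move=> r; apply: (cvg_continuous_comp cz); exact: mulgl_continuous.
exists [set (s * r)%g | r in supp (z V)]; split => //.
- by apply: compact_image csupp; exact: mulgl_continuous.
- split=> // r Kr; apply: contrapT => /eqP nz; apply: Kr.
  by exists (s^-1 * r)%g; rewrite ?mulVKg //; exact: subset_closure.
- by move=> r; exact: z0.
- rewrite -[RHS]intz -(integral_mulgl Hmu s^-1%g (f := fun r => (z V r)%:E)) //.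
  by apply/measurable_EFinP; exact: continuous_borel.
- move=> r; split => [nz|[t tz <-]]; last by rewrite mulKg; exact: zV.
  by apply: zV; exact: subset_closure.
Qed.

Lemma tensor_cc (V : set G) (s : G) (K : set G) (a : A) :
  continuous (translated_density V s) ->
    vanishes_off K (translated_density V s) ->
  cc_on K (tensor (translated_density V s) a).
Proof.
move=> cz zK; split; last by move=> r Kr; rewrite /tensor zK // scale0r.
by move=> r; apply: cvgZ; [exact: cz | exact: cvg_cst].
Qed.

Lemma tensor_Cc (V : set G) (s : G) (a : A) : Z V ->
  Cc (tensor (translated_density V s) a).
Proof.
move=> /(translated_densityP s) [K [cK [cz zK] _ _ _]].
by have [cf fK] := tensor_cc a cz zK; exact: cc_on_Cc cf fK.
Qed.

(** The bound is taken over [sV] itself rather than as [w s] times a bound over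
    [V], so that no factor [w 1] appears when [s] is 1. *)
Lemma iota_tensor_le (V : set G) (s : G) (a : A) (c : R) : Z V ->
  (forall v, V v -> w (s * v)%g <= c) ->
  `|iota (tensor (translated_density V s) a)| <= c * `|a|.
Proof.
move=> ZV wc; rewrite (beurling_norm HL (tensor_Cc s a ZV)) -lee_fin.
rewrite -norm1w_integral; last exact: tensor_Cc.
have [K [cK [cz zK] z0 intz zV]] := translated_densityP s ZV.
have w0 := weight_ge0 Hw; have cK' := continuous_borel cz.
have c0 : 0 <= c.
  apply: contrapT => c0; have :
    (\int[mu]_r (translated_density V s r)%:E = 0)%E.
    apply: integral0_eq => r _; apply/eqP; rewrite eqe;
      apply: contrapT => /negP zr.
    by have [/(_ zr) Vr _] := zV r; apply: c0; exact: le_trans (w0 _) (wc _ Vr).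
  by rewrite intz => /eqP; rewrite eqe oner_eq0.
have k0 : 0 <= c * `|a| by rewrite !mulr_ge0.
apply: (@le_trans _ _ (\int[mu]_r
  ((c * `|a|)%:E * (translated_density V s r)%:E))%E).
  apply: ge0_le_integral => //.
  - by move=> r _; rewrite lee_fin mulr_ge0.
  - apply/measurable_EFinP; apply: weighted_norm_measurable.
    by have [] := tensor_cc a cz zK.
  - by apply: emeasurable_funM => //; exact/measurable_EFinP.
  - move=> r _; rewrite -EFinM lee_fin /tensor normrZ ger0_norm //.
    have [->|zr] := eqVneq (translated_density V s r) 0.
      by rewrite !mul0r mulr0.
    have wr : w r <= c by have [/(_ zr) /wc] := zV r; rewrite mulVKg.
    have -> : translated_density V s r * `|a| * w r =
      w r * (`|a| * translated_density V s r) by ring.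
    by rewrite -[leRHS]mulrA ler_wpM2r // mulr_ge0.
rewrite ge0_integralZl //; first by rewrite intz mule1.
- exact/measurable_EFinP.
- by move=> r _; rewrite lee_fin.
Qed.

End densities_at_identity.

End beurling_norm.

(** * From covariant representations to the Beurling algebra *)

Section closure_norm.
Context (R : realType) (V : normedModType R).

Lemma closure_normP (S : set V) x :
  closure S x <-> forall e, 0 < e -> exists2 y, S y & `|x - y| <= e.
Proof.
split=> [clx e e0|Hx B Bx].
  have [y [Sy yx]] := clx _ (nbhsx_ballx x _ e0); exists y => //.
  by move: yx; rewrite -ball_normE /= => /ltW.
move: Bx => /nbhs_ballP [e e0 eB].
have [y Sy xy] := Hx (e / 2) (divr_gt0 e0 (ltr0Sn _ 1)); exists y; split => //.
apply: eB; rewrite -ball_normE /= (le_lt_trans xy) //.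
by rewrite ltr_pdivrMr // ltr_pMr // ltr1n.
Qed.

Lemma closure_dense (S : set V) : (forall x, closure S x) -> dense S.
Proof.
move=> clS W [x Wx] oW.
by have [y [Sy Wy]] := clS x _ (open_nbhs_nbhs (conj oW Wx)); exists y.
Qed.

Lemma linear_span0 (S : set V) : linear_span S 0.
Proof.
by exists 0, (fun=> 0), (fun=> 0); split => [[]|] //; rewrite big_ord0.
Qed.

Lemma linear_spanZD (S : set V) c x y :
  linear_span S x -> linear_span S y -> linear_span S (c *: x + y).
Proof.
move=> [n [a [u [Su ->]]]] [m [b [v [Sv ->]]]].
exists (n + m)%N, (fun i => match fintype.split i with inl j =>
  c * a j | inr j => b j end),
  (fun i => match fintype.split i with inl j => u j | inr j => v j end); split.
  by move=> i; case: (fintype.split i).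
rewrite big_split_ord /= scaler_sumr; congr (_ + _); apply: eq_bigr => i _.
  by rewrite (unsplitK (inl i)) scalerA.
by rewrite (unsplitK (inr i)).
Qed.

Lemma sub_linear_span (S : set V) x : S x -> linear_span S x.
Proof.
move=> Sx; exists 1%N, (fun=> 1), (fun=> x); split => //.
by rewrite big_ord1 scale1r.
Qed.

Lemma closure_span0 (S : set V) : closure (linear_span S) 0.
Proof. by apply: subset_closure; exact: linear_span0. Qed.

Lemma closure_spanZD (S : set V) c x y : closure (linear_span S) x ->
  closure (linear_span S) y -> closure (linear_span S) (c *: x + y).
Proof.
move=> /closure_normP clx /closure_normP cly; apply/closure_normP => e e0.
have d0 : 0 < e / (`|c| + 1) by rewrite divr_gt0 // ltr_wpDl.
have [u Su xu] := clx _ d0; have [v Sv yv] := cly _ d0.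
exists (c *: u + v); first exact: linear_spanZD.
rewrite opprD addrACA -scalerBr (le_trans (ler_normD _ _)) // normrZ.
have -> : e = `|c| * (e / (`|c| + 1)) + e / (`|c| + 1).
  by field; rewrite gt_eqF // ltr_wpDl.
by rewrite lerD // ler_wpM2l.
Qed.

End closure_norm.

Section integrated_form.
Context (R : realType) (A : completeNormedModType R) (mulA : A -> A -> A).
Context (coneA : set A) (G : topologicalGroupType) (alpha : G -> A -> A).
Variable mu : {measure set (borel G) -> \bar R}.
Variable w : G -> R.
Context (L : completeNormedModType R) (iota : (G -> A) -> L) (mulL : L -> L ->
  L).
Context (X : completeNormedModType R) (coneX : set X).
Hypothesis Halpha : dynamical_system mulA coneA alpha.
Hypothesis Hunif : uniformly_bounded alpha.
Hypothesis Hmu : left_haar_measure mu.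
Hypothesis Hw : weight w.
Hypothesis HL : beurling_algebra mu mulA alpha w iota mulL.
Let hausG : hausdorff_space G := ds_hausdorff Halpha.
Let mu_compact := haar_compact Hmu.

Variables (pi : A -> X -> X) (U : G -> X -> X).
Hypothesis HpiU : pos_nd_cont_covariant_rep mulA coneA coneX alpha w pi U.

Lemma cov_rep : representation mulA pi. Proof. by case: HpiU => -[]. Qed.

Lemma cov_bounded : bounded_representation pi. Proof. by case: HpiU. Qed.

Lemma cov_nondegenerate : Defs.nondegenerate pi. Proof. by case: HpiU. Qed.

Lemma cov_continuous x : continuous (U^~ x). Proof. by case: HpiU. Qed.

Lemma cov_mulg s t x : U (s * t)%g x = U s (U t x).
Proof. by case: HpiU => -[]. Qed.

Lemma cov_alpha s a x : pi (alpha s a) x = U s (pi a (U s^-1%g x)).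
Proof. by case: HpiU => -[]. Qed.

Lemma cov_U_bounded s : bounded_operator (U s).
Proof. by case: HpiU => -[_ _ /(_ s) [[]]]. Qed.

Lemma cov1 x : U 1%g x = x.
Proof.
have [S [_ SK _]] : exists S, [/\ positive_operator coneX S, cancel (U 1%g) S &
    cancel S (U 1%g)] by case: HpiU => -[_ _ /(_ 1%g) []].
by apply: (can_inj SK); rewrite -cov_mulg mulg1.
Qed.

Definition integrated (f : G -> A) (x : X) : X :=
  bochner mu (fun r : borel G => pi (f r) (U r x)).

Lemma integrand_cc (K : set G) (f : G -> A) x :
  cc_on K f -> cc_on K (fun r => pi (f r) (U r x)).
Proof.
move=> [cf fK]; split.
  move=> r; apply: (cvg_rep cov_rep cov_bounded); first exact: cf.
  exact: cov_continuous.
by move=> r Kr; rewrite fK // (linear_zero (rep_linearl cov_rep _)).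
Qed.

Lemma integrated_is (f : G -> A) x : Cc f ->
  bochner_integral_is mu (fun r : borel G => pi (f r) (U r x)) (integrated f x).
Proof.
move=> Cf; have [ch hK] := integrand_cc x (cc_on_supp Cf).
by apply: (bochner_integrable hausG mu_compact _ ch hK); case: Cf.
Qed.

Lemma integratedZDl c f g x : Cc f -> Cc g ->
  integrated (fun s => c *: f s + g s) x = c *: integrated f x + integrated g x.
Proof.
move=> Cf Cg; have [cf fK] := cc_on_supp Cf; have [cg gK] := cc_on_supp Cg.
have cK : compact (supp f `|` supp g) by apply: compactU; [case: Cf | case: Cg].
have ccf : cc_on (supp f `|` supp g) f by split => // r Kr; apply: fK => ?;
  apply: Kr; left.
have ccg : cc_on (supp f `|` supp g) g by split => // r Kr; apply: gK => ?;
  apply: Kr; right.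
have [c1 v1] := integrand_cc x ccf; have [c2 v2] := integrand_cc x ccg.
rewrite /integrated -(bochnerZD hausG Hmu cK) //; congr bochner.
by apply/funext => r; rewrite (rep_linearl cov_rep).
Qed.

Lemma integrated_linear f : Cc f -> linear (integrated f).
Proof.
move=> Cf c x y; have [c1 v1] := integrand_cc x (cc_on_supp Cf).
have [c2 v2] := integrand_cc y (cc_on_supp Cf).
rewrite /integrated -(bochnerZD hausG Hmu (K := supp f)) //; last by case: Cf.
congr bochner; apply/funext => r.
by rewrite (cov_U_bounded r).1 (rep_linear cov_rep).
Qed.

Section growth.
Variable CU : R.
Hypothesis HCU : growth_bound w U CU.

Lemma cov_U_le r x : `|U r x| <= CU * w r * `|x|.
Proof.
by rewrite (le_trans (le_opnorm x (cov_U_bounded r))) // ler_wpM2r //;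
  case: HCU.
Qed.

Lemma integrated_le f x : Cc f ->
  `|integrated f x| <= CU * repnorm pi * `|iota f| * `|x|.
Proof.
move=> Cf; have [ch hK] := integrand_cc x (cc_on_supp Cf).
have cK : compact (supp f) by case: Cf.
have [CU0 _] := HCU; have p0 := repnorm_ge0 cov_rep cov_bounded.
have k0 : 0 <= CU * repnorm pi * `|x| by rewrite !mulr_ge0.
rewrite -lee_fin (le_trans (bochner_norm hausG mu_compact cK ch hK)) //.
have -> : CU * repnorm pi * `|iota f| * `|x| = CU * repnorm pi * `|x| * `|iota
  f|.
  by ring.
rewrite (beurling_norm HL Cf) EFinM -(norm1w_integral Halpha Hmu Hw Cf).
have mfw : measurable_fun [set: borel G] ((fun s => `|f s| * w s) : borel G ->
  R).
  by apply: weighted_norm_measurable => //; case: Cf.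
rewrite -ge0_integralZl //; last 2 first.
- exact/measurable_EFinP.
- by move=> r _; rewrite lee_fin mulr_ge0 // (weight_ge0 Hw).
apply: ge0_le_integral => //.
- by apply/measurable_EFinP; apply: continuous_norm_borel.
- by apply: emeasurable_funM => //; exact/measurable_EFinP.
- move=> r _; rewrite -EFinM lee_fin.
  rewrite (le_trans (le_repnorm cov_rep cov_bounded _ _)) //.
  have -> : CU * repnorm pi * `|x| * (`|f r| * w r) =
    repnorm pi * `|f r| * (CU * w r * `|x|) by ring.
  by rewrite ler_wpM2l ?mulr_ge0 // cov_U_le.
Qed.

End growth.

Lemma growth_exists : exists CU, growth_bound w U CU. Proof. by case: HpiU. Qed.

Lemma integrated_sup_le (K : set G) x : compact K -> exists2 C : R, 0 <= C &
  forall f e, cc_on K f -> 0 <= e -> (forall s, `|f s| <= e) ->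
  `|integrated f x| <= C * e.
Proof.
move=> cK; have [CU HCU] := growth_exists; have [CU0 _] := HCU.
have [C C0 HC] := iota_le Halpha Hmu Hw HL cK.
have p0 := repnorm_ge0 cov_rep cov_bounded.
exists (CU * repnorm pi * C * `|x|); first by rewrite !mulr_ge0.
move=> f e ccf e0 fe; have Cf : Cc f by case: ccf => cf fK;
  exact: cc_on_Cc cK cf fK.
rewrite (le_trans (integrated_le HCU x Cf)) //.
have -> : CU * repnorm pi * C * `|x| * e = CU * repnorm pi *
  (C * e) * `|x| by ring.
by rewrite ler_wpM2r // ler_wpM2l ?mulr_ge0 // HC.
Qed.

(** Multiplicativity: Fubini, covariance and left invariance. *)
Lemma integratedM f g x : Cc f -> Cc g ->
  integrated (twisted_conv mu mulA alpha f g) x = integrated f (integrated g x).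
Proof.
move=> Cf Cg; have ccf := cc_on_supp Cf; have ccg := cc_on_supp Cg.
have cf : compact (supp f) by case: Cf.
have cg : compact (supp g) by case: Cg.
have cfg : compact (mul_set (supp f) (supp g)) by exact: compact_mulg.
have [C C0 HC] := integrated_sup_le x cfg.
rewrite twisted_convE (@interchange _ _ mu hausG Hmu A X (supp f)
  (mul_set (supp f) (supp g)) (integrated^~ x) cf cfg _ C HC
  (twisted_integrand mulA alpha f g)).
- rewrite {2}/integrated; congr bochner; apply/funext => r.
  rewrite /integrated /twisted_integrand /=.
  have [cs vs] := integrand_cc x ccg.
  have bpu : bounded_operator (fun y => pi (f r) (U r y)).
    exact: bounded_operator_comp (cov_U_bounded r) (rep_bounded cov_rep (f r)).
  rewrite -(bochner_comp hausG Hmu cg cs vs bpu).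
  have [c2 v2] : cc_on (supp g) (fun s => pi (f r) (U r (pi (g s) (U s x)))).
    split; last by move=> s Ks; rewrite vs // (linear_zero bpu.1).
    by move=> s; exact: (cvg_continuous_comp (bounded_operator_continuous bpu)
      (cs s)).
  rewrite -(bochner_mulgl hausG Hmu r^-1%g cg c2 v2); congr bochner.
  apply/funext => s; rewrite (repM cov_rep) cov_alpha;
    congr (pi _ (U _ (pi _ _))).
  by rewrite cov_mulg.
- by move=> c h1 h2 [ch1 v1] [ch2 v2]; rewrite integratedZDl //;
    [exact: cc_on_Cc cfg ch1 v1 | exact: cc_on_Cc cfg ch2 v2].
- exact: (twisted_integrand_continuous Halpha Hunif ccf ccg).
- exact: (twisted_integrand_vanishes Halpha ccf ccg).
Qed.

End integrated_form.

Section representation_of_integrals.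
Context (R : realType) (A : completeNormedModType R) (mulA : A -> A -> A).
Context (coneA : set A) (G : topologicalGroupType) (alpha : G -> A -> A).
Variable mu : {measure set (borel G) -> \bar R}.
Variable w : G -> R.
Context (L : completeNormedModType R) (iota : (G -> A) -> L) (mulL : L -> L ->
  L).
Context (X : completeNormedModType R) (coneX : set X).
Hypothesis Halpha : dynamical_system mulA coneA alpha.
Hypothesis Hunif : uniformly_bounded alpha.
Hypothesis Hmu : left_haar_measure mu.
Hypothesis Hw : weight w.
Hypothesis HL : beurling_algebra mu mulA alpha w iota mulL.
Let hausG : hausdorff_space G := ds_hausdorff Halpha.
Let mu_compact := haar_compact Hmu.
Variables (pi : A -> X -> X) (U : G -> X -> X).
Hypothesis HpiU : pos_nd_cont_covariant_rep mulA coneA coneX alpha w pi U.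
Let rpi := cov_rep HpiU.
Let bpi := cov_bounded HpiU.

Section density_nets.
Context (Z : set (set G)) (z : set G -> G -> R).
Hypotheses (HZ : small_nbhs_base Z) (Hz : bump_family mu Z z).
Context (I : Type) (le : I -> I -> Prop).
Hypothesis Hle : directed le.

(** [T (z_V(s^-1 .) (x) b_i) x] is the average of [pi (b_i) (U_r x)] over [r] in
    [sV], and these vectors tend to [Q (U_s x)] jointly in [r] and [i]. *)
Lemma integrated_density_cvg (b : I -> A) (M : R) (Q : X -> X) s x :
  bounded_by b M -> (forall y, pi (b i) y @[i --> tails setT le] --> Q y) ->
  integrated mu pi U (tensor (translated_density z p.1 s) (b p.2)) x
    @[p --> pair_tails Z le] --> Q (U s x).
Proof.
move=> bM bQ; have FP := pair_tails_proper HZ Hle; apply/cvgrPdist_le => e e0.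
have FI := directed_tails_proper Hle.
have p0 := repnorm_ge0 rpi bpi.
have h1 : pi (b q.2) (U (s * q.1)%g x) @[q --> (nbhs (1%g : G), tails setT le)]
    --> Q (U s x).
  apply: (cvg_equibounded (C := repnorm pi * M)
    (fun q => rep_linear rpi (b q.2))).
  - move=> q y; rewrite (le_trans (le_repnorm rpi bpi _ _)) //.
    by rewrite ler_wpM2r // ler_wpM2l.
  - exact: (cvg_comp _ _ cvg_snd (bQ _)).
  - have h : (s * q.1)%g @[q --> (nbhs (1%g : G), tails setT le)] --> s.
      suff : (s * q.1)%g @[q --> (nbhs (1%g : G), tails setT le)] --> (s * 1)%g.
        by rewrite mulg1.
      by apply: cvg_mulg; [exact: cvg_cst | exact: cvg_fst].
    exact: (cvg_continuous_comp (cov_continuous HpiU (x := x)) h).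
have : \forall v \near (1%g : G) & i \near tails setT le,
    `|pi (b i) (U (s * v)%g x) - Q (U s x)| <= e.
  by move/cvgrPdist_le : h1 => /(_ _ e0); apply: filterS => q; rewrite distrC.
move=> /(near_pair_tails HZ); apply: filterS => -[V i] /= [ZV Hv].
have [K [cK [cz zK] z0 intz zV]] := translated_densityP Hmu Hz s ZV.
rewrite distrC /integrated.
have -> : (fun r : borel G => pi (tensor (translated_density z V s) (b i) r)
  (U r x)) =
    (fun r => translated_density z V s r *: pi (b i) (U r x)).
  by apply/funext => r; rewrite /tensor (linear_scale (rep_linearl rpi _)).
apply: (density_average hausG Hmu cK cz zK z0 intz) (ltW e0) _.
  move=> r; exact: (cvg_continuous_comp (rep_continuous rpi (b := b i))
    (cov_continuous HpiU (x := x) (x0 := r))).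
move=> r zr; have [/(_ zr) Vr _] := zV r.
by have := Hv _ Vr; rewrite mulVKg.
Qed.

(** On a vector [pi a y] this is the convergence of [pi (u_i a) y]; boundedness
    extends it to the closed span of such vectors. *)
Lemma approximate_identity_strong (u : I -> A) (M : R) x :
  (forall a, mulA (u i) a @[i --> tails setT le] --> a) -> bounded_by u M ->
  pi (u i) x @[i --> tails setT le] --> x.
Proof.
move=> ua uM; have FI := directed_tails_proper Hle.
have p0 := repnorm_ge0 rpi bpi.
pose C := Num.max (repnorm pi * M) 1.
have cl : closed [set x | pi (u i) x @[i --> tails setT le] --> id x].
  apply: (@strong_cvg_to_closed _ X _ _ _ (fun i => pi (u i)) C) => //.
  - by rewrite le_max ler01 orbT.
  - by apply: nearW => i; exact: (rep_linear rpi).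
  - apply: nearW => i y; rewrite (le_trans (le_repnorm rpi bpi _ _))
      // ler_wpM2r //.
    by rewrite le_max ler_wpM2l.
  - by move=> y; rewrite ler_peMl // le_max lexx orbT.
apply: (nondegenerate_ind (cov_nondegenerate HpiU) cl) => /=.
- rewrite (_ : (fun i => pi (u i) 0) = cst 0); first exact: cvg_cst.
  by apply/funext => i; rewrite (linear_zero (rep_linear rpi _)).
- move=> c y y' uy uy'.
  rewrite (_ : (fun i => pi (u i) (c *: y + y')) =
    (fun i => c *: pi (u i) y + pi (u i) y')).
    by apply: cvgD => //; apply: cvgZ => //; exact: cvg_cst.
  by apply/funext => i; rewrite (rep_linear rpi).
- move=> a y; rewrite (_ : (fun i => _) = (fun i => pi (mulA (u i) a) y)).
    exact: (cvg_continuous_comp (rep_continuousl rpi bpi (x := y)) (ua a)).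
  by apply/funext => i; rewrite (repM rpi).
Qed.

End density_nets.

Lemma representation_exists : exists T : L -> X -> X,
  [/\ forall x, linear (T^~ x), forall l, linear (T l),
      exists2 C : R, 0 <= C & forall l x, `|T l x| <= C * `|l| * `|x| &
      forall f x, Cc f -> T (iota f) x = integrated mu pi U f x].
Proof.
have [CU HCU] := growth_exists HpiU; have [CU0 _] := HCU.
have p0 := repnorm_ge0 rpi bpi.
have /choice [T HT] : forall x, exists Tx : L -> X, [/\ linear Tx,
    forall l, `|Tx l| <= CU * repnorm pi * `|x| * `|l| &
    forall f, Cc f -> Tx (iota f) = integrated mu pi U f x].
  move=> x; apply: (@extend_bounded _ _ _ _ (@Cc R G A)).
  - by rewrite !mulr_ge0.
  - exact: beurling_dense HL.
  - move=> c f g Cf Cg; exists (fun s => c *: f s + g s); split.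
    + have [cf fK] := cc_on_supp Cf; have [cg gK] := cc_on_supp Cg.
      have cK : compact (supp f `|` supp g) by apply: compactU;
        [case: Cf | case: Cg].
      apply: (cc_on_Cc hausG cK).
        by move=> r; apply: cvgD;
          [apply: cvgZ; [exact: cvg_cst | exact: cf] | exact: cg].
      move=> r Kr; rewrite fK ?gK ?scaler0 ?addr0 // => ?; apply: Kr;
        by [left | right].
    + exact: iota_linear HL _ _ _ Cf Cg.
    + exact: (integratedZDl Halpha Hmu HpiU).
  - move=> f Cf; have := integrated_le Halpha Hmu Hw HL HpiU HCU x Cf.
    by rewrite mulrAC.
exists (fun l x => T x l); split.
- by move=> x; have [] := HT x.
- move=> l c x y; have lin x0 : continuous (T x0).
    have [lT bT _] := HT x0; exact: (linear_bounded_continuous lT bT).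
  apply: (dense_closed_ind (beurling_dense HL) (P := [set l | T (c *: x + y) l =
    c *: T x l + T y l])).
    apply: closed_eq_fun; first exact: lin.
    by move=> l'; apply: cvgD;
      [apply: cvgZ; [exact: cvg_cst | exact: lin] | exact: lin].
  move=> _ [f Cf <-] /=; have [_ _ ->] := HT (c *: x + y) => //.
  have [_ _ ->] := HT x => //; have [_ _ ->] := HT y => //.
  exact: (integrated_linear Halpha Hmu HpiU Cf).
- exists (CU * repnorm pi); first by rewrite mulr_ge0.
  by move=> l x; have [_ bT _] := HT x; rewrite (le_trans (bT l)) // mulrAC.
- by move=> f x Cf; have [_ _ ->] := HT x.
Qed.

Lemma integrated_form_of (T : L -> X -> X) :
  (forall f x, Cc f -> T (iota f) x = integrated mu pi U f x) ->
  integrated_form mu iota pi U T.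
Proof. by move=> TE f Cf x; rewrite TE //;
  exact: (integrated_is Halpha Hmu HpiU). Qed.

Lemma integrated_formE (T : L -> X -> X) : integrated_form mu iota pi U T ->
  forall f x, Cc f -> T (iota f) x = integrated mu pi U f x.
Proof. by move=> HT f x Cf; rewrite /integrated (bochnerE (HT f Cf x)). Qed.

Hypotheses (HX : is_cone coneX) (HXc : closed coneX).

Lemma integrated_positive f x : Cc_cone coneA f -> coneX x ->
  coneX (integrated mu pi U f x).
Proof.
move=> [Cf fA] Xx; have [ch hK] := integrand_cc HpiU x (cc_on_supp Cf).
have cK : compact (supp f) by case: Cf.
have [_ CZ] := HX.
apply: (bochner_in_cone hausG mu_compact cK ch hK HXc HX).
  by rewrite -(scale0r x); exact: CZ.
have [[_ ppi pU _ _] _ _ _ _] := HpiU.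
move=> r; have [_ pif] := ppi _ (fA r); have [[_ Ur] _] := pU r.
by apply: pif; exists (U r x) => //; apply: Ur; exists x.
Qed.

Context (Z : set (set G)) (z : set G -> G -> R).
Hypotheses (HZ : small_nbhs_base Z) (Hz : bump_family mu Z z).

Lemma integrated_representation (T : L -> X -> X) :
  (forall x, linear (T^~ x)) -> (forall l, linear (T l)) ->
  (exists2 C : R, 0 <= C & forall l x, `|T l x| <= C * `|l| * `|x|) ->
  (forall f x, Cc f -> T (iota f) x = integrated mu pi U f x) ->
  pos_nd_bounded_rep mulL (beurling_cone coneA iota) coneX T.
Proof.
move=> lTl lT [C C0 TC] TE.
have cTl x : continuous (T^~ x).
  by apply: (linear_bounded_continuous (lTl x) (C := C * `|x|)) => l;
    rewrite mulrAC.
have bT l : bounded_operator (T l) by split => //; exists (C * `|l|).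
have cT l := bounded_operator_continuous (bT l).
have TM l1 l2 x : T (mulL l1 l2) x = T l1 (T l2 x).
  have cmul l : continuous (mulL l).
    move=> m; have h : (l, m') @[m' --> m] --> (l, m).
      by apply: cvg_pair; [exact: cvg_cst | exact: cvg_id].
    exact: (cvg_continuous_comp (beurling_mul_continuous HL) h).
  have cmulr l : continuous (mulL^~ l).
    move=> m; have h : (m', l) @[m' --> m] --> (m, l).
      by apply: cvg_pair; [exact: cvg_id | exact: cvg_cst].
    exact: (cvg_continuous_comp (beurling_mul_continuous HL) h).
  apply: (dense_closed_ind (beurling_dense HL) (P := [set l | T (mulL l l2) x =
    T l (T l2 x)])).
    apply: closed_eq_fun; last exact: cTl.
    by move=> l; exact: (cvg_continuous_comp (cTl x) (cmulr l2 l)).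
  move=> _ [f Cf <-] /=.
  apply: (dense_closed_ind (beurling_dense HL)
    (P := [set l | T (mulL (iota f) l) x =
    T (iota f) (T l x)])).
    apply: closed_eq_fun; move=> l.
      exact: (cvg_continuous_comp (cTl x) (cmul _ l)).
    exact: (cvg_continuous_comp (cT (iota f)) (cTl x l)).
  move=> _ [g Cg <-] /=; rewrite (beurling_conv HL Cf Cg) (TE g) //.
  rewrite (TE f) // -(integratedM Halpha Hunif Hmu Hw HL HpiU) // TE //.
  have cf : compact (supp f) by case: Cf.
  have cg : compact (supp g) by case: Cg.
  have cfg : compact (mul_set (supp f) (supp g)) by exact: compact_mulg.
  have [cc vv] := twisted_conv_cc Halpha Hunif Hmu cf (cc_on_supp Cf)
    (cc_on_supp Cg).
  exact: (cc_on_Cc hausG cfg cc vv).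
have rT : representation mulL T.
  split; [exact: bT | by move=> c b1 b2 x; rewrite (lTl x) | exact: TM].
split => //.
- move=> l cl; split => // _ [x Xx <-].
  have clX : closed [set l | coneX (T l x)].
    by apply: (continuous_closedP _).1 HXc; exact: cTl.
  apply: (clX l); apply: closure_subset cl => _ [f cf <-] /=.
  by have [Cf _] := cf; rewrite TE //; exact: integrated_positive.
- apply: closure_dense.
  apply: (nondegenerate_ind (cov_nondegenerate HpiU) (@closed_closure _ _)).
  + exact: closure_span0.
  + by move=> c x y; exact: closure_spanZD.
  move=> a x.
  pose le (_ _ : unit) := True.
  have dle : directed le by split => //; exists tt.
  have FP := pair_tails_proper HZ dle; have FT := directed_tails_proper dle.
  have bc y : pi ((fun _ : unit => a) i) y @[i --> tails setT le] --> pi a y.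
    exact: cvg_cst.
  have := integrated_density_cvg HZ Hz dle (s := 1%g) (x := x) (b := fun=> a)
    (M := `|a|) (fun=> lexx _) bc.
  rewrite (cov1 HpiU) => h; apply: (closed_cvg _ (@closed_closure _ _) _ _ h).
  apply: filterS (near_pair_tails_base HZ dle) => -[W i] /= ZW.
  have Ct := tensor_Cc Halpha Hmu Hz 1%g a ZW.
  rewrite -TE //; apply: subset_closure; apply: sub_linear_span.
  by exists (iota (tensor (translated_density z W 1%g) a), x).
- apply/(bounded_representationP rT); by exists C.
Qed.

End representation_of_integrals.

(** * From the Beurling algebra to covariant representations *)

Section disintegration.
Context (R : realType) (A : completeNormedModType R) (mulA : A -> A -> A).
Context (coneA : set A) (G : topologicalGroupType) (alpha : G -> A -> A).
Variable mu : {measure set (borel G) -> \bar R}.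
Variable w : G -> R.
Context (L : completeNormedModType R) (iota : (G -> A) -> L) (mulL : L -> L ->
  L).
Context (X : completeNormedModType R) (coneX : set X).
Hypothesis Halpha : dynamical_system mulA coneA alpha.
Hypothesis Hunif : uniformly_bounded alpha.
Hypothesis Hmu : left_haar_measure mu.
Hypothesis Hw : weight w.
Hypothesis HL : beurling_algebra mu mulA alpha w iota mulL.
Let hausG : hausdorff_space G := ds_hausdorff Halpha.

Lemma iota_linear_cc (K : set G) : compact K -> forall c (f g : G -> A),
  cc_on K f -> cc_on K g ->
    iota (fun s => c *: f s + g s) = c *: iota f + iota g.
Proof.
move=> cK c f g [cf fK] [cg gK]; apply: (iota_linear HL).
  exact: (cc_on_Cc hausG cK cf fK).
exact: (cc_on_Cc hausG cK cg gK).
Qed.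

(** By near covering, joint convergence at the points of the common support [K]
    is uniform on [K], and there the norm is dominated by the uniform norm. *)
Lemma iota_cvg (I : Type) (F : set_system I) {FF : Filter F} (h : I -> G -> A)
    (h0 : G -> A) (K : set G) : compact K -> cc_on K h0 ->
  (\forall i \near F, cc_on K (h i)) ->
  (forall t, K t -> h q.2 q.1 @[q --> (nbhs t, F)] --> h0 t) ->
  iota (h i) @[i --> F] --> iota h0.
Proof.
move=> cK cc0 cch ht; apply/cvgrPdist_le => e e0.
have [C C0 HC] := iota_le Halpha Hmu Hw HL cK.
have d0 : 0 < e / (C + 1) by rewrite divr_gt0 // ltr_wpDl.
have /compact_near_coveringP cov := cK.
have : \forall i \near F, forall t, K t -> `|h0 t - h i t| <= e / (C + 1).
  apply: (cov I F (fun i t => `|h0 t - h i t| <= e / (C + 1))) => t Kt.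
  have h1 : h0 q.1 - h q.2 q.1 @[q --> (nbhs t, F)] --> (0 : A).
    rewrite -(subrr (h0 t)); apply: cvgB; last exact: ht.
    have [c0 _] := cc0; apply: (cvg_continuous_comp c0); exact: cvg_fst.
  by move/cvgr0Pnorm_le : h1 => /(_ _ d0).
apply: filterS2 cch => i cci Hi.
have := Lam_dist (iota_linear_cc cK) HC cc0 cci (ltW d0) => /(_ _) /le_trans;
  apply.
  move=> t; have [Kt|Kt] := pselect (K t); first exact: Hi.
  by rewrite cc0.2 // cci.2 // subrr normr0 ltW.
by rewrite mulr_divD1_le // ltW.
Qed.

Definition act_on (s : G) (beta : A -> A) (f : G -> A) : G -> A :=
  fun t => beta (alpha s (f (s^-1 * t)%g)).

Lemma act_on_cc (s : G) (beta : A -> A) (f : G -> A) (K : set G) :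
  bounded_operator beta -> cc_on K f ->
  cc_on [set (s * r)%g | r in K] (act_on s beta f).
Proof.
move=> bb [cf fK]; split.
  move=> t; apply: (cvg_continuous_comp (bounded_operator_continuous bb)).
  apply: (cvg_continuous_comp
    (bounded_operator_continuous (alpha_bounded Halpha s))).
  by apply: (cvg_continuous_comp cf); exact: mulgl_continuous.
move=> t Kt; rewrite /act_on fK.
  by rewrite (linear_zero (alpha_linear Halpha s)) (linear_zero bb.1).
by move=> Kst; apply: Kt; exists (s^-1 * t)%g; rewrite ?mulVKg.
Qed.

Lemma act_on_Cc (s : G) (beta : A -> A) (f : G -> A) :
  bounded_operator beta -> Cc f -> Cc (act_on s beta f).
Proof.
move=> bb Cf; have [ca va] := act_on_cc s bb (cc_on_supp Cf).
apply: (cc_on_Cc hausG _ ca va); apply: compact_image; last by case: Cf.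
exact: mulgl_continuous.
Qed.

Section nets_of_operators.
Context (Z : set (set G)) (z : set G -> G -> R).
Hypotheses (HZ : small_nbhs_base Z) (Hz : bump_family mu Z z).
Context (I : Type) (le : I -> I -> Prop).
Hypothesis Hle : directed le.

(** The net acts on the left of the algebra as [act_on s beta] in the limit:
    the density forces the group variable to [s], and [b] the algebra variable
    to [beta]. *)
Lemma density_conv_cvg (b : I -> A) (M : R) (beta : A -> A) (s : G)
  (f : G -> A) :
  bounded_by b M -> bounded_operator beta ->
  (forall c, mulA (b i) c @[i --> tails setT le] --> beta c) -> Cc f ->
  iota (twisted_conv mu mulA alpha
    (tensor (translated_density z p.1 s) (b p.2)) f)
    @[p --> pair_tails Z le] --> iota (act_on s beta f).
Proof.
move=> bM bb bbeta Cf; have [_ _ [KZ cKZ ZK]] := HZ.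
have FP := pair_tails_proper HZ Hle; have FI := directed_tails_proper Hle.
have cf : compact (supp f) by case: Cf.
have ccf := cc_on_supp Cf.
pose K1 := [set (s * r)%g | r in KZ].
have cK1 : compact K1 by apply: compact_image cKZ; exact: mulgl_continuous.
pose K2 := [set (s * r)%g | r in supp f].
have cK2 : compact K2 by apply: compact_image cf; exact: mulgl_continuous.
have cc2 := act_on_cc s bb ccf.
have cK : compact (mul_set K1 (supp f) `|` K2) by apply: compactU => //;
  exact: compact_mulg.
have cc_tensor V i : Z V -> cc_on K1 (tensor (translated_density z V s) (b i)).
  move=> ZV; have [K [cK' [cz zK] _ _ zV]] := translated_densityP Hmu Hz s ZV.
  have [ct vt] := tensor_cc (b i) cz zK; split => // r K1r; apply: vt => Kr.
  by apply: K1r; exists (s^-1 * r)%g; rewrite ?mulVKg //; apply: (ZK _ ZV);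
    have [_] := zV r; apply.
apply: (iota_cvg cK).
- split; first by case: cc2.
  by move=> t Kt; apply: cc2.2 => K2t; apply: Kt; right.
- apply: filterS (near_pair_tails_base HZ Hle) => -[W i] /= ZW.
  have [cc vv] := twisted_conv_cc Halpha Hunif Hmu cK1 (cc_tensor W i ZW) ccf.
  by split => // t Kt; apply: vv => Kt'; apply: Kt; left.
move=> t _; apply/cvgrPdist_le => e e0.
have h1 : mulA (b q.2.2) (alpha (s * q.2.1)%g (f ((s * q.2.1)^-1 * q.1)%g))
    @[q --> (nbhs t, (nbhs (1%g : G), tails setT le))] --> act_on s beta f t.
  apply: (cvg_equibounded (C := M) (fun q => mulA_linearr Halpha (b q.2.2))).
  - by move=> q c; rewrite (le_trans (mulA_norm Halpha _ _)) // ler_wpM2r.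
  - apply: (cvg_comp _ _ _ (bbeta _)); apply: (cvg_comp _ _ cvg_snd);
      exact: cvg_snd.
  - have hs : (s * q.2.1)%g @[q --> (nbhs t, (nbhs (1%g : G), tails setT le))]
      --> s.
      suff : (s * q.2.1)%g @[q --> (nbhs t, (nbhs (1%g : G), tails setT le))]
        --> (s * 1)%g.
        by rewrite mulg1.
      apply: cvg_mulg; first exact: cvg_cst.
      by apply: (cvg_comp _ _ cvg_snd); exact: cvg_fst.
    apply: (cvg_alpha Halpha Hunif hs); apply: (cvg_continuous_comp ccf.1).
    by apply: cvg_mulg; [exact: cvg_invg | exact: cvg_fst].
move/cvgrPdist_le : h1 => /(_ _ e0) [[Nt Nvi] /= [nNt nNvi] Hn].
have : \forall v \near (1%g : G) & i \near tails setT le, Nvi (v, i).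
  by apply: filterS nNvi => -[].
move=> /(near_pair_tails HZ) np.
exists (Nt, [set p : set G * I | Z p.1 /\ forall v, p.1 v -> Nvi (v, p.2)]) =>
  //.
move=> [t' [V i]] /= [Ntt' [ZV Hv]].
have [K [cK' [cz zK] z0 intz zV]] := translated_densityP Hmu Hz s ZV.
rewrite distrC /twisted_conv.
have -> : (fun r : borel G => mulA (tensor (translated_density z V s) (b i) r)
      (alpha r (f (r^-1 * t')%g))) =
    (fun r => translated_density z V s r *: mulA (b i)
      (alpha r (f (r^-1 * t')%g))).
  by apply/funext => r; rewrite /tensor (linear_scale (mulA_linearl Halpha _)).
apply: (density_average hausG Hmu cK' cz zK z0 intz _ (ltW e0)).
  move=> r; apply: (cvg_continuous_comp
    (bounded_operator_continuous (mulA_bounded Halpha (b i)))).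
  apply: (cvg_alpha Halpha Hunif); first exact: cvg_id.
  apply: (cvg_continuous_comp ccf.1).
  by apply: cvg_mulg; [apply: cvg_invg; exact: cvg_id | exact: cvg_cst].
move=> r zr; have [/(_ zr) Vr _] := zV r.
have := Hn (t', ((s^-1 * r)%g, i)); rewrite /= mulVKg distrC; apply.
by split => //=; exact: Hv.
Qed.

Variable T : L -> X -> X.
Hypothesis HT : pos_nd_bounded_rep mulL (beurling_cone coneA iota) coneX T.

Lemma brep : representation mulL T. Proof. by case: HT. Qed.

Lemma brep_bounded : bounded_representation T. Proof. by case: HT. Qed.

Lemma brep_nondegenerate : Defs.nondegenerate T. Proof. by case: HT. Qed.

Lemma brep_ind (P : set X) : closed P -> P 0 ->
  (forall c x y, P x -> P y -> P (c *: x + y)) ->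
  (forall f x, Cc f -> P (T (iota f) x)) -> forall x, P x.
Proof.
move=> cP P0 PZD Pf; apply: (nondegenerate_ind brep_nondegenerate cP P0 PZD) =>
  l x.
apply: (dense_closed_ind (beurling_dense HL) (P := [set l | P (T l x)])).
  apply: (continuous_closedP _).1 cP.
  exact: (rep_continuousl brep brep_bounded (x := x)).
by move=> _ [f Cf <-]; exact: Pf.
Qed.

(** Operators are compared on the vectors [T f x], where the limit operators
    are explicit. *)
Lemma brep_operator_eq (N1 N2 : X -> X) :
  bounded_operator N1 -> bounded_operator N2 ->
  (forall f x, Cc f -> N1 (T (iota f) x) = N2 (T (iota f) x)) -> forall x,
    N1 x = N2 x.
Proof.
move=> b1 b2 H; apply: (brep_ind (P := [set x | N1 x = N2 x])) => //=.
- by apply: closed_eq_fun; exact: bounded_operator_continuous.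
- by rewrite (linear_zero b1.1) (linear_zero b2.1).
- by move=> c x y; rewrite b1.1 b2.1 => -> ->.
Qed.

(** The operators of the net are bounded, and on [T f x] they are
    [T ((z_V(s^-1 .) (x) b_i) * f) x], which converges by [density_conv_cvg]. *)
Lemma operator_net_limit : exists2 c : R, 0 <= c &
  forall (b : I -> A) (M : R) (beta : A -> A) (s : G),
  bounded_by b M -> bounded_operator beta ->
  (forall a, mulA (b i) a @[i --> tails setT le] --> beta a) ->
  exists Q : X -> X,
  [/\ linear Q, forall x, `|Q x| <= c * M * w s * `|x|,
      forall x, T (iota (tensor (translated_density z p.1 s) (b p.2))) x
        @[p --> pair_tails Z le] --> Q x &
      forall f x, Cc f -> Q (T (iota f) x) = T (iota (act_on s beta f)) x].
Proof.
have [_ _ [KZ cKZ ZK]] := HZ.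
have [c c0 wc] := weight_compact hausG Hmu Hw cKZ.
have t0 := repnorm_ge0 brep brep_bounded.
have FP := pair_tails_proper HZ Hle; have [[i0] _ _ _] := Hle.
exists (repnorm T * c); first by rewrite mulr_ge0.
move=> b M beta s bM bb bbeta.
have M0 : 0 <= M by exact: le_trans (bM i0).
have w0 := weight_ge0 Hw s.
have nearZ := near_pair_tails_base HZ Hle.
pose N (p : set G * I) :=
  T (iota (tensor (translated_density z p.1 s) (b p.2))).
have C0 : 0 <= repnorm T * c * M * w s by rewrite !mulr_ge0.
have lN : \forall p \near pair_tails Z le, linear (N p).
  by apply: nearW => p; exact: (rep_linear brep).
have bN : \forall p \near pair_tails Z le, forall x,
    `|N p x| <= repnorm T * c * M * w s * `|x|.
  apply: filterS nearZ => -[V i] /= ZV x.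
  rewrite (le_trans (le_repnorm brep brep_bounded _ _)) // ler_wpM2r //.
  have Vc v : V v -> w (s * v)%g <= w s * c.
    by move=> /(ZK _ ZV) /wc vc;
      rewrite (le_trans (weightM Hw _ _)) // ler_wpM2l.
  rewrite (le_trans (ler_wpM2l t0
    (iota_tensor_le Halpha Hmu Hw HL Hz (b i) ZV Vc))) //.
  have -> : repnorm T * c * M * w s = repnorm T * (w s * c * M) by ring.
  by rewrite ler_wpM2l // ler_wpM2l ?mulr_ge0.
have cvgN f x : Cc f -> N p (T (iota f) x) @[p --> pair_tails Z le] -->
    T (iota (act_on s beta f)) x.
  move=> Cf; have h := density_conv_cvg (s := s) bM bb bbeta Cf.
  have {}h := cvg_continuous_comp (rep_continuousl brep brep_bounded (x := x))
    h.
  apply: cvg_trans h; apply: near_eq_cvg; apply: filterS nearZ => -[V i] /= ZV.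
  rewrite /N /= -(repM brep) (beurling_conv HL) //.
  exact: (tensor_Cc Halpha Hmu Hz).
have cN : forall x, cvg (N p x @[p --> pair_tails Z le]).
  apply: (brep_ind (P := [set x | cvg (N p x @[p --> pair_tails Z le])])).
  - exact: (strong_cvg_closed C0 lN bN).
  - apply/cvg_ex; exists 0; rewrite (_ : (fun p => N p 0) = cst 0);
      first exact: cvg_cst.
    by apply/funext => p; rewrite /N (linear_zero (rep_linear brep _)).
  - move=> a x y cx cy; apply/cvg_ex.
    exists (a *: lim (N p x @[p --> pair_tails Z le]) + lim
      (N p y @[p --> pair_tails Z le])).
    rewrite (_ : (fun p => N p (a *: x + y)) = (fun p => a *: N p x + N p y)).
      by apply: cvgD => //; apply: cvgZ => //; exact: cvg_cst.
    by apply/funext => p; rewrite /N (rep_linear brep).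
  - by move=> f x Cf; apply/cvg_ex; exists (T (iota (act_on s beta f)) x);
      exact: cvgN.
have [Q [lQ bQ NQ]] := strong_limit lN bN cN.
exists Q; split => // f x Cf.
exact: (cvg_norm_unique (NQ _) (cvgN f x Cf)).
Qed.

End nets_of_operators.

End disintegration.

Section covariant_representation.
Context (R : realType) (A : completeNormedModType R) (mulA : A -> A -> A).
Context (coneA : set A) (G : topologicalGroupType) (alpha : G -> A -> A).
Variable mu : {measure set (borel G) -> \bar R}.
Variable w : G -> R.
Context (L : completeNormedModType R) (iota : (G -> A) -> L) (mulL : L -> L ->
  L).
Context (X : completeNormedModType R) (coneX : set X).
Hypothesis Halpha : dynamical_system mulA coneA alpha.
Hypothesis Hunif : uniformly_bounded alpha.
Hypothesis Hmu : left_haar_measure mu.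
Hypothesis Hw : weight w.
Hypothesis HL : beurling_algebra mu mulA alpha w iota mulL.
Hypotheses (HX : is_cone coneX) (HXc : closed coneX).
Context (Z : set (set G)) (z : set G -> G -> R).
Hypotheses (HZ : small_nbhs_base Z) (Hz : bump_family mu Z z).
Context (I : Type) (le : I -> I -> Prop) (u : I -> A).
Hypothesis Hleft : positive_bounded_approximate_left_identity mulA coneA le u.
Let hausG : hausdorff_space G := ds_hausdorff Halpha.

Let Hle : directed le. Proof. by case: Hleft => -[]. Qed.

Let u_cvg a : mulA (u i) a @[i --> tails setT le] --> a.
Proof. by case: Hleft => -[_ ua] _ _; exact: ua. Qed.

Let u_pos i : coneA (u i). Proof. by case: Hleft. Qed.

Lemma translated_density1 V : translated_density z V 1%g = z V.
Proof. by apply/funext => r;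
  rewrite /translated_density /ltranslate invg1 mul1g. Qed.

Lemma tensor_cone V s a : Z V -> coneA a ->
  beurling_cone coneA iota (iota (tensor (translated_density z V s) a)).
Proof.
move=> ZV Aa; apply: subset_closure.
exists (tensor (translated_density z V s) a) => //; split.
  exact: (tensor_Cc Halpha Hmu Hz).
have [_ [_ z0 _ _]] := (translated_densityP Hmu Hz s ZV, Hz ZV).
have [[[_ _ [_ CZ] _] _] _ _ _ _] := Halpha.
by move=> r; apply: CZ => //; exact: z0.
Qed.

Variable T : L -> X -> X.
Hypothesis HT : pos_nd_bounded_rep mulL (beurling_cone coneA iota) coneX T.
Let rT := brep HT.
Let bT := brep_bounded HT.

Lemma limit_positive (b : I -> A) (Q : X -> X) s :
  (forall i, coneA (b i)) ->
  (forall x, T (iota (tensor (translated_density z p.1 s) (b p.2))) x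
        @[p --> pair_tails Z le] --> Q x) ->
  forall x, coneX x -> coneX (Q x).
Proof.
move=> bpos bQ x Xx; have FQ := pair_tails_proper HZ Hle.
apply: (@closed_cvg _ _ (pair_tails Z le) FQ _ coneX HXc _ _ (bQ x)).
apply: filterS (near_pair_tails_base HZ Hle) => -[V i] /= ZV.
have [_ pT _ _] := HT; have [_ TX] := pT _ (tensor_cone (s := s) ZV (bpos i)).
by apply: TX; exists x.
Qed.

Definition group_act (s : G) (f : G -> A) := act_on alpha s id f.
Definition algebra_act (a : A) (f : G -> A) : G -> A := fun t => mulA a (f t).

Lemma algebra_actE a f : act_on alpha 1%g (mulA a) f = algebra_act a f.
Proof.
by apply/funext => t; rewrite /act_on (alpha1 Halpha) invg1 mul1g.
Qed.

Lemma group_act_Cc s f : Cc f -> Cc (group_act s f).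
Proof. exact: (act_on_Cc Halpha s (bounded_operator_id A)). Qed.

Lemma algebra_act_Cc a f : Cc f -> Cc (algebra_act a f).
Proof.
by rewrite -algebra_actE; exact: (act_on_Cc Halpha _ (mulA_bounded Halpha a)).
Qed.

Lemma algebra_act_cc a f (K : set G) : cc_on K f -> cc_on K (algebra_act a f).
Proof.
move=> [cf fK]; split; last first.
  by move=> t Kt; rewrite /algebra_act fK
    // (linear_zero (mulA_linearr Halpha a)).
by move=> t; exact: (cvg_continuous_comp (bounded_operator_continuous
  (mulA_bounded Halpha a)) (cf t)).
Qed.

(** The base [Z] provides a compact neighbourhood of 1, so the translates of [f]
    by elements near [s0] are supported in one compact set. *)
Lemma iota_group_act_continuous f : Cc f ->
  continuous (fun s => iota (group_act s f)).
Proof.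
move=> Cf s0; have [Znbhs Zbase [KZ cKZ ZK]] := HZ.
have cf : compact (supp f) by case: Cf.
have ccf := cc_on_supp Cf.
pose K1 := [set (s0 * r)%g | r in KZ].
have cK1 : compact K1 by apply: compact_image cKZ; exact: mulgl_continuous.
have KS s : K1 s -> cc_on (mul_set K1 (supp f)) (group_act s f).
  move=> K1s; have [ca va] := act_on_cc Halpha s (bounded_operator_id A) ccf;
    split => // t Kt.
  by apply: va => -[r fr rt]; apply: Kt; exists (s, r).
have [V ZV _] := Zbase setT filterT.
have K1s0 : \forall s \near s0, K1 s.
  have h : (s0^-1 * s)%g @[s --> s0] --> (1%g : G).
    by rewrite -(mulVg s0); exact: mulgl_continuous.
  have := h _ (Znbhs _ ZV); rewrite nbhs_filterE /=; apply: filterS => s Vs.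
  by exists (s0^-1 * s)%g; [exact: (ZK _ ZV) | rewrite mulVKg].
apply: (iota_cvg Halpha Hmu Hw HL (K := mul_set K1 (supp f))).
- exact: compact_mulg.
- by apply: KS; exact: nbhs_singleton K1s0.
- by apply: filterS K1s0 => s; exact: KS.
move=> t _; have hs : (q.2 : G) @[q --> (nbhs t, nbhs s0)] -->
  s0 by exact: cvg_snd.
apply: (cvg_alpha Halpha Hunif hs); apply: (cvg_continuous_comp ccf.1).
by apply: cvg_mulg; [exact: cvg_invg | exact: cvg_fst].
Qed.

(** Bounded approximate identities converge uniformly on the compact range
    of [f]. *)
Lemma iota_approximate_identity (M : R) f : bounded_by u M -> Cc f ->
  iota (algebra_act (u i) f) @[i --> tails setT le] --> iota f.
Proof.
move=> uM Cf; have ccf := cc_on_supp Cf; have FI := directed_tails_proper Hle.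
apply: (iota_cvg Halpha Hmu Hw HL (K := supp f)) => //; first by case: Cf.
  by apply: nearW => i; exact: algebra_act_cc.
move=> t _; apply: (cvg_equibounded (C := M)
  (fun q => mulA_linearr Halpha (u q.2))).
- by move=> q c; rewrite (le_trans (mulA_norm Halpha _ _)) // ler_wpM2r.
- exact: (cvg_comp _ (fun i => mulA (u i) (f t)) cvg_snd (u_cvg (a := f t))).
- by apply: (cvg_continuous_comp ccf.1); exact: cvg_fst.
Qed.

(** The limit operators act on the vectors [T f x] as [A] and [G] act on the
    functions [f], so each property of (pi, U) is checked on functions. *)
Section generators.
Variables (pi : A -> X -> X) (U : G -> X -> X) (Cpi CU : R).
Hypothesis lpi : forall a, linear (pi a).
Hypothesis pi_le : forall a x, `|pi a x| <= Cpi * `|a| * `|x|.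
Hypothesis pi_pos : forall a x, coneA a -> coneX x -> coneX (pi a x).
Hypothesis piE : forall a f x, Cc f ->
  pi a (T (iota f) x) = T (iota (algebra_act a f)) x.
Hypothesis lU : forall s, linear (U s).
Hypothesis U_le : forall s x, `|U s x| <= CU * w s * `|x|.
Hypothesis U_pos : forall s x, coneX x -> coneX (U s x).
Hypothesis UE : forall s f x, Cc f ->
  U s (T (iota f) x) = T (iota (group_act s f)) x.
Hypotheses (Cpi0 : 0 <= Cpi) (CU0 : 0 <= CU).

Let bounded_pi a : bounded_operator (pi a).
Proof. by split => //; exists (Cpi * `|a|) => x; exact: pi_le. Qed.

Let bounded_U s : bounded_operator (U s).
Proof. by split => //; exists (CU * w s) => x; exact: U_le. Qed.

Lemma generated_representation : representation mulA pi.
Proof.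
split=> //.
- move=> c a1 a2; apply: (brep_operator_eq HL HT) => //.
    exact: bounded_operatorZD.
  move=> f x Cf; rewrite !piE // -(rep_linearl rT x) -(iota_linear HL);
    [|exact: algebra_act_Cc|exact: algebra_act_Cc].
  congr (T (iota _) x); apply/funext => t.
  by rewrite /algebra_act (mulA_linearl Halpha).
- move=> a1 a2; apply: (brep_operator_eq HL HT) => //.
    exact: bounded_operator_comp.
  move=> f x Cf; rewrite !piE //; last exact: algebra_act_Cc.
  by congr (T (iota _) x); apply/funext => t;
    rewrite /algebra_act (mulAA Halpha).
Qed.

Lemma generated_mulg s t x : U (s * t)%g x = U s (U t x).
Proof.
move: x; apply: (brep_operator_eq HL HT) => //;
  first exact: bounded_operator_comp.
move=> f x Cf; rewrite !UE //; last exact: group_act_Cc.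
congr (T (iota _) x); apply/funext => r.
by rewrite /group_act /act_on (alpha_mulg Halpha) invgM mulgA.
Qed.

Lemma generated1 x : U 1%g x = x.
Proof.
move: x; apply: (brep_operator_eq HL HT) => //;
  first exact: bounded_operator_id.
move=> f x Cf; rewrite UE //; congr (T (iota _) x); apply/funext => r.
by rewrite /group_act /act_on (alpha1 Halpha) invg1 mul1g.
Qed.

Lemma generated_covariance s a x : pi (alpha s a) x = U s (pi a (U s^-1%g x)).
Proof.
move: x; apply: (brep_operator_eq HL HT) => //.
  by apply: bounded_operator_comp => //; exact: bounded_operator_comp.
move=> f x Cf; rewrite UE // !piE //; last exact: group_act_Cc.
rewrite UE; last by apply: algebra_act_Cc; exact: group_act_Cc.
congr (T (iota _) x); apply/funext => r.
rewrite /group_act /algebra_act /act_on /= (alphaM Halpha) -(alpha_mulg Halpha).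
by rewrite mulgV (alpha1 Halpha) invgK mulVKg.
Qed.

Lemma generated_continuous x : continuous (U^~ x).
Proof.
move=> s0; have [c wc] := weight_near hausG Hmu Hw s0.
have wc0 := ltW (weight_gt0 Hw s0); have c0 := le_trans wc0 (nbhs_singleton wc).
have cl : closed [set x | U s x @[s --> s0] --> U s0 x].
  apply: (@strong_cvg_to_closed _ X _ _ _ U (CU * c)) => //.
  - by rewrite mulr_ge0.
  - by apply: nearW => s; exact: lU.
  - apply: filterS wc => s ws y; rewrite (le_trans (U_le _ _)) // ler_wpM2r //.
    by rewrite ler_wpM2l.
  - move=> y; rewrite (le_trans (U_le _ _)) // ler_wpM2r // ler_wpM2l //.
    exact: nbhs_singleton wc.
move: x; apply: (brep_ind HL HT cl) => /=.
- rewrite (_ : (fun s => U s 0) = cst 0);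
    first by rewrite (linear_zero (lU s0)); exact: cvg_cst.
  by apply/funext => s; rewrite (linear_zero (lU s)).
- move=> a x y Ux Uy; rewrite (lU s0) (_ : (fun s => U s (a *: x + y)) =
    (fun s => a *: U s x + U s y)).
    by apply: cvgD => //; apply: cvgZ => //; exact: cvg_cst.
  by apply/funext => s; rewrite (lU s).
- move=> f x Cf; rewrite UE //.
  rewrite (_ : (fun s => U s _) = (fun s => T (iota (group_act s f)) x)).
    exact: (cvg_continuous_comp (rep_continuousl rT bT (x := x))
      (iota_group_act_continuous Cf (x := s0))).
  by apply/funext => s; rewrite UE.
Qed.

Lemma generated_nondegenerate : Defs.nondegenerate pi.
Proof.
have [_ _ [M uM]] := Hleft; have FI := directed_tails_proper Hle.
apply: closure_dense; apply: (brep_ind HL HT (@closed_closure _ _)).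
- exact: closure_span0.
- by move=> c x y; exact: closure_spanZD.
move=> f x Cf.
have h := cvg_continuous_comp (rep_continuousl rT bT (x := x))
  (iota_approximate_identity uM Cf).
apply: (closed_cvg _ (@closed_closure _ _) _ _ h); apply: nearW => i.
rewrite -piE //; apply: subset_closure; apply: sub_linear_span.
by exists (u i, T (iota f) x).
Qed.

Lemma generated_covariant :
  pos_nd_cont_covariant_rep mulA coneA coneX alpha w pi U.
Proof.
have rpi := generated_representation.
have posU s : positive_operator coneX (U s).
  by split => // _ [x Xx <-]; exact: U_pos.
split.
- split=> //.
  + by move=> a Aa; split => // _ [x Xx <-]; exact: pi_pos.
  + move=> s; split => //; exists (U s^-1%g); split => // x.
      by rewrite -generated_mulg mulVg generated1.
    by rewrite -generated_mulg mulgV generated1.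
  + exact: generated_mulg.
  + exact: generated_covariance.
- exact: generated_nondegenerate.
- by apply/(bounded_representationP rpi); exists Cpi.
- exact: generated_continuous.
- exists CU; split => // r; apply: opnorm_le => //.
  by rewrite mulr_ge0 // (weight_ge0 Hw).
Qed.

(** On a vector [T g x] the integrand [pi (f r) (U_r (T g x))] is
    [T (f(r) alpha_r(g(r^-1 .))) x], and [interchange] moves the integral inside
    [T], where it is the twisted convolution of [f] and [g]. *)
Lemma generated_integrated_form : integrated_form mu iota pi U T.
Proof.
have HpiU := generated_covariant.
have rpi := generated_representation.
apply: (integrated_form_of Halpha Hmu HpiU) => f x Cf.
have ccf := cc_on_supp Cf; have cf : compact (supp f) by case: Cf.
have [CU' HCU] := growth_exists HpiU.
move: x; apply: (brep_operator_eq HL HT).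
- exact: (rep_bounded rT).
- split; first exact: (integrated_linear Halpha Hmu HpiU Cf).
  exists (CU' * repnorm pi * `|iota f|) => x.
  exact: (integrated_le Halpha Hmu Hw HL HpiU HCU).
move=> g x Cg; have ccg := cc_on_supp Cg.
have cg : compact (supp g) by case: Cg.
have cfg : compact (mul_set (supp f) (supp g)) by exact: compact_mulg.
have [C C0 HC] := iota_le Halpha Hmu Hw HL cfg.
rewrite -(repM rT) (beurling_conv HL) // twisted_convE.
pose Lam h := T (iota h) x.
have LamZD c (h1 h2 : G -> A) : cc_on (mul_set (supp f) (supp g)) h1 ->
    cc_on (mul_set (supp f) (supp g)) h2 ->
    Lam (fun s => c *: h1 s + h2 s) = c *: Lam h1 + Lam h2.
  move=> cc1 cc2; rewrite /Lam (iota_linear_cc Halpha HL cfg) //.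
  exact: (rep_linearl rT x).
have Lam_le (h : G -> A) e : cc_on (mul_set (supp f) (supp g)) h -> 0 <= e ->
    (forall s, `|h s| <= e) -> `|Lam h| <= repnorm T * C * `|x| * e.
  move=> cch e0 he; rewrite (le_trans (le_repnorm rT bT _ _)) //.
  have -> : repnorm T * C * `|x| * e = repnorm T * (C * e) * `|x| by ring.
  rewrite ler_wpM2r // ler_wpM2l ?(repnorm_ge0 rT bT) //; exact: HC.
rewrite -/(Lam _) (interchange hausG Hmu cf cfg LamZD Lam_le
  (twisted_integrand_continuous Halpha Hunif ccf ccg)
  (twisted_integrand_vanishes Halpha ccf ccg)).
rewrite /integrated; congr bochner; apply/funext => r.
by rewrite UE // piE //; exact: group_act_Cc.
Qed.

End generators.

Lemma disintegration_exists : exists (pi : A -> X -> X) (U : G -> X -> X),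
  [/\ pos_nd_cont_covariant_rep mulA coneA coneX alpha w pi U,
      disintegrated_form mulA iota Z z le u T pi U &
      integrated_form mu iota pi U T].
Proof.
have [_ _ [M uM]] := Hleft.
have [[i0] _ _ _] := Hle; have M0 : 0 <= M by exact: le_trans (uM i0).
have [c c0 Hc] := operator_net_limit Halpha Hunif Hmu Hw HL HZ Hz Hle HT.
have coneM : forall a b, coneA a -> coneA b -> coneA (mulA a b).
  by have [[[_ _ _ cM] _] _ _ _ _] := Halpha.
have FI := directed_tails_proper Hle.
have /choice [pi Hpi] : forall a, exists Q : X -> X,
  [/\ linear Q, forall x, `|Q x| <= c * (`|a| * M) * w 1%g * `|x|,
      forall x, T (iota (tensor (translated_density z p.1 1%g)
        (mulA a (u p.2)))) x
        @[p --> pair_tails Z le] --> Q x &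
      forall f x, Cc f -> Q (T (iota f) x) = T (iota (algebra_act a f)) x].
  move=> a; have [|a'|Q [lQ bQ cQ QE]] := Hc (fun i => mulA a (u i)) (`|a| * M)
      (mulA a) 1%g _ (mulA_bounded Halpha a).
  - by move=> i; rewrite (le_trans (mulA_norm Halpha _ _)) // ler_wpM2l.
  - rewrite (_ : (fun i => _) = (fun i => mulA a (mulA (u i) a'))).
      exact: (cvg_continuous_comp
        (bounded_operator_continuous (mulA_bounded Halpha a))
        (u_cvg (a := a'))).
    by apply/funext => i; rewrite (mulAA Halpha).
  by exists Q; split => // f x Cf; rewrite QE // algebra_actE.
have /choice [U HU] : forall s, exists Q : X -> X,
  [/\ linear Q, forall x, `|Q x| <= c * M * w s * `|x|,
      forall x, T (iota (tensor (translated_density z p.1 s) (u p.2))) x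
        @[p --> pair_tails Z le] --> Q x &
      forall f x, Cc f -> Q (T (iota f) x) = T (iota (group_act s f)) x].
  by move=> s; exact: Hc uM (bounded_operator_id A) u_cvg.
have lpi a : linear (pi a) by have [] := Hpi a.
have piE a f x : Cc f -> pi a (T (iota f) x) = T (iota (algebra_act a f)) x.
  by have [_ _ _ E] := Hpi a; exact: E.
have pi_le a x : `|pi a x| <= c * M * w 1%g * `|a| * `|x|.
  have [_ piQ _ _] := Hpi a; rewrite (le_trans (piQ x)) //.
  by have -> : c * (`|a| * M) * w 1%g = c * M * w 1%g * `|a| by ring.
have pi_pos a x : coneA a -> coneX x -> coneX (pi a x).
  move=> Aa; have [_ _ cvgpi _] := Hpi a.
  apply: (limit_positive (b := fun i => mulA a (u i)) _ cvgpi) => i.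
  by apply: coneM => //; exact: u_pos.
have lU s : linear (U s) by have [] := HU s.
have UE s f x : Cc f -> U s (T (iota f) x) = T (iota (group_act s f)) x.
  by have [_ _ _ E] := HU s; exact: E.
have U_le s x : `|U s x| <= c * M * w s * `|x| by have [_ UQ _ _] := HU s.
have U_pos s x : coneX x -> coneX (U s x).
  have [_ _ cvgU _] := HU s.
  by apply: (limit_positive (b := u) _ cvgU) => i; exact: u_pos.
have cM0 : 0 <= c * M by rewrite mulr_ge0.
have cMw0 : 0 <= c * M * w 1%g by rewrite mulr_ge0 // (weight_ge0 Hw).
exists pi, U; split.
- exact: (generated_covariant lpi pi_le pi_pos piE lU U_le U_pos UE cMw0 cM0).
- split.
    move=> a x; have [_ _ cvgpi _] := Hpi a.
    rewrite (_ : (fun p => _) = (fun p : set G * I =>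
      T (iota (tensor (translated_density z p.1 1%g) (mulA a (u p.2)))) x)) //.
    by apply/funext => p; rewrite translated_density1.
  by move=> s x; have [_ _ cvgU _] := HU s.
- exact: (generated_integrated_form lpi pi_le pi_pos piE lU U_le U_pos UE cMw0
    cM0).
Qed.

End covariant_representation.

(** * Norm estimates and the correspondence *)

Section inf_sup_weight.
Context (R : realType) (G : topologicalGroupType).
Variable mu : {measure set (borel G) -> \bar R}.
Hypothesis hausG : hausdorff_space G.
Hypothesis Hmu : left_haar_measure mu.
Variable w : G -> R.
Hypothesis Hw : weight w.
Variable Z : set (set G).
Hypothesis HZ : small_nbhs_base Z.

Lemma le_sup_weight V v : Z V -> V v -> w v <= sup (w @` V).
Proof.
move=> ZV Vv; have [_ _ [K cK ZK]] := HZ.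
have [c _ wc] := weight_compact hausG Hmu Hw cK.
apply: ub_le_sup; last by exists v.
by exists c => _ [s Vs <-]; apply: wc; exact: (ZK _ ZV).
Qed.

Lemma le_inf_sup_weight (k y : R) : 0 <= k ->
  (forall V, Z V -> y <= sup (w @` V) * k) -> y <= inf_sup_weight Z w * k.
Proof.
move=> k0 Hy; have [V ZV _] : exists2 V, Z V & V `<=` setT.
  by have [_ Zb _] := HZ; exact: Zb filterT.
move: k0; rewrite le_eqVlt => /orP[/eqP k0|k0].
  by rewrite -k0 mulr0; have := Hy V ZV; rewrite -k0 mulr0.
rewrite -ler_pdivrMr //; apply: lb_le_inf; first by exists (sup (w @` V)), V.
by move=> _ [W ZW <-]; rewrite ler_pdivrMr // Hy.
Qed.

Lemma inf_sup_weight_ge0 : 0 <= inf_sup_weight Z w.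
Proof.
have [Znbhs _ _] := HZ.
rewrite -[leRHS]mulr1; apply: le_inf_sup_weight => // V ZV; rewrite mulr1.
by rewrite (le_trans (weight_ge0 Hw 1%g)) // le_sup_weight //;
  exact: nbhs_singleton (Znbhs _ ZV).
Qed.

End inf_sup_weight.

Section correspondence.
Context (R : realType) (A : completeNormedModType R) (mulA : A -> A -> A).
Context (coneA : set A) (G : topologicalGroupType) (alpha : G -> A -> A).
Variable mu : {measure set (borel G) -> \bar R}.
Variable w : G -> R.
Context (L : completeNormedModType R) (iota : (G -> A) -> L) (mulL : L -> L ->
  L).
Context (X : completeNormedModType R) (coneX : set X).
Hypothesis Halpha : dynamical_system mulA coneA alpha.
Hypothesis Hunif : uniformly_bounded alpha.
Hypothesis Hmu : left_haar_measure mu.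
Hypothesis Hw : weight w.
Hypothesis HL : beurling_algebra mu mulA alpha w iota mulL.
Hypotheses (HX : is_cone coneX) (HXc : closed coneX).
Context (Z : set (set G)) (z : set G -> G -> R).
Hypotheses (HZ : small_nbhs_base Z) (Hz : bump_family mu Z z).
Let hausG : hausdorff_space G := ds_hausdorff Halpha.

Section integrated_limits.
Variables (pi : A -> X -> X) (U : G -> X -> X) (T : L -> X -> X).
Hypothesis HpiU : pos_nd_cont_covariant_rep mulA coneA coneX alpha w pi U.
Hypothesis rT : representation mulL T.
Hypothesis bT : bounded_representation T.
Hypothesis HTpiU : integrated_form mu iota pi U T.

Lemma integrated_form_cvg (I : Type) (le : I -> I -> Prop) (b : I -> A) (M : R)
    (Q : X -> X) s x : directed le -> bounded_by b M ->
  (forall y, pi (b i) y @[i --> tails setT le] --> Q y) ->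
  T (iota (tensor (translated_density z p.1 s) (b p.2))) x
    @[p --> pair_tails Z le] --> Q (U s x).
Proof.
move=> dle bM bQ; have FP := pair_tails_proper HZ dle.
have h := integrated_density_cvg Halpha Hmu HpiU HZ Hz dle (s := s)
  (x := x) bM bQ.
apply: cvg_trans h; apply: near_eq_cvg.
apply: filterS (near_pair_tails_base HZ dle) => -[W i] /= ZW.
by rewrite (integrated_formE HTpiU) //; exact: (tensor_Cc Halpha Hmu Hz).
Qed.

Lemma integrated_form_disintegrated (I : Type) (le : I -> I -> Prop)
  (u : I -> A) :
  positive_bounded_approximate_left_identity mulA coneA le u ->
  disintegrated_form mulA iota Z z le u T pi U.
Proof.
move=> [[dle ua] _ [M uM]]; have FI := directed_tails_proper dle.
have rpi := cov_rep HpiU; have bpi := cov_bounded HpiU.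
have u1 y : pi (u i) y @[i --> tails setT le] --> y.
  exact: (approximate_identity_strong HpiU dle ua uM).
split => [a x|s x]; last first.
  exact: (integrated_form_cvg (Q := id) (s := s) (x := x) dle uM u1).
have bM : bounded_by (fun i => mulA a (u i)) (`|a| * M).
  by move=> i; rewrite (le_trans (mulA_norm Halpha _ _)) // ler_wpM2l.
have bQ y : pi (mulA a (u i)) y @[i --> tails setT le] --> pi a y.
  rewrite (_ : (fun i => _) = (fun i => pi a (pi (u i) y))).
    exact: (cvg_continuous_comp (rep_continuous rpi (b := a)) (u1 y)).
  by apply/funext => i; rewrite (repM rpi).
have := integrated_form_cvg (s := 1%g) (x := x) dle bM bQ; rewrite (cov1 HpiU).
rewrite (_ : (fun p => _) = (fun p : set G * I =>
  T (iota (tensor (z p.1) (mulA a (u p.2)))) x)) //.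
by apply/funext => p; rewrite translated_density1.
Qed.

(** The norm of [z_W(s^-1 .) (x) b_i] in the algebra is at most [c M] for every
    [W] inside [V], and this bound survives the strong limit. *)
Lemma integrated_limit_le (I : Type) (le : I -> I -> Prop) (b : I -> A) (M : R)
    (Q : X -> X) s x V c : directed le -> bounded_by b M ->
  (forall y, pi (b i) y @[i --> tails setT le] --> Q y) -> Z V ->
  (forall v, V v -> w (s * v)%g <= c) ->
  `|Q (U s x)| <= repnorm T * (c * M) * `|x|.
Proof.
move=> dle bM bQ ZV wc; have FP := pair_tails_proper HZ dle.
have [[i0] _ _ _] := dle; have M0 : 0 <= M by exact: le_trans (bM i0).
have [Znbhs _ _] := HZ.
have c0 : 0 <= c.
  by rewrite (le_trans (weight_ge0 Hw _) (wc _ (nbhs_singleton (Znbhs _ ZV)))).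
have nh : `|T (iota (tensor (translated_density z p.1 s) (b p.2))) x|
    @[p --> pair_tails Z le] --> `|Q (U s x)|.
  by apply: cvg_norm; exact: integrated_form_cvg dle bM bQ.
apply: (cvgr_to_le nh).
apply: filterS (near_pair_tails_sub dle ZV) => -[W i] [/= ZW WV].
rewrite (le_trans (le_repnorm rT bT _ _)) // ler_wpM2r //.
rewrite ler_wpM2l ?(repnorm_ge0 rT bT) //.
have Wc v : W v -> w (s * v)%g <= c by move=> /WV; exact: wc.
rewrite (le_trans (iota_tensor_le Halpha Hmu Hw HL Hz (b i) ZW Wc)) //.
by rewrite ler_wpM2l.
Qed.

Lemma integrated_form_norm CU : growth_bound w U CU ->
  repnorm T <= CU * repnorm pi.
Proof.
move=> HCU; have [CU0 _] := HCU.
have k0 : 0 <= CU * repnorm pi.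
  by rewrite mulr_ge0 // (repnorm_ge0 (cov_rep HpiU) (cov_bounded HpiU)).
apply: repnorm_le => // l x.
apply: (dense_closed_ind (beurling_dense HL)
  (P := [set l | `|T l x| <= CU * repnorm pi * `|l| * `|x|])).
  rewrite (_ : [set l | _] = (fun l => CU * repnorm pi * `|l| * `|x| - `|T l x|)
    @^-1` [set y | 0 <= y]); last by apply/seteqP; split => m /=;
      rewrite subr_ge0.
  apply: (continuous_closedP _).1; last exact: closed_ge.
  move=> m; apply: cvgB.
    apply: cvgMl; apply: cvgMr; apply: cvg_norm; exact: cvg_id.
  by apply: cvg_norm; exact: (rep_continuousl rT bT).
move=> _ [f Cf <-] /=; rewrite (integrated_formE HTpiU) //.
exact: (integrated_le Halpha Hmu Hw HL HpiU HCU).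
Qed.

(** The constant net [a] computes [pi a], so only the densities contribute to
    the constant. *)
Lemma covariant_algebra_norm : repnorm pi <= inf_sup_weight Z w * repnorm T.
Proof.
have t0 := repnorm_ge0 rT bT.
apply: repnorm_le.
  by rewrite mulr_ge0 // (inf_sup_weight_ge0 hausG Hmu Hw HZ).
move=> a x; pose le (_ _ : unit) := True.
have dle : directed le by split => //; exists tt.
have FI := directed_tails_proper dle.
rewrite -2!mulrA; apply: (le_inf_sup_weight HZ); first by rewrite !mulr_ge0.
move=> V ZV.
have bQ y : pi ((fun _ : unit => a) i) y @[i --> tails setT le] --> pi a y.
  exact: cvg_cst.
have Vc v : V v -> w (1 * v)%g <= sup (w @` V).
  by rewrite mul1g; exact: (le_sup_weight hausG Hmu Hw HZ).
have := integrated_limit_le x dle (b := fun=> a) (M := `|a|)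
  (fun=> lexx _) bQ ZV Vc.
rewrite (cov1 HpiU) => /le_trans; apply.
by have -> : repnorm T * (sup (w @` V) * `|a|) * `|x| =
  sup (w @` V) * (repnorm T * (`|a| * `|x|)) by ring.
Qed.

(** Every bounded approximate left identity computes [U s], whether or not it is
    the positive one that defines it. *)
Lemma covariant_group_norm M s : has_bounded_approximate_left_identity mulA M ->
  opnorm (U s) <= M * inf_sup_weight Z w * repnorm T * w s.
Proof.
move=> [I [le [v [[dle va] vM]]]]; have t0 := repnorm_ge0 rT bT.
have [[i0] _ _ _] := dle; have M0 : 0 <= M by exact: le_trans (vM i0).
have ws0 := weight_ge0 Hw s.
apply: opnorm_le.
  by rewrite !mulr_ge0 // (inf_sup_weight_ge0 hausG Hmu Hw HZ).
move=> x; have -> : M * inf_sup_weight Z w * repnorm T * w s * `|x| =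
  inf_sup_weight Z w * (M * repnorm T * w s * `|x|) by ring.
apply: (le_inf_sup_weight HZ); first by rewrite !mulr_ge0.
move=> V ZV.
have bQ y : pi (v i) y @[i --> tails setT le] --> y.
  exact: (approximate_identity_strong HpiU dle va vM).
have Vc t : V t -> w (s * t)%g <= w s * sup (w @` V).
  move=> Vt; rewrite (le_trans (weightM Hw _ _)) // ler_wpM2l //.
  exact: (le_sup_weight hausG Hmu Hw HZ).
have := integrated_limit_le (Q := id) x dle vM bQ ZV Vc => /le_trans; apply.
by have -> : repnorm T * (w s * sup (w @` V) * M) * `|x| =
  sup (w @` V) * (M * repnorm T * w s * `|x|) by ring.
Qed.

End integrated_limits.

Lemma disintegrated_form_unique (I : Type) (le : I -> I -> Prop) (u : I -> A)
    (T : L -> X -> X) pi U pi' U' : directed le ->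
  disintegrated_form mulA iota Z z le u T pi U ->
  disintegrated_form mulA iota Z z le u T pi' U' -> pi' = pi /\ U' = U.
Proof.
move=> dle [cpi cU] [cpi' cU']; have FP := pair_tails_proper HZ dle.
split; apply/funext => t; apply/funext => x.
  exact: (cvg_norm_unique (cpi' t x) (cpi t x)).
exact: (cvg_norm_unique (cU' t x) (cU t x)).
Qed.

Lemma integrated_form_unique pi U (T T' : L -> X -> X) :
  representation mulL T -> bounded_representation T ->
  representation mulL T' -> bounded_representation T' ->
  integrated_form mu iota pi U T -> integrated_form mu iota pi U T' -> T' = T.
Proof.
move=> rT bT rT' bT' HT HT'; apply/funext => l; apply/funext => x.
apply: (dense_closed_ind (beurling_dense HL) (P := [set l | T' l x = T l x])).
  apply: closed_eq_fun; first exact: (rep_continuousl rT' bT').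
  exact: (rep_continuousl rT bT).
by move=> _ [f Cf <-] /=;
  exact: (bochner_integral_unique (HT' f Cf x) (HT f Cf x)).
Qed.

End correspondence.

Theorem theorem5p9 (R : realType)
    (A : completeNormedModType R) (mulA : A -> A -> A) (coneA : set A)
    (G : topologicalGroupType) (alpha : G -> A -> A)
    (mu : {measure set (borel G) -> \bar R}) (w : G -> R)
    (L : completeNormedModType R) (iota : (G -> A) -> L) (mulL : L -> L -> L)
    (X : completeNormedModType R) (coneX : set X)
    (Z : set (set G)) (z : set G -> G -> R)
    (I : Type) (le : I -> I -> Prop) (u : I -> A)
    (Halpha : dynamical_system mulA coneA alpha)
    (Hright : has_bounded_approximate_right_identity mulA)
    (Hleft : positive_bounded_approximate_left_identity mulA coneA le u)
    (Hunif : uniformly_bounded alpha)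
    (Hmu : left_haar_measure mu)
    (Hw : weight w)
    (HL : beurling_algebra mu mulA alpha w iota mulL)
    (HX : is_cone coneX) (HXc : closed coneX)
    (HZ : small_nbhs_base Z)
    (Hz : bump_family mu Z z) :
  let coneL := beurling_cone coneA iota in
  let covariant_reps pi U :=
    pos_nd_cont_covariant_rep mulA coneA coneX alpha w pi U in
  let reps T := pos_nd_bounded_rep mulL coneL coneX T in
  let T_of pi U T := integrated_form mu iota pi U T in
  let piU_of T pi U := disintegrated_form mulA iota Z z le u T pi U in
  [/\
    (* (pi, U) |-> T^(pi, U) is well defined, and T |-> (pi^T, U^T) undoes it *)
    forall (pi : A -> X -> X) (U : G -> X -> X), covariant_reps pi U ->
      exists T : L -> X -> X,
        [/\ reps T,
            T_of pi U T,
            forall T' : L -> X -> X, representation mulL T' ->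
              bounded_representation T' -> T_of pi U T' -> T' = T &
            piU_of T pi U],
    (* T |-> (pi^T, U^T) is well defined, and (pi, U) |-> T^(pi, U) undoes it *)
    forall T : L -> X -> X, reps T ->
      exists (pi : A -> X -> X) (U : G -> X -> X),
        [/\ covariant_reps pi U,
            piU_of T pi U,
            forall (pi' : A -> X -> X) (U' : G -> X -> X),
              piU_of T pi' U' -> pi' = pi /\ U' = U &
            T_of pi U T] &
    forall M : R, has_bounded_approximate_left_identity mulA M ->
      [/\ forall (pi : A -> X -> X) (U : G -> X -> X) (T : L -> X -> X) (CU : R),
            covariant_reps pi U -> growth_bound w U CU ->
            reps T -> T_of pi U T ->
            repnorm T <= CU * repnorm pi,
          forall (T : L -> X -> X) (pi : A -> X -> X) (U : G -> X -> X),
            reps T -> piU_of T pi U ->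
            repnorm pi <= inf_sup_weight Z w * repnorm T &
          forall (T : L -> X -> X) (pi : A -> X -> X) (U : G -> X -> X),
            reps T -> piU_of T pi U ->
            forall s, opnorm (U s) <= M * inf_sup_weight Z w * repnorm T * w s]].
Proof.
move=> coneL covariant_reps reps T_of piU_of.
have Hle : directed le by case: Hleft => -[].
split.
- move=> pi U HpiU.
  have [T [lTl lT TC TE]] := representation_exists Halpha Hmu Hw HL HpiU.
  have repT : reps T.
    exact: (integrated_representation Halpha Hunif Hmu Hw HL HpiU HX HXc HZ Hz
      lTl lT TC TE).
  have TpiU : T_of pi U T := integrated_form_of Halpha Hmu HpiU TE.
  have rT := brep repT; have bT := brep_bounded repT.
  exists T; split => //.
    by move=> T' rT' bT'; exact: (integrated_form_unique HL rT bT rT' bT' TpiU).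
  exact: (integrated_form_disintegrated Halpha Hmu HZ Hz HpiU TpiU Hleft).
- move=> T repT.
  have [pi [U [HpiU dT TpiU]]] :=
    disintegration_exists Halpha Hunif Hmu Hw HL HXc HZ Hz Hleft repT.
  exists pi, U; split => // pi' U';
    exact: (disintegrated_form_unique HZ Hle dT).
- move=> M HM.
  have from_T T pi U : reps T -> piU_of T pi U ->
      covariant_reps pi U /\ T_of pi U T.
    move=> repT dT.
    have [pi0 [U0 [HpiU0 dT0 TpiU0]]] :=
      disintegration_exists Halpha Hunif Hmu Hw HL HXc HZ Hz Hleft repT.
    by have [-> ->] := disintegrated_form_unique HZ Hle dT0 dT.
  split.
  + move=> pi U T CU HpiU HCU repT TpiU.
    exact: (integrated_form_norm Halpha Hmu Hw HL HpiU (brep repT)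
      (brep_bounded repT) TpiU HCU).
  + move=> T pi U repT /(from_T _ _ _ repT) [HpiU TpiU].
    exact: (covariant_algebra_norm Halpha Hmu Hw HL HZ Hz HpiU (brep repT)
      (brep_bounded repT) TpiU).
  + move=> T pi U repT /(from_T _ _ _ repT) [HpiU TpiU] s.
    exact: (covariant_group_norm Halpha Hmu Hw HL HZ Hz HpiU (brep repT)
      (brep_bounded repT) TpiU s HM).
Qed.
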